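(* Let $T\subset E^3$ be an anchor ring (torus of revolution) with circles of radii $a$ and $b$ satisfying $a/b=\sqrt{2}$, and let $M\subset E^3$ be a cyclide of Dupin given as the image of $T$ under an inversion of $E^3$. Let $A$ be the area of $M$ and $\lambda_1$ the first nonzero eigenvalue of the Laplace-Beltrami operator of $M$ with respect to the metric induced from $E^3$. Then $$\lambda_1<\frac{4\pi^2}{A}.$$
   Context: The anchor ring with circles of radii $a>b>0$ is the torus of revolution in $E^3$ obtained by rotating a circle of radius $b$ about a coplanar axis at distance $a$ from the center of the circle; up to a rigid motion it is $\{((a+b\cos u)\cos v,(a+b\cos u)\sin v,b\sin u):0\le u,v<2\pi\}$. An inversion of $E^3$ is a map $y\mapsto p+\frac{c^2}{|y-p|^2}(y-p)$ with center $p\in E^3$ and $c\ne 0$; the center $p$ is assumed not to lie on $T$, so that $M$ is compact. The Laplace-Beltrami operator is taken with the sign convention that its eigenvalues are nonnegative. *)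

(* Defs.v *)
From HB Require Import structures.
From mathcomp Require Import all_boot all_order all_algebra.
From mathcomp Require Import all_classical all_reals all_analysis.
Set Implicit Arguments.
Unset Strict Implicit.
Unset Printing Implicit Defensive.
Import Order.TTheory GRing.Theory Num.Theory.
Import numFieldNormedType.Exports.
Local Open Scope classical_set_scope.
Local Open Scope ring_scope.

(* Euclidean inner product of E^3. The library norm `|x| on 'rV[R]_3 is the sup
   norm, so |x|^2 is always written dot x x. *)
Definition dot (R : realType) (x y : 'rV[R]_3) : R :=
  \sum_(i < 3) x 0 i * y 0 i.

Definition vec3 (R : realType) (x y z : R) : 'rV[R]_3 :=
  \row_(i < 3) [:: x; y; z]`_i.

(* A torus in E^3 is handled through a doubly 2pi-periodic map X : R -> R -> E^3;
   surface X is the underlying set of points. *)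
Definition surface (R : realType) (X : R -> R -> 'rV[R]_3) : set 'rV[R]_3 :=
  [set y | exists u v, y = X u v].

(* The standard anchor ring moved by the isometry y |-> y Q + t of E^3, where Q
   is meant to be orthogonal. *)
Definition anchor_ring (R : realType) (a b : R) (Q : 'M[R]_3) (t : 'rV[R]_3)
    (u v : R) : 'rV[R]_3 :=
  vec3 ((a + b * cos u) * cos v) ((a + b * cos u) * sin v) (b * sin u) *m Q + t.

Definition inversion (R : realType) (p : 'rV[R]_3) (c : R) (y : 'rV[R]_3) :
    'rV[R]_3 :=
  p + (c ^+ 2 / dot (y - p) (y - p)) *: (y - p).

Definition inverted (R : realType) (p : 'rV[R]_3) (c : R)
    (X : R -> R -> 'rV[R]_3) (u v : R) : 'rV[R]_3 :=
  inversion p c (X u v).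

Lemma surface_inverted (R : realType) (p : 'rV[R]_3) (c : R)
    (X : R -> R -> 'rV[R]_3) :
  surface (inverted p c X) = inversion p c @` surface X.
Proof.
apply/seteqP; split => y /=.
  by move=> [u [v ->]]; exists (X u v) => //; exists u, v.
by move=> [_ [u [v ->]] <-]; exists u, v.
Qed.

Definition partial_u (R : realType) (V : normedModType R) (F : R -> R -> V)
    (u v : R) : V := derive1 (fun s => F s v) u.

Definition partial_v (R : realType) (V : normedModType R) (F : R -> R -> V)
    (u v : R) : V := derive1 (fun s => F u s) v.

(* F is of class C^k on the plane: it is jointly continuous and, for k > 0, its
   partial derivatives exist everywhere and are of class C^(k-1). *)
Fixpoint classC (R : realType) (V : normedModType R) (k : nat)
    (F : R -> R -> V) : Prop :=
  continuous (fun z : R * R => F z.1 z.2) /\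
  if k is k'.+1 then
    [/\ forall u v, derivable (fun s => F s v) u 1,
        forall u v, derivable (fun s => F u s) v 1,
        classC k' (partial_u F) &
        classC k' (partial_v F)]
  else True.

(* The first fundamental form E du^2 + 2 F du dv + G dv^2, i.e. the metric
   induced from E^3, and the area density. *)
Definition fundE (R : realType) (X : R -> R -> 'rV[R]_3) (u v : R) : R :=
  dot (partial_u X u v) (partial_u X u v).
Definition fundF (R : realType) (X : R -> R -> 'rV[R]_3) (u v : R) : R :=
  dot (partial_u X u v) (partial_v X u v).
Definition fundG (R : realType) (X : R -> R -> 'rV[R]_3) (u v : R) : R :=
  dot (partial_v X u v) (partial_v X u v).
Definition area_density (R : realType) (X : R -> R -> 'rV[R]_3) (u v : R) : R :=
  Num.sqrt (fundE X u v * fundG X u v - fundF X u v ^+ 2).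

Definition area (R : realType) (X : R -> R -> 'rV[R]_3) : R :=
  \int[(@lebesgue_measure R \x @lebesgue_measure R)%E]_(z in
     `[0, 2 * pi]%classic `*` `[0, 2 * pi]%classic) area_density X z.1 z.2.

(* - (det g)^(-1/2) \sum_(i, j) d_i ((det g)^(1/2) g^(i j) d_j h), where g^-1 has
   entries G, -F, -F, E divided by det g = E G - F^2. The leading minus sign
   makes the eigenvalues nonnegative. *)
Definition laplace_beltrami (R : realType) (X : R -> R -> 'rV[R]_3)
    (h : R -> R -> R) (u v : R) : R :=
  - (partial_u (fun s r : R =>
       (fundG X s r * partial_u h s r - fundF X s r * partial_v h s r)
         / area_density X s r) u v
     + partial_v (fun s r : R =>
       (fundE X s r * partial_v h s r - fundF X s r * partial_u h s r)
         / area_density X s r) u v)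
  / area_density X u v.

(* Eigenfunctions are functions on the closed surface itself: only the values of
   f on surface X matter, and the pullback of f by X is automatically doubly
   periodic. Since X is an immersion, f is of class C^2 on the surface exactly
   when its pullback is of class C^2 on the plane. *)
Definition is_eigenvalue (R : realType) (X : R -> R -> 'rV[R]_3) (mu : R) :
    Prop :=
  exists f : 'rV[R]_3 -> R,
    let h := fun u v : R => f (X u v) in
    [/\ classC 2 h,
        exists2 y, surface X y & f y != 0 &
        forall u v, laplace_beltrami X h u v = mu * h u v].

Definition is_first_nonzero_eigenvalue (R : realType) (X : R -> R -> 'rV[R]_3)
    (lambda1 : R) : Prop :=
  [/\ is_eigenvalue X lambda1, lambda1 != 0 &
      forall mu, is_eigenvalue X mu -> mu != 0 -> lambda1 <= mu].

(* Main.v *)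
Require Import Defs.
From HB Require Import structures.
From mathcomp Require Import all_boot all_order all_algebra.
From mathcomp Require Import all_classical all_reals all_analysis.
From mathcomp Require Import ring lra zify.
Import Order.TTheory GRing.Theory Num.Theory.
Import numFieldNormedType.Exports.
Set Implicit Arguments.
Unset Strict Implicit.
Unset Printing Implicit Defensive.
Local Open Scope classical_set_scope.
Local Open Scope ring_scope.

(** The ring with a / b = sqrt 2 has isothermal coordinates in which it is a square
    flat torus. In the same coordinates an inverted ring has, up to a constant factor,
    the metric w^(-2) (du^2 + dv^2) with w = sqrt 2 - al cos u - be cos v, where
    al, be >= 0, al^2 + be^2 = 1, and al <> be because the centre of inversion is off
    the ring. So an eigenfunction is a solution of - Laplacian H = mu w^(-2) H on the
    flat torus, and it suffices to find one with 0 < mu * \int w^(-2) < 4 pi^2.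

    Let be < al. The function sin v / w is odd in v and its Rayleigh quotient is smaller
    than 4 pi^2 / \int w^(-2); the integrals in v are elementary after the substitution
    that takes the true anomaly to the eccentric anomaly in Kepler's problem. A genuine
    eigenvalue below this bound comes from the Galerkin method on the span of
    cos (j u) sin (k v). Since al + be < sqrt 2, division by w preserves the decay of
    Fourier coefficients, so the Galerkin equations, in which the Laplacian multiplies by
    j^2 + k^2, improve the decay by two orders at each use, uniformly in the dimension
    of the Galerkin space. An ultrafilter limit of the Galerkin solutions is thus of class C^3
    and solves the equation; the residual tends to 0 because only edge frequencies
    contribute to it. *)

(** * Integration on the flat torus *)

Section torus_integral.
Context {R : realType}.
Local Notation mu := (@lebesgue_measure R).
Implicit Types (f g : R -> R -> R) (h k : R -> R).

(** The hypothesis on [lambda1] speaks only of eigenvalues of genuine C^2 eigenfunctions, so a small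
    Rayleigh quotient says nothing until a classical eigenfunction has been built from it. Oddness
    in v keeps the eigenvalue 0 away: all frequencies have k >= 1, so the Dirichlet energy is a norm
    on the Galerkin spaces. The origin of sin v / w is this. The ring with a / b = sqrt 2 is a
    stereographic image of the Clifford torus x = (cos u, sin u, cos v, sin v) / sqrt 2 of S^3. An
    inverted ring is, up to a similarity, its image from another pole e, which rotations of the
    torus bring to (al, 0, be, 0). As w = sqrt 2 (1 - <x, e>), the functions sin u / w and sin v / w
    are Euclidean coordinates of the cyclide, normal to its planes of symmetry. The relation al^2 +
    be^2 = 1 is |e| = 1, and al = be would put e on the torus. The coordinate taken belongs to the
    smaller of al and be. After integration in v, its quotient still contains elliptic integrals in
    u; these are estimated by AM-GM and Cauchy-Schwarz, sharply enough to reach the limit al =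
    be. *)

Definition der h (x l : R) : Prop := is_derive x (1 : R) h l.

Definition cont2 f := continuous (fun z : R * R => f z.1 z.2).

Definition circ : set R := `[0, 2 * pi]%classic.
Definition square : set (R * R) := circ `*` circ.

Definition I1 h : R := \int[mu]_(x in circ) h x.
Definition I2 f : R := \int[(mu \x mu)%E]_(z in square) f z.1 z.2.

(** The product sigma-algebra is generated by rectangles, so an open set is written as a countable
    union of them: squares with rational centre and half-side, enumerated through [unpickle]. *)
Lemma open_measurable2 (O : set (R * R)) : open O -> measurable O.
Proof.
move=> oO.
pose box (q : rat * rat * rat) : set (R * R) :=
  `](ratr q.1.1 - ratr q.2), (ratr q.1.1 + ratr q.2)[%classic `*`
  `](ratr q.1.2 - ratr q.2), (ratr q.1.2 + ratr q.2)[%classic.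
pose bx n := if unpickle n is Some q then box q else set0.
suff -> : O = \bigcup_(n in [set n | bx n `<=` O]) bx n.
  apply: bigcup_measurable => n _; rewrite /bx; case: unpickle => // q.
  by apply: measurableX; apply: measurable_itv.
apply/seteqP; split => [[x y] Oxy|z [q qO /qO//]].
have /nbhs_ballP[e/= e0 He] : nbhs (x, y) O by apply: open_nbhs_nbhs.
have [r /andP[r0 re]] : exists r : rat, 0 < (ratr r : R) < e / 2.
  have /rat_in_itvoo[r] : (0 : R) < e / 2 by rewrite divr_gt0.
  by rewrite in_itv/= => ?; exists r.
have [q1] : exists r1 : rat, (ratr r1 : R) \in `]x - ratr r, x + ratr r[.
  by apply: rat_in_itvoo; lra.
rewrite in_itv/= => /andP[q1a q1b].
have [q2] : exists r1 : rat, (ratr r1 : R) \in `]y - ratr r, y + ratr r[.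
  by apply: rat_in_itvoo; lra.
rewrite in_itv/= => /andP[q2a q2b].
exists (pickle (q1, q2, r)); rewrite /= /bx pickleK; last by split => /=; rewrite in_itv/=; apply/andP; split; lra.
move=> [x' y'] /= [] /=; rewrite !in_itv/= => /andP[? ?] /andP[? ?].
by apply: He; split; rewrite /ball/= ltr_norml; apply/andP; split; lra.
Qed.

Lemma cont2_measurable f : cont2 f ->
  measurable_fun setT (fun z : R * R => f z.1 z.2).
Proof.
move=> cf; apply: (measurability _ (measurable_realfun.RGenOpens.measurableE R)).
move=> _ [_ [a [b ->] <-]]; rewrite setTI.
apply: open_measurable2; apply: open_comp; last exact: interval_open.
by move=> z _; apply: cf.
Qed.

Lemma measurable_circ : measurable circ.
Proof. exact: measurable_itv. Qed.

Lemma measurable_square : measurable square.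
Proof. by apply: measurableX; exact: measurable_circ. Qed.

Lemma mu_circ : mu circ = (2 * pi)%:E.
Proof.
rewrite /circ lebesgue_measure_itv/= lte_fin ifT ?sube0//.
by rewrite mulr_gt0// pi_gt0.
Qed.

Lemma mu_square : (mu \x mu)%E square = ((2 * pi) ^+ 2)%:E.
Proof.
rewrite /square product_measure1E; [|exact: measurable_circ..].
transitivity ((2 * pi)%:E * (2 * pi)%:E : \bar R)%E; last by rewrite -EFinM expr2.
by congr (_ * _)%E; exact: mu_circ.
Qed.

Lemma compact_square : compact square.
Proof. by apply: compact_setX; exact: segment_compact. Qed.

Lemma cont2_bounded f : cont2 f ->
  exists2 M : R, 0 < M & forall z, square z -> `|f z.1 z.2| <= M.
Proof.
move=> cf.
have : compact ((fun z : R * R => f z.1 z.2) @` square).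
  apply: continuous_compact; last exact: compact_square.
  exact: continuous_subspaceT.
move=> /compact_bounded[M [Mr HM]].
exists (Num.max M 0 + 1); first by rewrite ltr_wpDl// le_max lexx orbT.
move=> z sz; apply: (HM (Num.max M 0 + 1)); last by exists z.
by rewrite (le_lt_trans (y := Num.max M 0))// ?le_max ?lexx// ltrDl.
Qed.

Lemma cont2_integrable f : cont2 f ->
  (mu \x mu)%E.-integrable square (EFin \o (fun z : R * R => f z.1 z.2)).
Proof.
move=> cf; apply: measurable_bounded_integrable.
- exact: measurable_square.
- by rewrite /= mu_square ltry.
- by apply: measurable_funS (cont2_measurable cf).
- have [M M0 HM] := cont2_bounded cf.
  exists M; split; first by rewrite num_real.
  by move=> x Mx z sz /=; apply: (le_trans (HM _ sz)); exact: ltW.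
Qed.

Lemma cont_integrable h : continuous h -> mu.-integrable circ (EFin \o h).
Proof.
move=> ch; apply: continuous_compact_integrable; first exact: segment_compact.
exact: continuous_subspaceT.
Qed.

Lemma I1_ext h k : h =1 k -> I1 h = I1 k.
Proof. by move=> e; congr I1; apply/funext. Qed.

Lemma I2_ext f g : (forall u v, f u v = g u v) -> I2 f = I2 g.
Proof. by move=> e; congr I2; apply/funext => u; apply/funext. Qed.

Lemma I1D h k : continuous h -> continuous k ->
  I1 (fun x => h x + k x) = I1 h + I1 k.
Proof.
move=> ch ck; rewrite /I1 RintegralD//; first exact: measurable_circ.
- exact: cont_integrable.
- exact: cont_integrable.
Qed.

Lemma I1Z c h : continuous h -> I1 (fun x => c * h x) = c * I1 h.
Proof.
move=> ch; rewrite /I1 RintegralZl//; first exact: measurable_circ.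
exact: cont_integrable.
Qed.

Lemma le_I1 h k : continuous h -> continuous k ->
  (forall x, h x <= k x) -> I1 h <= I1 k.
Proof.
move=> ch ck hk; apply: le_Rintegral => //; first exact: measurable_circ.
- exact: cont_integrable.
- exact: cont_integrable.
Qed.

Lemma I2D f g : cont2 f -> cont2 g ->
  I2 (fun u v => f u v + g u v) = I2 f + I2 g.
Proof.
move=> ch ck; rewrite /I2 RintegralD//; first exact: measurable_square.
- exact: cont2_integrable.
- exact: cont2_integrable.
Qed.

Lemma I2Z c f : cont2 f -> I2 (fun u v => c * f u v) = c * I2 f.
Proof.
move=> ch; rewrite /I2 RintegralZl//; first exact: measurable_square.
exact: cont2_integrable.
Qed.

Lemma le_I2 f g : cont2 f -> cont2 g ->
  (forall u v, circ u -> circ v -> f u v <= g u v) -> I2 f <= I2 g.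
Proof.
move=> ch ck hk; apply: le_Rintegral => //; first exact: measurable_square.
- exact: cont2_integrable.
- exact: cont2_integrable.
- by move=> [u v] [/= ? ?]; exact: hk.
Qed.

Lemma I2_cst c : I2 (fun _ _ => c) = c * (2 * pi) ^+ 2.
Proof.
rewrite /I2 Rintegral_cst; last exact: measurable_square.
by rewrite /= mu_square.
Qed.

Lemma cont2_l f u : cont2 f -> continuous (fun v => f u v).
Proof.
move=> cf v; apply: (@continuous_comp _ _ _ (fun v => (u, v)) (fun z : R * R => f z.1 z.2)).
  exact: (@cvg_pair _ _ _ (nbhs v) (nbhs u) (nbhs v) _ _ _ (fun=> u) id (cvg_cst u) cvg_id).
exact: cf.
Qed.

Lemma cont2_r f v : cont2 f -> continuous (fun u => f u v).
Proof.
move=> cf u; apply: (@continuous_comp _ _ _ (fun u => (u, v)) (fun z : R * R => f z.1 z.2)).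
  exact: (@cvg_pair _ _ _ (nbhs u) (nbhs u) (nbhs v) _ _ _ id (fun=> v) cvg_id (cvg_cst v)).
exact: cf.
Qed.

Lemma I1_fin h : continuous h ->
  ((I1 h)%:E = \int[mu]_(x in circ) (h x)%:E)%E.
Proof.
move=> ch; rewrite /I1 /Rintegral fineK//.
by apply: integrable_fin_num; [exact: measurable_circ|exact: cont_integrable].
Qed.

Lemma I2_iter f : cont2 f ->
  I2 f = I1 (fun u => I1 (f u)) /\ I2 f = I1 (fun v => I1 (f ^~ v)).
Proof.
move=> cf.
pose F := (EFin \o (fun z : R * R => f z.1 z.2)) \_ square.
have iF : (mu \x mu)%E.-integrable setT F.
  have := cont2_integrable cf.
  by move=> h; refine (proj1 (integrable_mkcond _ _) h); exact: measurable_square.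
have E0 : (\int[(mu \x mu)%E]_(z in square) (f z.1 z.2)%:E =
    \int[(mu \x mu)%E]_z F z)%E by rewrite integral_mkcond.
split; rewrite /I2 /I1 /Rintegral E0; congr fine.
  rewrite -(integral12_prod_meas1 iF) [RHS]integral_mkcond.
  apply: eq_integral => x _; rewrite /fubini_F /F patchE.
  case: ifPn => [xc|xc].
    transitivity (\int[mu]_(y in circ) (f x y)%:E)%E.
      rewrite [RHS]integral_mkcond; apply: eq_integral => y _.
      rewrite !patchE /square in_setX xc/=; case: ifP => // _.
    by rewrite -I1_fin//; exact: cont2_l.
  by rewrite integral0_eq// => y _; rewrite patchE in_setX (negbTE xc).
rewrite -(integral21_prod_meas1 iF) [RHS]integral_mkcond.
apply: eq_integral => y _; rewrite /fubini_G /F patchE.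
case: ifPn => [xc|xc].
  transitivity (\int[mu]_(x in circ) (f x y)%:E)%E.
    rewrite [RHS]integral_mkcond; apply: eq_integral => x _.
    by rewrite !patchE /square in_setX xc/= andbT; case: ifP.
  by rewrite -I1_fin//; exact: cont2_r.
by rewrite integral0_eq// => x _; rewrite patchE in_setX (negbTE xc) andbF.
Qed.

Lemma cont2_swap f : cont2 f -> cont2 (fun u v => f v u).
Proof.
move=> cf z; apply: (@continuous_comp _ _ _ (fun z : R * R => (z.2, z.1)) (fun z : R * R => f z.1 z.2)).
  exact: (@cvg_pair _ _ _ (nbhs z) (nbhs z.2) (nbhs z.1) _ _ _ snd fst cvg_snd cvg_fst).
exact: cf.
Qed.

Lemma I2_swap f : cont2 f -> I2 (fun u v => f v u) = I2 f.
Proof. by move=> cf; rewrite (I2_iter (cont2_swap cf)).1 (I2_iter cf).2. Qed.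

Lemma two_pi_gt0 : 0 < 2 * pi :> R.
Proof. by rewrite mulr_gt0// pi_gt0. Qed.

Lemma I1_FTC h (F : R -> R) : continuous h ->
  (forall x, circ x -> der F x (h x)) -> I1 h = F (2 * pi) - F 0.
Proof.
move=> ch dF; rewrite /I1 /Rintegral.
have dF' x : circ x -> derivable F x 1 by move=> /dF[].
have cF x : circ x -> {for x, continuous F}.
  by move=> /dF' ?; apply: differentiable_continuous; apply/derivable1_diffP.
have c0 : circ 0 by rewrite /circ/= in_itv/= lexx ltW// two_pi_gt0.
have c1 : circ (2 * pi) by rewrite /circ/= in_itv/= lexx ltW// two_pi_gt0.
rewrite (@continuous_FTC2 _ h F 0 (2 * pi))//.
- exact: two_pi_gt0.
- exact: continuous_subspaceT.
- split => //.
  + by move=> x xc; apply: dF'; exact: subset_itv_oo_cc xc.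
  + by apply: cvg_at_right_filter; exact: cF.
  + by apply: cvg_at_left_filter; exact: cF.
- move=> x xc; rewrite derive1E; case: (dF x) => //.
  exact: subset_itv_oo_cc xc.
Qed.

End torus_integral.

(** * Differentiation and change of variables *)

Section derivation_rules.
Context {R : realType}.
Implicit Types (f g : R -> R) (x a b : R).

Lemma der_eq f x a b : der f x a -> a = b -> der f x b.
Proof. by move=> h <-. Qed.

Lemma der_cst c x : der (fun _ : R => c : R) x 0.
Proof. exact: is_derive_cst. Qed.

Lemma der_id x : der (fun y : R => y) x 1.
Proof. exact: is_derive_id. Qed.

Lemma derD f g x a b : der f x a -> der g x b ->
  der (fun y => f y + g y) x (a + b).
Proof. by move=> h k; exact: is_deriveD. Qed.

Lemma derN f x a : der f x a -> der (fun y => - f y) x (- a).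
Proof. by move=> h; exact: is_deriveN. Qed.

Lemma derM f g x a b : der f x a -> der g x b ->
  der (fun y => f y * g y) x (a * g x + f x * b).
Proof.
move=> h k; apply: (der_eq (@is_deriveM _ _ f g x 1 a b h k)).
by rewrite /GRing.scale/= addrC (mulrC (g x)).
Qed.

Lemma der_comp f g x a b : der g x b -> der f (g x) a ->
  der (fun y => f (g y)) x (a * b).
Proof.
move=> h k; exact: (@is_derive1_comp _ f g x a b).
Qed.

Lemma derX f x a n : der f x a -> der (fun y => f y ^+ n) x (n%:R * f x ^+ n.-1 * a).
Proof.
move=> h; elim: n => [|n IH].
  by apply: der_eq (der_cst 1 x) _; rewrite !mul0r.
have -> : (fun y => f y ^+ n.+1) = (fun y => f y * f y ^+ n).
  by apply/funext => y; rewrite exprS.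
apply: der_eq (derM h IH) _ => /=.
case: n {IH} => [|n] /=; first by rewrite !expr0 !mul0r mulr0 mulr1 addr0 !mul1r.
by rewrite -(natr1 n.+1) exprS; ring.
Qed.

Lemma derV f x a : f x != 0 -> der f x a -> der (fun y => (f y)^-1) x (- (a / f x ^+ 2)).
Proof.
move=> n0 h; apply: (der_eq (is_deriveV n0 h)).
by rewrite /GRing.scale/= mulNr mulrC.
Qed.

Lemma der_sin f x a : der f x a -> der (fun y => sin (f y)) x (cos (f x) * a).
Proof. by move=> h; apply: der_comp h (is_derive_sin _). Qed.

Lemma der_cos f x a : der f x a -> der (fun y => cos (f y)) x (- sin (f x) * a).
Proof. by move=> h; apply: der_comp h (is_derive_cos _). Qed.

Lemma der_atan f x a : der f x a -> der (fun y => atan (f y)) x (a / (1 + f x ^+ 2)).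
Proof.
move=> h; apply: der_eq (der_comp h (is_derive1_atan _)) _.
by rewrite mulrC.
Qed.

Lemma der_sqrt f x a : 0 < f x -> der f x a ->
  der (fun y => Num.sqrt (f y)) x (a / (2 * Num.sqrt (f x))).
Proof.
move=> f0 h; apply: der_eq (der_comp h (is_derive1_sqrt f0)) _.
by rewrite mulrC.
Qed.

Lemma der_cont f : (forall x, exists l, der f x l) -> continuous f.
Proof.
move=> h x; have [l hl] := h x; apply: differentiable_continuous.
by apply/derivable1_diffP; case: hl.
Qed.

Lemma der_ext f g x a : f =1 g -> der f x a -> der g x a.
Proof. by move=> /funext ->. Qed.

Lemma der_unique f x a b : der f x a -> der f x b -> a = b.
Proof. by move=> [_ <-] [_ <-]. Qed.

Lemma derive1_der f x a : der f x a -> derive1 f x = a.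
Proof. by move=> [_ <-]; rewrite derive1E. Qed.

Lemma der0_cst f : (forall x, der f x 0) -> forall x y, f x = f y.
Proof.
move=> h.
suff H x y : x < y -> f x = f y.
  by move=> x y; case: (ltgtP x y) => [/H|/H ->|->].
move=> xy; have [||z _] := @MVT_segment R f (fun _ => 0) x y (ltW xy).
- by move=> z _; exact: h.
- by apply: continuous_subspaceT; apply: der_cont => z; exists 0.
- by rewrite mul0r => /eqP; rewrite subr_eq0 => /eqP ->.
Qed.

End derivation_rules.

(** The derivative is an existential variable that the rules fill in. [eassumption] comes first, so
    that a derivative already known for a compound term is used as a unit and not expanded.
    Conditions of nonvanishing and positivity remain as goals. *)
Ltac der1 := first
  [ eassumption
  | apply: der_cst
  | apply: der_id
  | match goal with H : forall _, der _ _ _ |- _ => apply: H end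
  | eapply derD | eapply derN | eapply derX | eapply derM
  | eapply derV | eapply der_sqrt | eapply der_sin | eapply der_cos | eapply der_atan
  | match goal with H : forall _, der _ _ _ |- _ => eapply der_comp; [|apply: H] end ].
Ltac ders := repeat der1.

Section continuity_rules.
Context {R : realType}.
Implicit Types (f g : R -> R -> R) (h : R -> R).

Lemma cont2_cst c : cont2 (fun _ _ : R => c : R).
Proof. by move=> z; exact: cvg_cst. Qed.

Lemma cont2_fst h : continuous h -> cont2 (fun u _ => h u).
Proof.
move=> ch z; apply: (@continuous_comp _ _ _ fst h); last exact: ch.
exact: cvg_fst.
Qed.

Lemma cont2_snd h : continuous h -> cont2 (fun _ v => h v).
Proof.
move=> ch z; apply: (@continuous_comp _ _ _ snd h); last exact: ch.
exact: cvg_snd.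
Qed.

Lemma cont2D f g : cont2 f -> cont2 g -> cont2 (fun u v => f u v + g u v).
Proof. by move=> cf cg z; apply: cvgD; [exact: cf|exact: cg]. Qed.

Lemma cont2N f : cont2 f -> cont2 (fun u v => - f u v).
Proof. by move=> cf z; apply: cvgN; exact: cf. Qed.

Lemma cont2M f g : cont2 f -> cont2 g -> cont2 (fun u v => f u v * g u v).
Proof. by move=> cf cg z; apply: cvgM; [exact: cf|exact: cg]. Qed.

Lemma cont2X f n : cont2 f -> cont2 (fun u v => f u v ^+ n).
Proof.
move=> cf; elim: n => [|n IH]; first exact: cont2_cst.
have -> : (fun u v => f u v ^+ n.+1) = (fun u v => f u v * f u v ^+ n).
  by apply/funext => u; apply/funext => v; rewrite exprS.
exact: cont2M.
Qed.

Lemma cont2V f : (forall u v, f u v != 0) -> cont2 f -> cont2 (fun u v => (f u v)^-1).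
Proof. by move=> n0 cf z; apply: cvgV; [exact: n0|exact: cf]. Qed.

Lemma cont2_comp f h k : cont2 f -> continuous h -> continuous k ->
  cont2 (fun u v => f (h u) (k v)).
Proof.
move=> cf ch ck z.
apply: (@continuous_comp _ _ _ (fun z : R * R => (h z.1, k z.2)) (fun z : R * R => f z.1 z.2)).
  exact: (@cvg_pair _ _ _ (nbhs z) (nbhs (h z.1)) (nbhs (k z.2)) _ _ _ _ _ (cont2_fst ch (x:=z)) (cont2_snd ck (x:=z))).
exact: cf.
Qed.

End continuity_rules.

Section continuity_1.
Context {R : realType}.
Implicit Types (h k : R -> R).

Lemma cont_cst (c : R) : continuous (fun _ : R => c).
Proof. by move=> x; exact: cvg_cst. Qed.

Lemma contD h k : continuous h -> continuous k -> continuous (fun x => h x + k x).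
Proof. by move=> ch ck x; apply: cvgD; [exact: ch|exact: ck]. Qed.

Lemma contM h k : continuous h -> continuous k -> continuous (fun x => h x * k x).
Proof. by move=> ch ck x; apply: cvgM; [exact: ch|exact: ck]. Qed.

Lemma I1_lin (a b : R) h k : continuous h -> continuous k ->
  I1 (fun x => a * h x + b * k x) = a * I1 h + b * I1 k.
Proof.
move=> ch ck; rewrite -!I1Z// I1D//; apply: contM => //; exact: cont_cst.
Qed.

End continuity_1.

Lemma eq_ler (R : realType) (x y : R) : x = y -> x <= y.
Proof. by move->. Qed.

Ltac derq := apply: der_eq; [ders|rewrite /=].
Ltac cont1 := let x := fresh in apply: der_cont => x; eexists; ders.
Ltac c2step := lazymatch goal with
  | |- cont2 (fun u v => @?f u v + @?g u v) => apply: (@cont2D _ f g)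
  | |- cont2 (fun u v => @?f u v * @?g u v) => apply: (@cont2M _ f g)
  | |- cont2 (fun u v => - @?f u v) => apply: (@cont2N _ f)
  | |- cont2 (fun u v => @?f u v ^+ ?n) => apply: (@cont2X _ f n)
  | |- cont2 (fun _ _ => ?c) => exact: cont2_cst
  | |- _ => eassumption
  end.
Ltac c2 := repeat c2step.

(** * Periodic substitution and a lower bound for integrals *)

Section more_integral.
Context {R : realType}.
Implicit Types (f g : R -> R -> R) (h k : R -> R).

(* The antiderivative of a periodic h gains the same amount over every period. *)
Lemma I1_subst h (phi dphi : R -> R) : continuous h ->
  (forall x, h (x + 2 * pi) = h x) -> continuous dphi ->
  (forall x, der phi x (dphi x)) -> phi (2 * pi) = phi 0 + 2 * pi ->
  I1 (fun x => h (phi x) * dphi x) = I1 h.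
Proof.
move=> ch ph cd dphi' phi2.
have cphi : continuous phi by apply: der_cont => x; exists (dphi x).
have [M M0 HM] := cont2_bounded (cont2_fst cphi).
have Hphi x : circ x -> `|phi x| <= M.
  move=> cx; apply: (HM (x, x)); by split.
have p0 := @two_pi_gt0 R.
pose K := M + 1.
pose F x := \int[@lebesgue_measure R]_(t in `[(- K), x]) h t.
have dF x : - K < x -> der F x (h x).
  move=> Kx.
  have x1 : x < x + 1 by rewrite ltrDl.
  have hi : (@lebesgue_measure R).-integrable `[(- K), (x + 1)] (EFin \o h).
    apply: continuous_compact_integrable; first exact: segment_compact.
    exact: continuous_subspaceT.
  have [dv e] := continuous_FTC1_closed x1 hi Kx (ch x).
  by split; [exact: dv|rewrite -derive1E; exact: e].
have hM x : `|x| <= M -> - K < x.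
  by rewrite ler_norml => /andP[h1 _]; rewrite /K; lra.
rewrite (@I1_FTC _ (fun x => h (phi x) * dphi x) (F \o phi)); last first.
- by move=> x cx; apply: der_comp; [exact: dphi'|apply: dF; apply: hM; exact: Hphi].
- move=> x; apply: cvgM; last exact: cd.
  by apply: continuous_comp; [exact: cphi|exact: ch].
have dlt x : - K < x -> - K < x + 2 * pi by move=> h1; lra.
have c0 : circ (0 : R) by rewrite /circ/= in_itv/= lexx ltW.
pose D x := F (x + 2 * pi) - F x.
have dD x : - K < x -> der D x 0.
  move=> Kx; have h1 := dF _ Kx; have h2 := dF _ (dlt _ Kx).
  apply: der_eq.
    by rewrite /D; apply: derD; [apply: (@der_comp _ F (fun x => x + 2 * pi)); [apply: derD; [exact: der_id|exact: der_cst]|exact: h2]|apply: derN; exact: h1].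
  by rewrite ph; ring.
have DD : forall x y, x < y -> - K < x -> D x = D y.
  move=> x y xy Kx.
  have Kz z : z \in `[x, y] -> der D z 0.
    by rewrite in_itv/= => /andP[xz _]; apply: dD; exact: lt_le_trans xz.
  have [||z _] := @MVT_segment _ D (fun _ => 0) x y (ltW xy).
  - by move=> z zi; apply: Kz; exact: subset_itv_oo_cc zi.
  - apply: continuous_in_subspaceT => z /set_mem zi; apply: differentiable_continuous.
    by apply/derivable1_diffP; case: (Kz z zi).
  - by rewrite mul0r => /eqP; rewrite subr_eq0 => /eqP ->.
have D0 : D (phi 0) = D 0.
  have h1 : - K < phi 0 by apply: hM; exact: Hphi.
  have h2 : - K < 0 by rewrite /K; lra.
  by case: (ltgtP (phi 0) 0) => [/DD ->|/DD ->|->].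
rewrite (@I1_FTC _ h F)//; last first.
  move=> x; rewrite /circ/= in_itv/= => /andP[x0 _]; apply: dF.
  by rewrite /K; lra.
by move: D0; rewrite /D/= phi2 add0r.
Qed.

Lemma I2_subst f (phi dphi psi dpsi : R -> R) : cont2 f ->
  (forall u v, f (u + 2 * pi) v = f u v) ->
  (forall u v, f u (v + 2 * pi) = f u v) ->
  continuous dphi -> continuous dpsi ->
  (forall x, der phi x (dphi x)) -> phi (2 * pi) = phi 0 + 2 * pi ->
  (forall x, der psi x (dpsi x)) -> psi (2 * pi) = psi 0 + 2 * pi ->
  I2 (fun u v => f (phi u) (psi v) * (dphi u * dpsi v)) = I2 f.
Proof.
move=> cf pu pv cdphi cdpsi dphi' phi2 dpsi' psi2.
have cphi : continuous phi by apply: der_cont => x; exists (dphi x).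
have cpsi : continuous psi by apply: der_cont => x; exists (dpsi x).
have c1 : cont2 (fun u v => f (phi u) v * dphi u).
  apply: cont2M; last exact: cont2_fst.
  apply: (cont2_comp cf cphi) => x; exact: cvg_id.
have c2 : cont2 (fun u v => f (phi u) (psi v) * (dphi u * dpsi v)).
  by apply: cont2M; [exact: cont2_comp|apply: cont2M; [exact: cont2_fst|exact: cont2_snd]].
transitivity (I2 (fun u v => f (phi u) v * dphi u)).
  rewrite (I2_iter c2).1 (I2_iter c1).1; apply: I1_ext => u.
  rewrite -(@I1_subst (fun v => f (phi u) v * dphi u) psi dpsi)//.
  - by apply: I1_ext => v; rewrite mulrA.
  - exact: (cont2_l c1).
  - by move=> x; rewrite pv.
rewrite (I2_iter c1).2 (I2_iter cf).2; apply: I1_ext => v.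
apply: I1_subst => //; exact: cont2_r.
Qed.

(** This turns smallness in the mean into smallness at a point for equi-Lipschitz functions. Since L
    <= pi, for each coordinate x one of [x, x + L] and [x - L, x] lies in [0, 2 pi]; the integral
    over the resulting square of side L is already large enough. *)
Lemma I2_lower f (M L eps u0 v0 : R) : cont2 f -> circ u0 -> circ v0 -> 0 < eps ->
  0 < L -> (forall u v, 0 <= f u v) ->
  (forall u v, `|u - u0| <= L -> `|v - v0| <= L -> eps <= f u v) ->
  L <= pi -> eps * L ^+ 2 <= I2 f.
Proof.
move=> cf cu0 cv0 e0 L0 f0 fe Lpi.
have key (x : R) : circ x -> exists l : R, [/\ 0 <= l, l + L <= 2 * pi &
    forall y, l <= y <= l + L -> `|y - x| <= L].
  rewrite /circ/= in_itv/= => /andP[x0 x1].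
  case: (lerP x pi) => xp.
    exists x; split => //; first lra.
    by move=> y /andP[? ?]; rewrite ler_norml; apply/andP; split; lra.
  exists (x - L); split; [lra|lra|].
  by move=> y /andP[? ?]; rewrite ler_norml; apply/andP; split; lra.
have [a [a0 a1 Ha]] := key _ cu0; have [b [b0 b1 Hb]] := key _ cv0.
pose B : set (R * R) := `[a, (a + L)] `*` `[b, (b + L)].
have mB : measurable B by apply: measurableX; exact: measurable_itv.
have sB : B `<=` square.
  move=> [u v] [/=]; rewrite !in_itv/= => /andP[? ?] /andP[? ?].
  by split; rewrite /circ/= in_itv/=; apply/andP; split; lra.
have i1 (c : R) : lebesgue_measure (`[c, (c + L)]%classic : set R) = L%:E.
  rewrite lebesgue_measure_itv/= lte_fin ltrDl L0 -EFinD; congr EFin; lra.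
have muB : (@lebesgue_measure R \x @lebesgue_measure R)%E B = (L ^+ 2)%:E.
  rewrite /B product_measure1E; [|exact: measurable_itv..].
  transitivity (L%:E * L%:E : \bar R)%E; last by rewrite -EFinM expr2.
  by congr (_ * _)%E; exact: i1.
have iB : (@lebesgue_measure R \x @lebesgue_measure R)%E.-integrable B
    (EFin \o (fun z : R * R => f z.1 z.2)).
  refine (integrableS _ _ _ (cont2_integrable cf)).
  - exact: measurable_square.
  - exact: mB.
  - exact: sB.
have iBc : (@lebesgue_measure R \x @lebesgue_measure R)%E.-integrable B (EFin \o (fun=> eps)).
  apply: measurable_bounded_integrable => //.
    by rewrite /= muB ltry.
  exists `|eps|; split; first by rewrite num_real.
  by move=> x ex z _ /=; exact: ltW.
apply: (@le_trans _ _ (\int[(@lebesgue_measure R \x @lebesgue_measure R)%E]_(z in B) f z.1 z.2)).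
  have -> : eps * L ^+ 2 = \int[(@lebesgue_measure R \x @lebesgue_measure R)%E]_(z in B) eps.
    by rewrite Rintegral_cst//= muB.
  apply: le_Rintegral => //.
  by move=> [u v] [/=]; rewrite !in_itv/= => ? ?; apply: fe; [exact: Ha|exact: Hb].
rewrite /I2 /Rintegral fine_le//.
- exact: integrable_fin_num iB.
- refine (integrable_fin_num _ (cont2_integrable cf)); exact: measurable_square.
- apply: ge0_subset_integral => //; first exact: measurable_square.
    exact: (measurable_int _ (cont2_integrable cf)).
  by move=> z _; rewrite lee_fin.
Qed.
End more_integral.

(** * The test function and Kepler's substitution *)

Section kepler.
Context {R : realType}.
Variables (A B d : R).
Hypotheses (A0 : 0 < A) (d0 : 0 < d) (dE : d ^+ 2 = A ^+ 2 - B ^+ 2).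
Local Notation w v := (A - B * cos v).

Lemma kepler_BA : `|B| < A.
Proof.
rewrite -(@ltr_pXn2r _ 2)// ?nnegrE//; last exact: ltW.
by rewrite real_normK ?num_real// -subr_gt0 -dE exprn_gt0.
Qed.

Lemma mul_cos_le (a x : R) : a * cos x <= `|a|.
Proof.
rewrite (le_trans (ler_norm _))// normrM ler_piMr//.
by rewrite ler_norml cos_geN1 cos_le1.
Qed.

Lemma kepler_w_gt0 v : 0 < w v.
Proof. by have := kepler_BA; have := mul_cos_le B v; lra. Qed.

(** The eccentric anomaly as a function of the true anomaly v, for eccentricity - B / A. Writing it
    as v plus a periodic correction makes it smooth on the whole line, while the usual relation
    between tan (E / 2) and tan (v / 2) breaks down at odd multiples of pi. *)
Definition kepler_angle (v : R) := v + 2 * atan (B * sin v / (A + d - B * cos v)).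
Local Notation G := kepler_angle.
Local Notation S v := (sin v / w v).
Local Notation C v := ((A * cos v - B) / w v).

Let cs v : cos v ^+ 2 + sin v ^+ 2 = 1 :> R. Proof. exact: cos2Dsin2. Qed.

Lemma der_kepler v : der G v (d / w v).
Proof.
have w0 := kepler_w_gt0 v.
have k0 : A + d - B * cos v != 0 by rewrite gt_eqF//; move: w0 d0; lra.
have q0 : (A + d) ^+ 2 + B ^+ 2 - 2 * (A + d) * B * cos v != 0.
  have -> : (A + d) ^+ 2 + B ^+ 2 - 2 * (A + d) * B * cos v = 2 * (A + d) * w v.
    by rewrite sqrrD dE; ring.
  by rewrite gt_eqF// !mulr_gt0// addr_gt0.
apply: der_eq.
  rewrite /kepler_angle; ders => //.
have sE : sin v ^+ 2 = 1 - cos v ^+ 2 by rewrite -(cs v); ring.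
have q1 : (A + d - B * cos v) ^+ 2 + (B * sin v) ^+ 2 = 2 * (A + d) * w v.
  by rewrite exprMn sE; ring: dE.
have -> : 1 + (B * sin v / (A + d - B * cos v)) ^+ 2 =
    2 * (A + d) * w v / (A + d - B * cos v) ^+ 2.
  by rewrite -q1; field.
cbv beta.
have wn : w v != 0 by rewrite gt_eqF.
have An : A + d != 0 by rewrite gt_eqF// addr_gt0.
transitivity (((A + d) * A - B ^+ 2 * (cos v ^+ 2 + sin v ^+ 2)) / ((A + d) * w v)).
  by field; rewrite wn An k0.
rewrite cs mulr1; have -> : (A + d) * A - B ^+ 2 = (A + d) * d by ring: dE.
by field; rewrite wn An.
Qed.

Lemma kepler_2pi : G (2 * pi) = G 0 + 2 * pi.
Proof.
by rewrite /kepler_angle (mulrC 2 pi) mulr_natr sin2pi sin0 !mulr0 !mul0r atan0; ring.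
Qed.

Lemma kepler_circle v : d ^+ 2 * S v ^+ 2 + C v ^+ 2 = 1.
Proof.
have w0 := kepler_w_gt0 v.
have sE : sin v ^+ 2 = 1 - cos v ^+ 2 by rewrite -(cs v); ring.
rewrite dE !expr_div_n sE; field; by rewrite gt_eqF.
Qed.

Lemma kepler_inv v : (w v)^-1 = (A + B * C v) / d ^+ 2.
Proof.
have w0 := kepler_w_gt0 v.
have d20 : d ^+ 2 != 0 by rewrite gt_eqF// exprn_gt0.
apply: (mulIf d20); rewrite divfK// dE; field; by rewrite gt_eqF.
Qed.

Lemma der_kepler_S v : der (fun v => S v) v (C v / w v).
Proof.
have w0 := kepler_w_gt0 v.
apply: der_eq; first by ders; rewrite gt_eqF.
have sE : sin v ^+ 2 = 1 - cos v ^+ 2 by rewrite -(cs v); ring.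
have wn : w v != 0 by rewrite gt_eqF.
apply: (mulIf (expf_neq0 2 wn)).
transitivity (cos v * w v - B * sin v ^+ 2); first by field.
rewrite sE; by field.
Qed.

Lemma der_kepler_C v : der (fun v => C v) v (- (d ^+ 2 * S v / w v)).
Proof.
have w0 := kepler_w_gt0 v.
apply: der_eq; first by ders; rewrite gt_eqF.
by rewrite dE; field; rewrite gt_eqF.
Qed.

(** The unit vectors (C, d S) and (cos G, sin G) turn at the same rate, so the quotient (C + i d S)
    / (cos G + i sin G) is constant, and it is 1 at v = 0. [X] and [Y] are its real and imaginary
    parts. *)
Lemma cos_sin_kepler v : cos (G v) = C v /\ sin (G v) = d * S v.
Proof.
have hX : forall v, der (fun v => C v * cos (G v) + d * S v * sin (G v)) v 0.
  move=> x; have h1 := der_kepler_S x; have h2 := der_kepler_C x.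
  have h3 := der_kepler x.
  apply: der_eq; first by ders.
  rewrite /=.
  by field; rewrite gt_eqF// kepler_w_gt0.
have hY : forall v, der (fun v => d * S v * cos (G v) - C v * sin (G v)) v 0.
  move=> x; have h1 := der_kepler_S x; have h2 := der_kepler_C x.
  have h3 := der_kepler x.
  apply: der_eq; first by ders.
  rewrite /=.
  by field; rewrite gt_eqF// kepler_w_gt0.
have w0 := kepler_w_gt0 0.
have G0 : G 0 = 0 by rewrite /kepler_angle sin0 mulr0 mul0r atan0; ring.
have X : C v * cos (G v) + d * S v * sin (G v) = 1.
  rewrite (der0_cst hX v 0) G0 sin0 cos0; field.
  by move: w0; rewrite cos0 mulr1 => w0; rewrite gt_eqF.
have Y : d * S v * cos (G v) - C v * sin (G v) = 0.
  by rewrite (der0_cst hY v 0) G0 sin0 cos0; ring.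
have N := kepler_circle v.
have cG := cs (G v).
split.
  have -> : cos (G v) = cos (G v) * (d ^+ 2 * S v ^+ 2 + C v ^+ 2) by rewrite N mulr1.
  transitivity (C v * (C v * cos (G v) + d * S v * sin (G v)) + d * S v * (d * S v * cos (G v) - C v * sin (G v))); first by ring.
  by rewrite X Y; ring.
have -> : sin (G v) = sin (G v) * (d ^+ 2 * S v ^+ 2 + C v ^+ 2) by rewrite N mulr1.
transitivity (d * S v * (C v * cos (G v) + d * S v * sin (G v)) - C v * (d * S v * cos (G v) - C v * sin (G v))); first by ring.
by rewrite X Y; ring.
Qed.

Lemma cont_kepler_inv n : continuous (fun v => (w v)^-1 ^+ n).
Proof. by cont1; rewrite gt_eqF// kepler_w_gt0. Qed.

(** [S v] vanishes at both ends of the period, so only the secular term [a * G v] contributes. The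
    antiderivatives below are found in the eccentric anomaly E = G v, where 1 / w = (A + B cos E) /
    d^2, dv = (w / d) dE, cos E = [C v] and sin E = [d * S v]: powers of 1 / w become polynomials in
    cos E. *)
Lemma I1_kepler_FTC h (F : R -> R) (a b c e : R) :
  continuous h ->
  (forall v, der F v (h v)) ->
  (forall v, F v = a * G v + e * S v + b * (S v * C v) + c * S v ^+ 3) ->
  I1 h = 2 * pi * a.
Proof.
move=> ch dF FE; rewrite (@I1_FTC _ h F)// !FE kepler_2pi.
by rewrite (mulrC 2 pi) mulr_natr sin2pi sin0 !mul0r; ring.
Qed.

Lemma I1_kepler1 : I1 (fun v => (w v)^-1) = 2 * pi / d.
Proof.
apply: (@I1_kepler_FTC _ (fun v => d^-1 * G v) d^-1 0 0 0).
- by cont1; rewrite gt_eqF// kepler_w_gt0.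
- move=> v; have h3 := der_kepler v; apply: der_eq; first by ders.
  rewrite /=.
  by field; rewrite !gt_eqF// kepler_w_gt0.
- by move=> v; ring.
Qed.

Lemma I1_kepler2 : I1 (fun v => (w v)^-1 ^+ 2) = 2 * pi * (A / d ^+ 3).
Proof.
apply: (@I1_kepler_FTC _ (fun v => A / d ^+ 3 * G v + B / d ^+ 2 * S v) _ 0 0 (B / d ^+ 2)).
- exact: cont_kepler_inv.
- move=> v; have h3 := der_kepler v; have h1 := der_kepler_S v.
  apply: der_eq; first by ders.
  rewrite /=.
  rewrite [in RHS]expr2 [in X in _ = X * _]kepler_inv.
  by field; rewrite !gt_eqF// kepler_w_gt0.
- by move=> v; ring.
Qed.

Lemma I1_kepler3 : I1 (fun v => (w v)^-1 ^+ 3) = 2 * pi * ((A ^+ 2 + B ^+ 2 / 2) / d ^+ 5).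
Proof.
apply: (@I1_kepler_FTC _ (fun v => (A ^+ 2 + B ^+ 2 / 2) / d ^+ 5 * G v +
   2 * A * B / d ^+ 4 * S v + B ^+ 2 / (2 * d ^+ 4) * (S v * C v)) _ (B ^+ 2 / (2 * d ^+ 4)) 0 (2 * A * B / d ^+ 4)).
- exact: cont_kepler_inv.
- move=> v; have h3 := der_kepler v; have h1 := der_kepler_S v.
  have h2 := der_kepler_C v.
  apply: der_eq; first by ders.
  rewrite /=.
  have N := kepler_circle v.
  have -> : (w v)^-1 ^+ 3 = (w v)^-1 * ((A + B * C v) / d ^+ 2) ^+ 2.
    by rewrite -kepler_inv exprS.
  have wn : w v != 0 by rewrite gt_eqF// kepler_w_gt0.
  have dn : d != 0 by rewrite gt_eqF.
  apply/eqP; rewrite -subr_eq0; apply/eqP.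
  transitivity (B ^+ 2 / (2 * d ^+ 4) / w v * (1 - (d ^+ 2 * S v ^+ 2 + C v ^+ 2))).
    by set c := C v; set s := S v; field; rewrite dn wn.
  by rewrite N subrr mulr0.
- by move=> v; ring.
Qed.

Lemma I1_kepler_sin2 : I1 (fun v => sin v ^+ 2 * (w v)^-1 ^+ 4) = pi * (A / d ^+ 5).
Proof.
have -> : pi * (A / d ^+ 5) = 2 * pi * (A / (2 * d ^+ 5)).
  by field; rewrite gt_eqF.
apply: (@I1_kepler_FTC _ (fun v => A / (2 * d ^+ 5) * G v
   + - (A / (2 * d ^+ 4)) * (S v * C v) + B / (3 * d ^+ 2) * S v ^+ 3) _
   (- (A / (2 * d ^+ 4))) (B / (3 * d ^+ 2)) 0).
- by cont1; rewrite gt_eqF// kepler_w_gt0.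
- move=> v; have h3 := der_kepler v; have h1 := der_kepler_S v.
  have h2 := der_kepler_C v.
  apply: der_eq; first by ders.
  rewrite /=.
  have N := kepler_circle v.
  have wn : w v != 0 by rewrite gt_eqF// kepler_w_gt0.
  have dn : d != 0 by rewrite gt_eqF.
  have -> : sin v ^+ 2 * (w v)^-1 ^+ 4 = S v ^+ 2 * (w v)^-1 * ((A + B * C v) / d ^+ 2).
    by rewrite -kepler_inv; field.
  apply/eqP; rewrite -subr_eq0; apply/eqP.
  transitivity (A / (2 * d ^+ 4) / w v * (1 - (d ^+ 2 * S v ^+ 2 + C v ^+ 2))).
    by set c := C v; set s := S v; field; rewrite dn wn.
  by rewrite N subrr mulr0.
- by move=> v; ring.
Qed.

Lemma I1_kepler_cos2 : I1 (fun v => (A * cos v - B) ^+ 2 * (w v)^-1 ^+ 4) = pi * (A / d ^+ 3).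
Proof.
have -> : pi * (A / d ^+ 3) = 2 * pi * (A / (2 * d ^+ 3)).
  by field; rewrite gt_eqF.
apply: (@I1_kepler_FTC _ (fun v => A / (2 * d ^+ 3) * G v + B / d ^+ 2 * S v
   + A / (2 * d ^+ 2) * (S v * C v) + - (B / 3) * S v ^+ 3) _
   (A / (2 * d ^+ 2)) (- (B / 3)) (B / d ^+ 2)).
- by cont1; rewrite gt_eqF// kepler_w_gt0.
- move=> v; have h3 := der_kepler v; have h1 := der_kepler_S v.
  have h2 := der_kepler_C v.
  apply: der_eq; first by ders.
  rewrite /=.
  have N := kepler_circle v.
  have wn : w v != 0 by rewrite gt_eqF// kepler_w_gt0.
  have dn : d != 0 by rewrite gt_eqF.
  have -> : (A * cos v - B) ^+ 2 * (w v)^-1 ^+ 4 = C v ^+ 2 * (w v)^-1 * ((A + B * C v) / d ^+ 2).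
    by rewrite -kepler_inv; field.
  apply/eqP; rewrite -subr_eq0; apply/eqP.
  transitivity ((A / (2 * d ^+ 2) + B * C v / d ^+ 2) / w v * (1 - (d ^+ 2 * S v ^+ 2 + C v ^+ 2))).
    by set c := C v; set s := S v; field; rewrite dn wn.
  by rewrite N subrr mulr0.
- by move=> v; ring.
Qed.

End kepler.

(** * The Rayleigh quotient of sin v / w *)

Section test_function.
Context {R : realType}.
Variables (al be : R).
Hypotheses (be0 : 0 <= be) (beal : be < al) (abE : al ^+ 2 + be ^+ 2 = 1).
Local Notation s2 := (Num.sqrt (2 : R)).
Local Notation A u := (s2 - al * cos u).
Local Notation w u v := (s2 - al * cos u - be * cos v).
Local Notation d u := (Num.sqrt (A u ^+ 2 - be ^+ 2)).
Local Notation P u := (s2 - be - al * cos u).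
Local Notation Q u := (s2 + be - al * cos u).
Let b := s2 * be.

Lemma sqrt2_sqr : s2 ^+ 2 = 2. Proof. by rewrite sqr_sqrtr. Qed.
Lemma sqrt2_gt0 : 0 < s2. Proof. by rewrite sqrtr_gt0. Qed.
Lemma sqrt2_le : s2 <= 99 / 70.
Proof. by rewrite -(@ler_pXn2r _ 2) ?nnegrE ?sqrtr_ge0// ?sqrt2_sqr; lra. Qed.

Let al0 : 0 < al. Proof. exact: le_lt_trans beal. Qed.
Let b0 : 0 <= b. Proof. by rewrite mulr_ge0// sqrtr_ge0. Qed.
Let b1 : b < 1.
Proof.
rewrite -(@ltr_pXn2r _ 2)// ?nnegrE// expr1n exprMn sqrt2_sqr.
have : be ^+ 2 < al ^+ 2 by rewrite ltr_pXn2r// nnegrE// ltW.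
by move: abE; lra.
Qed.
Let beE : be = s2 * b / 2.
Proof. by rewrite /b mulrA -expr2 sqrt2_sqr mulrC mulKf. Qed.

Lemma ab_lt_sqrt2 : al + be < s2.
Proof.
rewrite -(@ltr_pXn2r _ 2)// ?nnegrE ?sqrtr_ge0//; last by rewrite addr_ge0// ltW.
rewrite sqrt2_sqr.
have : 0 < (al - be) ^+ 2 by rewrite exprn_gt0// subr_gt0.
by move: abE; nra.
Qed.

Lemma P_gt0 u : 0 < P u.
Proof.
have := mul_cos_le al u; rewrite (gtr0_norm al0).
by have := ab_lt_sqrt2; lra.
Qed.

Lemma Q_gt0 u : 0 < Q u.
Proof. by have := P_gt0 u; move: be0; lra. Qed.

Lemma A_gt0 u : 0 < A u.
Proof. by have := P_gt0 u; move: be0; lra. Qed.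

Lemma w_gt0 u v : 0 < w u v.
Proof.
have := P_gt0 u; have := mul_cos_le be v; rewrite (ger0_norm be0).
lra.
Qed.

Lemma PQE u : A u ^+ 2 - be ^+ 2 = P u * Q u.
Proof. ring. Qed.

Lemma d_gt0 u : 0 < d u.
Proof. by rewrite sqrtr_gt0 PQE mulr_gt0// ?P_gt0// Q_gt0. Qed.

Lemma d_sqr u : d u ^+ 2 = A u ^+ 2 - be ^+ 2.
Proof. by rewrite sqr_sqrtr// PQE ltW// mulr_gt0// ?P_gt0// Q_gt0. Qed.

(** [kap] and [k1] are the Kepler parameters d belonging to [P] and [Q]: by al^2 + be^2 = 1, the
    differences (sqrt 2 -+ be)^2 - al^2 are the perfect squares (1 -+ sqrt 2 be)^2. Hence all
    elementary integrals below are rational in b, up to factors sqrt 2 and pi. *)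
Let kap := 1 - b.
Let k1 := 1 + b.
Let kap0 : 0 < kap. Proof. by rewrite /kap; move: b1; lra. Qed.
Let k10 : 0 < k1. Proof. by rewrite /k1; move: b0; lra. Qed.

Let kapE : kap ^+ 2 = (s2 - be) ^+ 2 - al ^+ 2.
Proof.
have -> : al ^+ 2 = 1 - be ^+ 2 by rewrite -abE; ring.
by rewrite /kap /b sqrrB sqrrB exprMn sqrt2_sqr; ring.
Qed.
Let k1E : k1 ^+ 2 = (s2 + be) ^+ 2 - al ^+ 2.
Proof.
have -> : al ^+ 2 = 1 - be ^+ 2 by rewrite -abE; ring.
by rewrite /k1 /b sqrrD sqrrD exprMn sqrt2_sqr; ring.
Qed.
Let p0 : 0 < s2 - be. Proof. by have := ab_lt_sqrt2; move: al0; lra. Qed.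
Let q0 : 0 < s2 + be. Proof. by have := sqrt2_gt0; move: be0; lra. Qed.

Let IP1 : I1 (fun u => (P u)^-1) = 2 * pi / kap := I1_kepler1 p0 kap0 kapE.
Let IQ1 : I1 (fun u => (Q u)^-1) = 2 * pi / k1 := I1_kepler1 q0 k10 k1E.
Let IP2 : I1 (fun u => (P u)^-1 ^+ 2) = 2 * pi * ((s2 - be) / kap ^+ 3) := I1_kepler2 p0 kap0 kapE.
Let IQ2 : I1 (fun u => (Q u)^-1 ^+ 2) = 2 * pi * ((s2 + be) / k1 ^+ 3) := I1_kepler2 q0 k10 k1E.

Let cP n : continuous (fun u => (P u)^-1 ^+ n). Proof. exact: cont_kepler_inv p0 kap0 kapE n. Qed.
Let cQ n : continuous (fun u => (Q u)^-1 ^+ n). Proof. exact: cont_kepler_inv q0 k10 k1E n. Qed.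
Let cP1 : continuous (fun u => (P u)^-1). Proof. by cont1; rewrite gt_eqF// P_gt0. Qed.
Let cQ1 : continuous (fun u => (Q u)^-1). Proof. by cont1; rewrite gt_eqF// Q_gt0. Qed.
Let i11 := I1 (fun u => (P u)^-1 ^+ 1 * (Q u)^-1 ^+ 1).
Let i21 := I1 (fun u => (P u)^-1 ^+ 2 * (Q u)^-1 ^+ 1).
Let i12 := I1 (fun u => (P u)^-1 ^+ 1 * (Q u)^-1 ^+ 2).

(** Partial fractions by 1 / P - 1 / Q = 2 be / (P Q) reduce everything to Kepler integrals. They
    divide by be, so be = 0, where P = Q, is computed separately. *)
Lemma I1_PQ :
  [/\ i11 = 2 * pi * (s2 / (kap * k1)),
      i21 = 2 * pi * ((5 - 3 * b) / (2 * kap ^+ 3 * k1)) &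
      i12 = 2 * pi * ((5 + 3 * b) / (2 * kap * k1 ^+ 3))].
Proof.
have [bz|bn] := eqVneq be 0.
  have bz' : b = 0 by rewrite /b bz mulr0.
  have PA u : P u = A u by rewrite bz subr0.
  have QA u : Q u = A u by rewrite bz addr0.
  have a1 : (1 : R) ^+ 2 = s2 ^+ 2 - al ^+ 2.
    rewrite expr1n sqrt2_sqr; move: abE; rewrite bz expr0n /=; lra.
  have K2 := I1_kepler2 sqrt2_gt0 ltr01 a1.
  have K3 := I1_kepler3 sqrt2_gt0 ltr01 a1.
  have aE : al ^+ 2 = 1 by move: abE; rewrite bz expr0n /=; lra.
  rewrite /kap /k1 bz' !(subr0, addr0, mulr0, expr1n, mulr1, divr1).
  split.
  - rewrite -[RHS]mulr1 -[X in _ = X]mulr1 -[s2]divr1 -[X in _ / X](expr1n _ 3) mulr1.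
    rewrite mulr1 -K2 /i11; apply: I1_ext => u; rewrite PA QA; ring.
  - have -> : 2 * pi * (5 / 2) = 2 * pi * ((s2 ^+ 2 + al ^+ 2 / 2) / 1 ^+ 5).
      by rewrite sqrt2_sqr aE expr1n; field.
    by rewrite -K3 /i21; apply: I1_ext => u; rewrite PA QA; ring.
  - have -> : 2 * pi * (5 / 2) = 2 * pi * ((s2 ^+ 2 + al ^+ 2 / 2) / 1 ^+ 5).
      by rewrite sqrt2_sqr aE expr1n; field.
    by rewrite -K3 /i12; apply: I1_ext => u; rewrite PA QA; ring.
have Pn u : P u != 0 by rewrite gt_eqF// P_gt0.
have Qn u : Q u != 0 by rewrite gt_eqF// Q_gt0.
have bn0 : b != 0 by rewrite mulf_neq0// gt_eqF// sqrt2_gt0.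
have kn : kap != 0 by rewrite gt_eqF.
have k1n : k1 != 0 by rewrite gt_eqF.
have sn : s2 != 0 by rewrite gt_eqF// sqrt2_gt0.
have bb : b ^+ 2 = 2 * be ^+ 2 by rewrite exprMn sqrt2_sqr.
have e11 : i11 = 2 * pi * (s2 / (kap * k1)).
  have -> : i11 = (2 * be)^-1 * (2 * pi / kap) + - (2 * be)^-1 * (2 * pi / k1).
    rewrite -IP1 -IQ1 -I1_lin; [|exact: cP1|exact: cQ1].
    by apply: I1_ext => u; field; rewrite bn Pn Qn.
  rewrite beE; have -> : (2 * (s2 * b / 2))^-1 * (2 * pi / kap) + - (2 * (s2 * b / 2))^-1 * (2 * pi / k1) = 2 * pi * (2 / s2 / (kap * k1)).
    by rewrite /kap /k1; field; rewrite -/kap -/k1 kn k1n sn bn0.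
  suff -> : 2 / s2 = s2 by [].
  by apply: (mulIf sn); rewrite divfK// -expr2 sqrt2_sqr.
have c11 : continuous (fun u => (P u)^-1 ^+ 1 * (Q u)^-1 ^+ 1) by apply: contM.
split => //.
- have -> : i21 = (2 * be)^-1 * (2 * pi * ((s2 - be) / kap ^+ 3)) + - (2 * be)^-1 * i11.
    rewrite -IP2 /i11 -I1_lin; [|exact: cP|exact: c11].
    by apply: I1_ext => u; field; rewrite bn Pn Qn.
  rewrite e11 beE /kap /k1; field.
  by rewrite -/kap -/k1 sn bn0 kn k1n.
- have -> : i12 = (2 * be)^-1 * i11 + - (2 * be)^-1 * (2 * pi * ((s2 + be) / k1 ^+ 3)).
    rewrite -IQ2 /i11 -I1_lin; [|exact: c11|exact: cQ].
    by apply: I1_ext => u; field; rewrite bn Pn Qn.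
  rewrite e11 beE /kap /k1; field.
  by rewrite -/kap -/k1 sn bn0 kn k1n.
Qed.

Local Notation di u := ((d u)^-1).

Let der_d u : der (fun u => d u) u (A u * (al * sin u) * di u).
Proof.
apply: der_eq; first by ders; rewrite PQE mulr_gt0// ?P_gt0// Q_gt0.
rewrite /=; by field; rewrite gt_eqF// d_gt0.
Qed.

Let c_di n : continuous (fun u => di u ^+ n).
Proof.
apply: der_cont => u; have dd := der_d u; eexists; ders.
by rewrite gt_eqF// d_gt0.
Qed.
Let c_A : continuous (fun u => A u). Proof. by cont1. Qed.
Let c_Adi n : continuous (fun u => A u * di u ^+ n).
Proof. by apply: contM; [exact: c_A|exact: c_di]. Qed.

(** After the Kepler integrals in v, \int w^(-2) is 2 pi X, the weighted square norm of sin v / w is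
    pi V and its Dirichlet integral is pi (W + X). Odd powers of d make these integrals elliptic. W
    is expressed by T and X, which are bounded above by 2 pi t0 and 2 pi x0; V is bounded below
    through M, where d occurs to an even power and the value is exactly 2 pi m0. *)
Let X := I1 (fun u => A u * di u ^+ 3).
Let T := I1 (fun u => di u ^+ 3).
Let V := I1 (fun u => A u * di u ^+ 5).
Let M := I1 (fun u => A u * di u ^+ 4).
Let W := I1 (fun u => (al * sin u) ^+ 2 * (A u * di u ^+ 5)).
Let x0 := s2 / (kap * k1) ^+ 2.
Let t0 := (10 + 10 * b - b ^+ 2 - 3 * b ^+ 3) / (4 * kap ^+ 2 * k1 ^+ 3).
Let m0 := (5 - b ^+ 2) / (2 * (kap * k1) ^+ 3).

(** AM-GM with weight [kap], since d^2 = P Q. It replaces a square root by partial fractions, and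
    for be = 0 it is an equality at every u. *)
Let di_le u : di u <= 2^-1 * (kap / P u + (kap * Q u)^-1).
Proof.
have P0 := P_gt0 u; have Q0 := Q_gt0 u; have d0 := d_gt0 u.
have dE : d u ^+ 2 = P u * Q u by rewrite d_sqr PQE.
have -> : kap / P u + (kap * Q u)^-1 = (kap ^+ 2 * Q u + P u) / (kap * d u ^+ 2).
  by rewrite dE; field; rewrite !gt_eqF.
rewrite -subr_ge0.
have -> : 2^-1 * ((kap ^+ 2 * Q u + P u) / (kap * d u ^+ 2)) - di u =
    (kap * Q u - d u) ^+ 2 / (2 * kap * d u ^+ 2 * Q u).
  apply/eqP; rewrite -subr_eq0; apply/eqP.
  transitivity ((P u * Q u - d u ^+ 2) / (2 * kap * d u ^+ 2 * Q u)).
    by set D := d u; set p := P u; set q := Q u; field; rewrite !gt_eqF.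
  by rewrite dE subrr mul0r.
by rewrite divr_ge0 ?sqr_ge0// !mulr_ge0 ?sqr_ge0// ltW.
Qed.

Let pi0 : 0 < 2 * pi :> R. Proof. exact: two_pi_gt0. Qed.
Let kn : kap != 0. Proof. by rewrite gt_eqF. Qed.
Let k1n : k1 != 0. Proof. by rewrite gt_eqF. Qed.

Let c11 : continuous (fun u => (P u)^-1 ^+ 1 * (Q u)^-1 ^+ 1). Proof. exact: contM. Qed.
Let c21 : continuous (fun u => (P u)^-1 ^+ 2 * (Q u)^-1 ^+ 1). Proof. exact: contM. Qed.
Let c12 : continuous (fun u => (P u)^-1 ^+ 1 * (Q u)^-1 ^+ 2). Proof. exact: contM. Qed.

Let T_le : T <= 2 * pi * t0.
Proof.
have [_ e21 e12] := I1_PQ.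
have -> : 2 * pi * t0 = (kap / 2) * i21 + (2 * kap)^-1 * i12.
  by rewrite e21 e12 /t0 /kap /k1; field; rewrite -/kap -/k1 kn k1n.
rewrite -I1_lin//; apply: le_I1; [exact: c_di| |].
  by apply: contD; apply: contM => //; exact: cont_cst.
move=> u; have P0 := P_gt0 u; have Q0 := Q_gt0 u; have d0 := d_gt0 u.
have dE : d u ^+ 2 = P u * Q u by rewrite d_sqr PQE.
have -> : di u ^+ 3 = (P u * Q u)^-1 * di u by rewrite -dE; field; rewrite gt_eqF.
apply: le_trans (ler_wpM2l _ (di_le u)) _; first by rewrite invr_ge0 mulr_ge0 ?ltW.
by apply: eq_ler; field; rewrite kn !gt_eqF.
Qed.

Let X_le : X <= 2 * pi * x0.
Proof.
have [e11 _ _] := I1_PQ.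
(* The integral of the AM-GM bound. It falls short of [2 * pi * x0] only by a term of order b^3,
   which is given up for the simple form of [x0]. *)
apply: (@le_trans _ _ ((kap / 4) * (2 * pi * ((s2 - be) / kap ^+ 3)) +
   1 * ((4 * kap)^-1 * (2 * pi * ((s2 + be) / k1 ^+ 3)) + (kap + kap^-1) / 4 * i11))); last first.
  rewrite -subr_ge0 e11 beE.
  have -> : 2 * pi * x0 - (kap / 4 * (2 * pi * ((s2 - s2 * b / 2) / kap ^+ 3)) + 1 * ((4 * kap)^-1 * (2 * pi * ((s2 + s2 * b / 2) / k1 ^+ 3)) + (kap + kap^-1) / 4 * (2 * pi * (s2 / (kap * k1))))) = 2 * pi * s2 * (b ^+ 3 * kap / (8 * kap ^+ 2 * k1 ^+ 3)).
    by rewrite /x0 /kap /k1; field; rewrite -/kap -/k1 kn k1n.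
  by rewrite !mulr_ge0 ?invr_ge0// ?mulr_ge0// ?exprn_ge0// ?ltW// ?sqrtr_ge0// pi_gt0.
rewrite -IP2 -IQ2 /i11 -(I1_lin (4 * kap)^-1 ((kap + kap^-1) / 4) (@cQ 2) c11).
have cl : continuous (fun u => (4 * kap)^-1 * (Q u)^-1 ^+ 2 + (kap + kap^-1) / 4 * ((P u)^-1 ^+ 1 * (Q u)^-1 ^+ 1)).
  by apply: contD; apply: contM => //; try exact: cont_cst; exact: cQ.
rewrite -I1_lin; [|exact: cP|exact: cl].
apply: le_I1; [exact: c_Adi| |].
  by apply: contD; apply: contM => //; try exact: cont_cst; exact: cP.
move=> u; have P0 := P_gt0 u; have Q0 := Q_gt0 u; have d0 := d_gt0 u.
have A0 := A_gt0 u.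
have dE : d u ^+ 2 = P u * Q u by rewrite d_sqr PQE.
have -> : A u * di u ^+ 3 = A u * (P u * Q u)^-1 * di u by rewrite -dE; field; rewrite gt_eqF.
apply: le_trans (ler_wpM2l _ (di_le u)) _; first by rewrite mulr_ge0 ?invr_ge0 ?mulr_ge0 ?ltW.
apply: eq_ler; have -> : A u = (P u + Q u) / 2 by field.
by field; rewrite kn !gt_eqF.
Qed.

Let M_eq : M = 2 * pi * m0.
Proof.
have [_ e21 e12] := I1_PQ.
have -> : 2 * pi * m0 = 2^-1 * i21 + 2^-1 * i12.
  by rewrite e21 e12 /m0 /kap /k1; field; rewrite -/kap -/k1 kn k1n.
rewrite -I1_lin//; apply: I1_ext => u.
have P0 := P_gt0 u; have Q0 := Q_gt0 u; have d0 := d_gt0 u.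
have dE : d u ^+ 2 = P u * Q u by rewrite d_sqr PQE.
have -> : di u ^+ 4 = ((P u * Q u)^-1) ^+ 2 by rewrite -dE; field; rewrite gt_eqF.
by field; rewrite !gt_eqF.
Qed.

(** Integration by parts: the derivative of al sin u / d^3 integrates to 0 over a period, and al cos
    u = sqrt 2 - A. *)
Let W_eq : W = 3^-1 * (s2 * T + -1 * X).
Proof.
rewrite /T /X -I1_lin; [|exact: c_di|exact: c_Adi].
have cW : continuous (fun u => (al * sin u) ^+ 2 * (A u * di u ^+ 5)).
  by apply: contM => //; cont1.
have cT : continuous (fun u => s2 * di u ^+ 3 + -1 * (A u * di u ^+ 3)).
  by apply: contD; apply: contM => //; exact: cont_cst.
suff : 0 = 3 * W + -1 * I1 (fun u => s2 * di u ^+ 3 + -1 * (A u * di u ^+ 3)).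
  by move/esym/eqP; rewrite mulN1r subr_eq0 => /eqP <-; rewrite mulKf.
rewrite /W -I1_lin//.
rewrite (@I1_FTC _ _ (fun u => - (al * sin u * di u ^+ 3))).
- by rewrite (mulrC 2 pi) mulr_natr sin2pi sin0 !mulr0 !mul0r oppr0 subrr.
- by apply: contD; apply: contM => //; exact: cont_cst.
- move=> u _; have dd := der_d u; apply: der_eq; first by ders; rewrite gt_eqF// d_gt0.
  by rewrite /=; field; rewrite gt_eqF// d_gt0.
Qed.

(** Cauchy-Schwarz, M^2 <= X V, in the linear form that comes from (1 / d - tau)^2 >= 0 with weight
    A / d^3. With tau free one can take tau = m0 / x0, for which the upper bound of X is enough. *)
Let V_ge tau : 2 * tau * M + - tau ^+ 2 * X <= V.
Proof.
rewrite /M /X -I1_lin; [|exact: c_Adi|exact: c_Adi]; apply: le_I1; last 1 first.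
- move=> u; rewrite -subr_ge0.
  have -> : A u * di u ^+ 5 - (2 * tau * (A u * di u ^+ 4) + - tau ^+ 2 * (A u * di u ^+ 3)) = A u * di u ^+ 3 * (di u - tau) ^+ 2 by ring.
  apply: mulr_ge0; last exact: sqr_ge0.
  apply: mulr_ge0; first exact: ltW (A_gt0 u).
  by apply: exprn_ge0; rewrite invr_ge0; exact: ltW (d_gt0 u).
- by apply: contD; apply: contM => //; exact: cont_cst.
- exact: c_Adi.
Qed.

(** Up to a positive factor this is a polynomial inequality in b on [0, 1). The constant 33 / 35 is
    (2 / 3) (99 / 70), where 99 / 70 is a convergent of sqrt 2. The margin in [h2] is smallest at b
    = 1, the limit in which al = be. *)
Let final : 2 * x0 ^+ 3 / 3 + s2 * t0 * x0 ^+ 2 / 3 < m0 ^+ 2.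
Proof.
have s22 := sqrt2_sqr; have s20 := sqrt2_gt0; have s2l := sqrt2_le.
rewrite -subr_gt0.
have -> : m0 ^+ 2 - (2 * x0 ^+ 3 / 3 + s2 * t0 * x0 ^+ 2 / 3) =
   ((5 - b ^+ 2) ^+ 2 * k1 - s2 ^+ 2 * s2 * ((18 * k1 - b ^+ 2 * (1 + 3 * b)) / 3)) / (4 * (kap * k1) ^+ 6 * k1).
  rewrite /m0 /x0 /t0 /kap /k1; by field; rewrite -/kap -/k1 kn k1n.
rewrite divr_gt0//; last by rewrite !mulr_gt0// exprn_gt0// mulr_gt0.
rewrite s22 subr_gt0 /k1.
have b2 : b ^+ 2 <= b by rewrite expr2 ler_piMr// ltW.
have b3 : b ^+ 4 <= b ^+ 3 by rewrite exprS ler_piMl ?exprn_ge0// ltW.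
have h1 : 18 * (1 + b) - b ^+ 2 * (1 + 3 * b) <= (18 - b ^+ 2 - b ^+ 4) * (1 + b).
  have : 0 <= b ^+ 2 * (b - b ^+ 2) by rewrite mulr_ge0 ?sqr_ge0 ?subr_ge0.
  have : 0 <= b ^+ 3 * (1 - b ) by rewrite mulr_ge0 ?exprn_ge0 ?subr_ge0// ltW.
  nra.
have h2 : 0 <= (5 - b ^+ 2) ^+ 2 - 33 / 35 * (18 - b ^+ 2 - b ^+ 4) - 1 / 10.
  have -> : b ^+ 4 = (b ^+ 2) ^+ 2 by rewrite -exprM.
  have : b ^+ 2 <= 1 by apply: le_trans b2 _; exact: ltW.
  have := sqr_ge0 b; set y := b ^+ 2; nra.
have h3 : 0 <= 18 - b ^+ 2 - b ^+ 4.
  have : b ^+ 4 <= b ^+ 2 by rewrite -[4%N]/(2 + 2)%N exprD ler_piMl ?sqr_ge0// (le_trans b2)// ltW.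
  have : b ^+ 2 <= 1 by apply: le_trans b2 _; exact: ltW.
  lra.
have k1' : 0 < 1 + b by move: k10; rewrite /k1.
apply: (@le_lt_trans _ _ (33 / 35 * (18 - b ^+ 2 - b ^+ 4) * (1 + b))); last by rewrite ltr_pM2r//; lra.
apply: (@le_trans _ _ (2 * s2 * ((18 - b ^+ 2 - b ^+ 4) * (1 + b) / 3))).
  by apply: ler_wpM2l; [rewrite mulr_ge0// ltW|rewrite ler_pM2r// invr_gt0].
have -> : 2 * s2 * ((18 - b ^+ 2 - b ^+ 4) * (1 + b) / 3) = (2 * s2 / 3) * ((18 - b ^+ 2 - b ^+ 4) * (1 + b)) by field.
by rewrite -[leRHS]mulrA ler_wpM2r//; [rewrite mulr_ge0// ltW|lra].
Qed.

(** The first integrand is the squared gradient of sin v / w. With X = 2 pi x and T = 2 pi t the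
    claim becomes (2 x^2 + sqrt 2 t x) / 3 < V / (2 pi). The left side increases with x and t, so
    they may be replaced by [x0] and [t0]; the right side is at least m0^2 / x0, and [final]
    compares the two. *)
Lemma test_function_quotient :
  I2 (fun u v => (al * sin u) ^+ 2 * (sin v ^+ 2 * (w u v)^-1 ^+ 4) + (A u * cos v - be) ^+ 2 * (w u v)^-1 ^+ 4)
  * I2 (fun u v => (w u v)^-1 ^+ 2)
  < (2 * pi) ^+ 2 * I2 (fun u v => sin v ^+ 2 * (w u v)^-1 ^+ 4).
Proof.
have cw n : cont2 (fun u v => (w u v)^-1 ^+ n).
  apply: cont2X; apply: cont2V; first by move=> u v; rewrite gt_eqF// w_gt0.
  by apply: cont2D; [apply: cont2_fst; exact: c_A|apply: cont2_snd; cont1].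
have csv : cont2 (fun _ v : R => sin v ^+ 2) by apply: cont2_snd; cont1.
have csu : cont2 (fun u _ : R => (al * sin u) ^+ 2) by apply: cont2_fst; cont1.
have ccv : cont2 (fun u v : R => (A u * cos v - be) ^+ 2).
  apply: cont2X; apply: cont2D; last exact: cont2_cst.
  by apply: cont2M; [apply: cont2_fst; exact: c_A|apply: cont2_snd; cont1].
have cs4 : cont2 (fun u v => sin v ^+ 2 * (w u v)^-1 ^+ 4) by exact: cont2M.
have cc4 : cont2 (fun u v => (A u * cos v - be) ^+ 2 * (w u v)^-1 ^+ 4) by exact: cont2M.
have J2 : I2 (fun u v => (w u v)^-1 ^+ 2) = 2 * pi * X.
  rewrite (I2_iter (cw 2)).1 /X -I1Z; last exact: c_Adi.
  apply: I1_ext => u; rewrite (I1_kepler2 (A_gt0 u) (d_gt0 u) (d_sqr u)).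
  by rewrite exprVn.
have JB : I2 (fun u v => sin v ^+ 2 * (w u v)^-1 ^+ 4) = pi * V.
  rewrite (I2_iter cs4).1 /V -I1Z; last exact: c_Adi.
  apply: I1_ext => u; rewrite (I1_kepler_sin2 (A_gt0 u) (d_gt0 u) (d_sqr u)).
  by rewrite exprVn.
have JE : I2 (fun u v => (al * sin u) ^+ 2 * (sin v ^+ 2 * (w u v)^-1 ^+ 4) + (A u * cos v - be) ^+ 2 * (w u v)^-1 ^+ 4) = pi * W + pi * X.
  have cE1 : cont2 (fun u v => (al * sin u) ^+ 2 * (sin v ^+ 2 * (w u v)^-1 ^+ 4)) by exact: cont2M.
  rewrite I2D//; congr (_ + _).
    rewrite (I2_iter cE1).1 /W -I1Z; last by apply: contM; [cont1|exact: c_Adi].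
    apply: I1_ext => u; rewrite I1Z; last exact: (cont2_l cs4).
    rewrite (I1_kepler_sin2 (A_gt0 u) (d_gt0 u) (d_sqr u)) exprVn; ring.
  rewrite (I2_iter cc4).1 /X -I1Z; last exact: c_Adi.
  apply: I1_ext => u; rewrite (I1_kepler_cos2 (A_gt0 u) (d_gt0 u) (d_sqr u)).
  by rewrite exprVn.
rewrite J2 JB JE W_eq.
have X0 : 0 <= X.
  have -> : 0 = I1 (fun _ : R => 0 * 0) :> R by rewrite I1Z ?mul0r//; exact: cont_cst.
  apply: le_I1; [exact: cont_cst|exact: c_Adi|move=> u; rewrite mul0r].
  by rewrite !mulr_ge0 ?sqr_ge0 ?exprn_ge0 ?invr_ge0// ?(ltW (A_gt0 _)) ?(ltW (d_gt0 _)).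
have T0 : 0 <= T.
  have -> : 0 = I1 (fun _ : R => 0 * 0) :> R by rewrite I1Z ?mul0r//; exact: cont_cst.
  apply: le_I1; [exact: cont_cst|exact: c_di|move=> u; rewrite mul0r].
  by rewrite exprn_ge0 ?invr_ge0// ltW// d_gt0.
have x00 : 0 < x0 by rewrite divr_gt0 ?sqrt2_gt0// exprn_gt0// mulr_gt0.
have Vg : (2 * pi) * m0 ^+ 2 / x0 ^+ 2 * (2 * x0 - X / (2 * pi)) <= V.
  have := V_ge (m0 / x0); rewrite M_eq; apply: le_trans; apply: eq_ler.
  have x0n : x0 != 0 by rewrite gt_eqF.
  have pin : (pi : R) != 0 by rewrite gt_eqF// pi_gt0.
  have gen (y m z p : R) : y != 0 -> p != 0 -> 2 * p * m ^+ 2 / y ^+ 2 * (2 * y - z / (2 * p)) =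
      2 * (m / y) * (2 * p * m) + - (m / y) ^+ 2 * z by move=> yn pn; field; rewrite yn pn.
  exact: gen.
have ppi : 0 < pi :> R := pi_gt0 R.
pose x := X / (2 * pi); pose t := T / (2 * pi).
have XE : X = 2 * pi * x by rewrite /x mulrC divfK// gt_eqF.
have TE : T = 2 * pi * t by rewrite /t mulrC divfK// gt_eqF.
have xx0 : x <= x0 by rewrite /x ler_pdivrMr// mulrC.
have tt0 : t <= t0 by rewrite /t ler_pdivrMr// mulrC.
have x0' : 0 <= x by rewrite divr_ge0// ltW.
have V1 : 2 * pi * (m0 ^+ 2 / x0) <= V.
  apply: le_trans Vg; rewrite -/x.
  have -> : 2 * pi * m0 ^+ 2 / x0 ^+ 2 * (2 * x0 - x) = 2 * pi * (m0 ^+ 2 / x0) + 2 * pi * m0 ^+ 2 / x0 ^+ 2 * (x0 - x).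
    by field; rewrite gt_eqF.
  rewrite lerDl; apply: mulr_ge0; last by rewrite subr_ge0.
  apply: mulr_ge0; last by rewrite invr_ge0 sqr_ge0.
  by apply: mulr_ge0; [exact: ltW|exact: sqr_ge0].
rewrite XE TE.
have -> : (pi * (3^-1 * (s2 * (2 * pi * t) + -1 * (2 * pi * x))) + pi * (2 * pi * x)) * (2 * pi * (2 * pi * x)) = (2 * pi) ^+ 2 * pi * (2 * pi) * ((2 * x ^+ 2 + s2 * t * x) / 3) by field.
have H : (2 * x ^+ 2 + s2 * t * x) / 3 < m0 ^+ 2 / x0.
  rewrite ltr_pdivlMr//; apply: le_lt_trans final.
  have -> : 2 * x0 ^+ 3 / 3 + s2 * t0 * x0 ^+ 2 / 3 = (2 * x0 ^+ 2 + s2 * t0 * x0) / 3 * x0 by field.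
  apply: ler_wpM2r; first exact: ltW.
  rewrite ler_pM2r//; apply: lerD.
    by rewrite ler_pM2l// ler_pXn2r ?nnegrE// ltW.
  rewrite -(mulrA s2 t x) -(mulrA s2 t0 x0) ler_pM2l ?sqrt2_gt0//.
  by apply: ler_pM => //; rewrite /t divr_ge0// ltW.
apply: (@lt_le_trans _ _ ((2 * pi) ^+ 2 * pi * (2 * pi) * (m0 ^+ 2 / x0))).
  by rewrite ltr_pM2l// !mulr_gt0// exprn_gt0.
have -> : (2 * pi) ^+ 2 * pi * (2 * pi) * (m0 ^+ 2 / x0) = (2 * pi) ^+ 2 * (pi * (2 * pi * (m0 ^+ 2 / x0))).
  by rewrite -!mulrA.
by apply: ler_wpM2l; [exact: sqr_ge0|apply: ler_wpM2l => //; exact: ltW].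
Qed.

End test_function.

(** * Fourier coefficients *)

Section circle_orthogonality.
Context {R : realType}.
Implicit Types (j k n : nat) (x : R).

Lemma sin_2pi_nat n : sin (n%:R * (2 * pi)) = 0 :> R.
Proof.
elim: n => [|n IH]; first by rewrite mul0r sin0.
have -> : n.+1%:R * (2 * pi) = n%:R * (2 * pi) + pi *+ 2 :> R by rewrite -natr1; ring.
by rewrite sinD2pi.
Qed.

Lemma cont_cosn n : continuous (fun x => cos (n%:R * x)).
Proof. by cont1. Qed.

Lemma cont_sinn n : continuous (fun x => sin (n%:R * x)).
Proof. by cont1. Qed.

Lemma I1_cosn n : I1 (fun x => cos (n%:R * x)) = if n == 0%N then 2 * pi else 0 :> R.
Proof.
case: eqP => [->|/eqP n0].
  rewrite (@I1_FTC _ _ (fun x => x)) ?subr0//; first exact: cont_cosn.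
  by move=> x _; rewrite mul0r cos0; exact: der_id.
have nn : n%:R != 0 :> R by rewrite pnatr_eq0.
rewrite (@I1_FTC _ _ (fun x => n%:R^-1 * sin (n%:R * x))).
- by rewrite sin_2pi_nat !mulr0 sin0 mulr0 subrr.
- exact: cont_cosn.
- by move=> x _; derq; field.
Qed.

Lemma I1_coscos j k :
  I1 (fun x => cos (j%:R * x) * cos (k%:R * x)) =
  if j == k then (if j == 0%N then 2 * pi else pi) else 0 :> R.
Proof.
wlog jk : j k / (j <= k)%N => [H|].
  case: (leqP j k) => [/H//|/ltnW kj].
  rewrite -[LHS](_ : I1 (fun x => cos (k%:R * x) * cos (j%:R * x)) = _); last first.
    by apply: I1_ext => x; rewrite mulrC.
  rewrite H// eq_sym; case: eqP => // ->//.
transitivity (I1 (fun x => 2^-1 * cos ((k - j)%:R * x) + 2^-1 * cos ((k + j)%:R * x))).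
  by apply: I1_ext => x; rewrite natrB// natrD mulrBl mulrDl cosB cosD; field.
rewrite I1_lin; [|exact: cont_cosn..].
rewrite !I1_cosn subn_eq0 addn_eq0.
have [->|jk'] := eqVneq j k.
  by rewrite leqnn andbb; case: eqP => _; field.
by rewrite leqNgt ltn_neqAle jk' jk/= (_ : (k == 0%N) && (j == 0%N) = false); [field|lia].
Qed.

Lemma I1_sinsin j k :
  I1 (fun x => sin (j%:R * x) * sin (k%:R * x)) =
  if j == k then (if j == 0%N then 0 else pi) else 0 :> R.
Proof.
wlog jk : j k / (j <= k)%N => [H|].
  case: (leqP j k) => [/H//|/ltnW kj].
  rewrite -[LHS](_ : I1 (fun x => sin (k%:R * x) * sin (j%:R * x)) = _); last first.
    by apply: I1_ext => x; rewrite mulrC.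
  rewrite H// eq_sym; case: eqP => // ->//.
transitivity (I1 (fun x => 2^-1 * cos ((k - j)%:R * x) + - 2^-1 * cos ((k + j)%:R * x))).
  by apply: I1_ext => x; rewrite natrB// natrD mulrBl mulrDl cosB cosD; field.
rewrite I1_lin; [|exact: cont_cosn..].
rewrite !I1_cosn subn_eq0 addn_eq0.
have [->|jk'] := eqVneq j k.
  by rewrite leqnn andbb; case: eqP => _; field.
by rewrite leqNgt ltn_neqAle jk' jk/= (_ : (k == 0%N) && (j == 0%N) = false); [field|lia].
Qed.

Lemma I2_prod (f g : R -> R) : continuous f -> continuous g ->
  I2 (fun u v => f u * g v) = I1 f * I1 g.
Proof.
move=> cf cg.
have c2 : cont2 (fun u v => f u * g v) by apply: cont2M; [exact: cont2_fst|exact: cont2_snd].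
rewrite (I2_iter c2).1 mulrC -I1Z//; apply: I1_ext => u.
by rewrite I1Z// mulrC.
Qed.

Lemma I2_sum (I : Type) (s : seq I) (F : I -> R -> R -> R) :
  (forall i, cont2 (F i)) ->
  cont2 (fun u v => \sum_(i <- s) F i u v) /\
  I2 (fun u v => \sum_(i <- s) F i u v) = \sum_(i <- s) I2 (F i).
Proof.
move=> cF; elim: s => [|i s [IH1 IH2]].
  have -> : (fun u v => \sum_(i <- [::]) F i u v) = (fun _ _ => 0).
    by apply/funext => u; apply/funext => v; rewrite big_nil.
  by split; [exact: cont2_cst|rewrite I2_cst mul0r big_nil].
have -> : (fun u v => \sum_(i <- i :: s) F i u v) = (fun u v => F i u v + \sum_(i <- s) F i u v).
  by apply/funext => u; apply/funext => v; rewrite big_cons.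
split; first exact: cont2D.
by rewrite big_cons I2D// IH2.
Qed.

Lemma I2_sqr_orth (I : eqType) (s : seq I) (F : I -> R -> R -> R) (m a : I -> R) :
  uniq s -> (forall i, cont2 (F i)) ->
  {in s &, forall i i', I2 (fun u v => F i u v * F i' u v) = if i == i' then m i else 0} ->
  I2 (fun u v => (\sum_(i <- s) a i * F i u v) ^+ 2) = \sum_(i <- s) m i * a i ^+ 2.
Proof.
move=> us cF orth.
have cc i i' : cont2 (fun u v => a i * a i' * (F i u v * F i' u v)).
  by apply: cont2M; [exact: cont2_cst|exact: cont2M].
transitivity (I2 (fun u v => \sum_(i <- s) \sum_(i' <- s) a i * a i' * (F i u v * F i' u v))).
  apply: I2_ext => u v; rewrite expr2 mulr_suml; apply: eq_bigr => i _.
  by rewrite mulr_sumr; apply: eq_bigr => i' _; ring.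
rewrite (I2_sum _ _).2; last by move=> i; exact: (I2_sum _ _).1.
apply: eq_big_seq => i si.
rewrite (I2_sum _ _).2// (bigD1_seq i)//= I2Z; last exact: cont2M.
rewrite orth// eqxx big_seq_cond big1 => [|i' /andP[si' ii']]; first by rewrite addr0; ring.
by rewrite I2Z ?orth// 1?eq_sym ?(negbTE ii') ?mulr0//; exact: cont2M.
Qed.

End circle_orthogonality.

(** * Coefficients for the system cos (j u) sin (k v) *)

Section fourier.
Context {R : realType}.
Implicit Types (f g : R -> R -> R) (i : nat * nat) (a : nat * nat -> R).

(** Not normalised: on a trigonometric polynomial it gives [nu] times the coefficient, see
    [fc_tpoly]. In this form multiplication by cos u or cos v is a plain average over two
    neighbouring frequencies. *)
Definition fc f (j k : nat) : R :=
  I2 (fun u v => f u v * (cos (j%:R * u) * sin (k%:R * v))).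

Definition ebas i (u v : R) : R := cos (i.1%:R * u) * sin (i.2%:R * v).

(** The second frequency starts at 1 because sin (0 v) = 0; thus [lam] is at least 1 on every
    box. *)
Definition box (N : nat) : seq (nat * nat) :=
  [seq (j, k) | j <- iota 0 N, k <- iota 1 N].

(** [lam i] is the eigenvalue of minus the Laplacian on [ebas i], and [nu i] is the square norm of
    [ebas i] on the torus when i.2 > 0. *)
Definition lam i : R := i.1%:R ^+ 2 + i.2%:R ^+ 2.
Definition nu i : R := (if i.1 == 0%N then 2 * pi else pi) * pi.

Definition tpoly N a (u v : R) : R := \sum_(i <- box N) a i * ebas i u v.

Lemma box_uniq N : uniq (box N).
Proof. by apply: allpairs_uniq; rewrite ?iota_uniq// => -[? ?] [? ?]. Qed.

Lemma mem_box N i : (i \in box N) = (i.1 < N)%N && (0 < i.2 <= N)%N.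
Proof.
case: i => j k; apply/allpairsP/idP => [[[j' k'] /= []]|].
  by rewrite !mem_iota => ? ? [-> ->]; lia.
by move=> H; exists (j, k); rewrite !mem_iota/=; split => //; move: H => /=; lia.
Qed.

Lemma cont2_ebas i : cont2 (ebas i).
Proof. by apply: cont2M; [apply: cont2_fst; exact: cont_cosn|apply: cont2_snd; exact: cont_sinn]. Qed.

Lemma cont2_tpoly N a : cont2 (tpoly N a).
Proof.
by apply: (I2_sum _ _).1 => i; apply: cont2M; [exact: cont2_cst|exact: cont2_ebas].
Qed.

Lemma I2_4 (f1 f2 g1 g2 : R -> R) : continuous f1 -> continuous f2 -> continuous g1 -> continuous g2 ->
  I2 (fun u v => (f1 u * g1 v) * (f2 u * g2 v)) = I1 (fun u => f1 u * f2 u) * I1 (fun v => g1 v * g2 v).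
Proof.
move=> *; rewrite -I2_prod; [|exact: contM|exact: contM].
by apply: I2_ext => u v; ring.
Qed.

Lemma ebas_orth N : {in box N &, forall i i',
  I2 (fun u v => ebas i u v * ebas i' u v) = if i == i' then nu i else 0}.
Proof.
move=> [j k] [j' k']; rewrite !mem_box/= => H1 H2.
rewrite I2_4; [|exact: cont_cosn|exact: cont_cosn|exact: cont_sinn|exact: cont_sinn].
rewrite I1_coscos I1_sinsin xpair_eqE /nu/=.
case: (j =P j') => [_|_] /=; last by rewrite mul0r.
case: (k =P k') => [_|_]; last by rewrite mulr0.
by case: k H1 => //=; lia.
Qed.

Lemma fc_tpoly N a j k : fc (tpoly N a) j k =
  if (j, k) \in box N then nu (j, k) * a (j, k) else 0.
Proof.
rewrite /fc.
transitivity (I2 (fun u v => \sum_(i <- box N) a i * (ebas i u v * ebas (j, k) u v))).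
  apply: I2_ext => u v; rewrite /tpoly mulr_suml.
  by apply: eq_bigr => i _; rewrite /ebas/=; ring.
rewrite (I2_sum _ _).2; last first.
  by move=> i; apply: cont2M; [exact: cont2_cst|apply: cont2M; exact: cont2_ebas].
case: ifPn => jk.
  rewrite (bigD1_seq (j, k))//= ?box_uniq// I2Z; last by apply: cont2M; exact: cont2_ebas.
  rewrite (ebas_orth jk jk) eqxx big_seq_cond big1 ?addr0 1?mulrC//.
  move=> i /andP[si ii]; rewrite I2Z; last by apply: cont2M; exact: cont2_ebas.
  by rewrite (ebas_orth si jk) (negbTE ii) mulr0.
have H i : i \in box N -> I2 (fun u v => ebas i u v * ebas (j, k) u v) = 0.
  move=> si; case: k jk => [|k] jk.
    transitivity (I2 (fun _ _ : R => 0 : R)); last by rewrite I2_cst mul0r.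
    by apply: I2_ext => u v; rewrite /ebas /= mul0r sin0 !mulr0.
  have [M [iM jM]] : exists M, i \in box M /\ (j, k.+1) \in box M.
    by exists (N + j + k).+1; move: si; rewrite !mem_box/=; lia.
  by rewrite (ebas_orth iM jM); case: eqP => // e; rewrite -e si in jk.
rewrite big_seq big1// => i si; rewrite I2Z ?H ?mulr0//.
by apply: cont2M; exact: cont2_ebas.
Qed.

Lemma nu_ge1 i : 1 <= nu i.
Proof.
have p2 : 2 <= pi :> R by exact: pi_ge2.
by rewrite /nu; case: ifP => _; nra.
Qed.

Lemma nu_le i : nu i <= 2 * pi ^+ 2.
Proof.
have p2 : 2 <= pi :> R by exact: pi_ge2.
by rewrite /nu; case: ifP => _; nra.
Qed.

Lemma fc0 f j : fc f j 0 = 0.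
Proof.
transitivity (I2 (fun _ _ : R => 0 : R)); last by rewrite I2_cst mul0r.
by apply: I2_ext => u v; rewrite mul0r sin0 !mulr0.
Qed.

Lemma fcD f g j k : cont2 f -> cont2 g ->
  fc (fun u v => f u v + g u v) j k = fc f j k + fc g j k.
Proof.
move=> cf cg; rewrite /fc -I2D; [|apply: cont2M => //; exact: (@cont2_ebas (j, k))..].
by apply: I2_ext => u v; ring.
Qed.

Lemma fcZ c f j k : cont2 f -> fc (fun u v => c * f u v) j k = c * fc f j k.
Proof.
move=> cf; rewrite /fc -I2Z; last by apply: cont2M => //; exact: (@cont2_ebas (j, k)).
by apply: I2_ext => u v; ring.
Qed.

Lemma fc_bound f : cont2 f -> exists M, forall j k, `|fc f j k| <= M.
Proof.
move=> cf; have [M M0 HM] := cont2_bounded cf.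
exists (M * (2 * pi) ^+ 2) => j k; rewrite -I2_cst.
have ce : cont2 (fun u v => f u v * (cos (j%:R * u) * sin (k%:R * v))).
  by apply: cont2M => //; exact: (@cont2_ebas (j, k)).
have H u v : circ u -> circ v -> `|f u v * (cos (j%:R * u) * sin (k%:R * v))| <= M.
  move=> cu cv; rewrite normrM -[M]mulr1; apply: ler_pM => //; first by apply: (HM (u, v)).
  rewrite normrM -[1]mulr1; apply: ler_pM => //; rewrite ler_norml.
    by rewrite cos_geN1 cos_le1.
  by rewrite sin_geN1 sin_le1.
rewrite ler_norml; apply/andP; split; last first.
  by apply: le_I2 => //; [exact: cont2_cst|move=> u v cu cv; apply: le_trans (H _ _ cu cv); exact: ler_norm].
rewrite I2_cst -mulNr -I2_cst; apply: le_I2 => //; first exact: cont2_cst.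
by move=> u v cu cv; have := H _ _ cu cv; rewrite ler_norml => /andP[].
Qed.

(* j - 1 reflected at 0, since cos is even *)
Definition predr (j : nat) := if j is j'.+1 then j' else 1%N.

Lemma cosu_ebas j k (u v : R) : cos u * ebas (j, k) u v =
  2^-1 * (ebas (j.+1, k) u v + ebas (predr j, k) u v).
Proof.
rewrite /ebas/=; case: j => [|j] /=.
  by rewrite mul0r cos0 !mul1r; field.
rewrite -(natr1 j.+1) mulrDl mul1r cosD.
have -> : j%:R * u = j.+1%:R * u - u by rewrite -natr1; ring.
by rewrite cosB; field.
Qed.

Lemma cosv_ebas j k (u v : R) : cos v * ebas (j, k.+1) u v =
  2^-1 * (ebas (j, k.+2) u v + ebas (j, k) u v).
Proof.
rewrite /ebas/= -(natr1 k.+1) mulrDl mul1r sinD.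
have -> : k%:R * v = k.+1%:R * v - v by rewrite -natr1; ring.
by rewrite sinB; field.
Qed.

Lemma fc_cosu f j k : cont2 f ->
  fc (fun u v => cos u * f u v) j k = 2^-1 * (fc f j.+1 k + fc f (predr j) k).
Proof.
move=> cf.
have ce i : cont2 (fun u v => f u v * ebas i u v) by apply: cont2M => //; exact: cont2_ebas.
rewrite /fc -I2D; [|exact: (ce (_, _))..].
rewrite -I2Z; last by apply: cont2D; exact: (ce (_, _)).
apply: I2_ext => u v.
rewrite -[cos (j%:R * u) * _]/(ebas (j, k) u v) mulrAC (mulrC (cos u)) -mulrA (mulrCA _ (cos u)).
by rewrite mulrC (mulrC _ (f u v)) -mulrA [_ * cos u]mulrC cosu_ebas /ebas/=; ring.
Qed.

Lemma fc_cosv f j k : cont2 f ->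
  fc (fun u v => cos v * f u v) j k.+1 = 2^-1 * (fc f j k.+2 + fc f j k).
Proof.
move=> cf.
have ce i : cont2 (fun u v => f u v * ebas i u v) by apply: cont2M => //; exact: cont2_ebas.
rewrite /fc -I2D; [|exact: (ce (_, _))..].
rewrite -I2Z; last by apply: cont2D; exact: (ce (_, _)).
apply: I2_ext => u v.
transitivity (f u v * (cos v * ebas (j, k.+1) u v)); first by rewrite /ebas/=; ring.
by rewrite cosv_ebas /ebas/=; ring.
Qed.

End fourier.

(** * Ultrafilter limits and decay of Fourier coefficients *)

Section ultrafilter_limits.
Context {R : realType}.

Lemma ultrafilter_nat : exists U : set_system nat, UltraFilter U /\ \oo `<=` U.
Proof. exact: ultraFilterLemma. Qed.

Context (U : set_system nat) {UU : UltraFilter U}.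
Hypothesis Uoo : \oo `<=` U.
Implicit Types (a b : nat -> R) (l M : R).

Lemma U_ge (N : nat) : U [set n | (N <= n)%N].
Proof. by apply: Uoo; exists N. Qed.

(** A single ultrafilter gives limits to all bounded sequences at once. This takes the place of
    diagonal subsequences and allows limits at every point (u, v) simultaneously. *)
Lemma ultra_cvg a M : U [set n | `|a n| <= M] -> exists l, a @ U --> l.
Proof.
move=> UM.
have cM : compact (`[- M, M]%classic : set R) by exact: segment_compact.
have FU : (a @ U) `[- M, M]%classic.
  have h : [set n | `|a n| <= M] `<=` a @^-1` `[- M, M]%classic.
    by move=> n; rewrite /= in_itv/= ler_norml.
  exact: filterS h UM.
have [l [_ cl]] := cM (a @ U) _ FU.
exists l => V Vl.
have [//|nV] := @in_ultra_setVsetC _ U (a @^-1` V) UU.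
have : (a @ U) (~` V) by exact: nV.
by move=> FV; have [x []] := cl _ _ FV Vl.
Qed.

Lemma ultra_le a l M : a @ U --> l -> U [set n | a n <= M] -> l <= M.
Proof.
by move=> al UM; exact: cvgr_to_le al UM.
Qed.

Lemma ultra_ge a l M : a @ U --> l -> U [set n | M <= a n] -> M <= l.
Proof.
by move=> al UM; exact: cvgr_to_ge al UM.
Qed.

Lemma ultra_norm_le a l M : a @ U --> l -> U [set n | `|a n| <= M] -> `|l| <= M.
Proof. by move=> al; apply: ultra_le; exact: cvg_norm. Qed.

Lemma ultra_unique a l l' : a @ U --> l -> a @ U --> l' -> l = l'.
Proof. by move=> h h'; apply: cvg_unique h h'. Qed.

Lemma ultra_sum (I : Type) (s : seq I) (F : I -> nat -> R) (L : I -> R) :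
  (forall i, F i n @[n --> U] --> L i) ->
  \sum_(i <- s) F i n @[n --> U] --> \sum_(i <- s) L i.
Proof.
move=> FL; elim: s => [|i s IH].
  by rewrite big_nil; under eq_fun do rewrite big_nil; exact: cvg_cst.
rewrite big_cons; under eq_fun do rewrite big_cons.
exact: cvgD.
Qed.

End ultrafilter_limits.

(** * Maximum of a quadratic form on an ellipsoid *)

Section quadratic_form.
Context {R : realType} {I : eqType}.
Variables (s : seq I) (b : I -> I -> R) (m : I -> R).
Hypotheses (us : uniq s) (s0 : s != [::]) (bC : forall i j, b i j = b j i)
  (m0 : forall i, 0 < m i).

Let B (a : I -> R) := \sum_(i <- s) \sum_(j <- s) a i * a j * b i j.
Let E (a : I -> R) := \sum_(i <- s) m i * a i ^+ 2.

(** S is the supremum of B on the ellipsoid E = 1, attained at an ultrafilter limit of a maximising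
    sequence. Homogeneity extends B <= S E to all vectors, and the vanishing of the first variation
    in each coordinate gives the eigenvector equations with multiplier S. *)
Lemma quadratic_max : exists (a : I -> R) S,
  [/\ E a = 1, forall i, i \in s -> \sum_(j <- s) b i j * a j = S * m i * a i &
    forall a', B a' <= S * E a'].
Proof.
have [i0 i0s] : exists i0, i0 \in s by case: s s0 => // i t _; exists i; rewrite mem_head.
have Ebound a i : E a = 1 -> i \in s -> `|a i| <= (m i)^-1 + 1.
  move=> Ea si.
  have h : m i * a i ^+ 2 <= 1.
    rewrite -Ea /E (bigD1_seq i)//= lerDl; apply: sumr_ge0 => j _.
    by rewrite mulr_ge0 ?sqr_ge0// ltW.
  have h2 : `|a i| ^+ 2 <= (m i)^-1 by rewrite real_normK ?num_real// -[leRHS]mul1r ler_pdivlMr// mulrC.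
  have := m0 i; rewrite -invr_gt0; have := normr_ge0 (a i); nra.
pose K := \sum_(i <- s) \sum_(j <- s) ((m i)^-1 + 1) * ((m j)^-1 + 1) * `|b i j|.
have Bbound a : E a = 1 -> B a <= K.
  move=> Ea; rewrite /B /K big_seq [leRHS]big_seq; apply: ler_sum => i si.
  rewrite big_seq [leRHS]big_seq; apply: ler_sum => j sj.
  by rewrite (le_trans (ler_norm _))// !normrM ler_wpM2r// ler_pM//; apply: Ebound.
pose A := [set B a | a in [set a | E a = 1]].
have hA : has_sup A.
  split; last by exists K => _ [a Ea <-]; exact: Bbound.
  exists (B (fun i => if i == i0 then (Num.sqrt (m i0))^-1 else 0)).
  exists (fun i => if i == i0 then (Num.sqrt (m i0))^-1 else 0) => //=.
  rewrite /E (bigD1_seq i0)//= eqxx big1 ?addr0.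
    by rewrite exprVn sqr_sqrtr ?divff ?gt_eqF// ltW.
  by move=> i /negbTE ->; rewrite expr0n mulr0.
pose S := sup A.
have SB a : E a = 1 -> B a <= S by move=> Ea; apply: sup_upper_bound => //; exists a.
have /boolp.choice[an Han] : forall n, exists a, E a = 1 /\ S - n.+1%:R^-1 < B a.
  move=> n.
  have [||_ [a Ea <-] h] := @sup_adherent _ A n.+1%:R^-1; [|exact: hA|by exists a].
  by rewrite invr_gt0.
have [U [UU Uoo]] := ultrafilter_nat.
have /boolp.choice[a Ha] : forall i, exists l : R, i \in s -> an n i @[n --> U] --> l.
  move=> i; case: (boolP (i \in s)) => si; last by exists 0.
  have [|l hl] := @ultra_cvg _ U UU (fun n => an n i) ((m i)^-1 + 1).
    by apply: filterE => n; apply: Ebound => //; exact: (Han n).1.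
  by exists l.
(* Off s the coordinates are set to 0, so that convergence holds at every index, as [ultra_sum]
   asks. *)
pose a0 i := if i \in s then a i else 0.
pose an0 n i := if i \in s then an n i else 0.
have Ha0 i : an0 n i @[n --> U] --> a0 i.
  rewrite /an0 /a0; case: ifPn => [/Ha//|_]; exact: cvg_cst.
have Bn n : B (an n) = \sum_(i <- s) \sum_(j <- s) an0 n i * an0 n j * b i j.
  rewrite /B big_seq [RHS]big_seq; apply: eq_bigr => i si.
  by rewrite big_seq [RHS]big_seq; apply: eq_bigr => j sj; rewrite /an0 si sj.
have En n : E (an n) = \sum_(i <- s) m i * an0 n i ^+ 2.
  by rewrite /E big_seq [RHS]big_seq; apply: eq_bigr => i si; rewrite /an0 si.
have cB : B (an n) @[n --> U] --> B a0.
  under eq_fun do rewrite Bn.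
  apply: ultra_sum => i; apply: ultra_sum => j.
  by apply: cvgM; [apply: cvgM; exact: Ha0|exact: cvg_cst].
have cE : E (an n) @[n --> U] --> E a0.
  under eq_fun do rewrite En.
  apply: ultra_sum => i; apply: cvgM; first exact: cvg_cst.
  by under eq_fun do rewrite expr2; rewrite expr2; apply: cvgM; exact: Ha0.
have Ea0 : E a0 = 1.
  apply: (ultra_unique (U:=U) cE).
  by under eq_fun do rewrite (Han _).1; exact: cvg_cst.
have Ba0 : B a0 = S.
  apply/eqP; rewrite eq_le SB//=; apply/ler_addgt0Pr => e e0.
  rewrite -lerBlDr; apply: (ultra_ge (U:=U) cB).
  have [n0 hn0] : exists n0, n0.+1%:R^-1 < e :> R.
    by have [n _ hn] := near_infty_natSinv_lt (PosNum e0); exists n; exact: (hn n (leqnn n)).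
  apply: filterS (U_ge Uoo n0) => n /= n0n.
  apply: le_trans (ltW (Han n).2); rewrite lerB//.
  by apply: le_trans (ltW hn0); rewrite lef_pV2 ?posrE// ler_nat ltnS.
have BS a' : B a' <= S * E a'.
  have E0 : 0 <= E a' by apply: sumr_ge0 => i _; rewrite mulr_ge0 ?sqr_ge0// ltW.
  have [Ez|En0] := eqVneq (E a') 0.
    rewrite Ez mulr0 /B big_seq big1// => i si; rewrite big_seq big1// => j sj.
    suff -> : a' i = 0 by rewrite !mul0r.
    move: Ez => /eqP; rewrite /E psumr_eq0; last by move=> k _; rewrite mulr_ge0 ?sqr_ge0// ltW.
    by move=> /allP/(_ _ si)/=; rewrite mulf_eq0 gt_eqF//= sqrf_eq0 => /eqP.
  pose c := (Num.sqrt (E a'))^-1.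
  have c2 : c ^+ 2 = (E a')^-1 by rewrite exprVn sqr_sqrtr.
  have Ep : 0 < E a' by rewrite lt_neqAle eq_sym En0.
  have : B (fun i => c * a' i) <= S.
    apply: SB; rewrite /E.
    transitivity (c ^+ 2 * E a'); last by rewrite c2 mulVf.
    by rewrite /E mulr_sumr; apply: eq_bigr => i _; ring.
  have -> : B (fun i => c * a' i) = c ^+ 2 * B a'.
    rewrite /B mulr_sumr; apply: eq_bigr => i _; rewrite mulr_sumr; apply: eq_bigr => j _; ring.
  by rewrite c2 mulrC ler_pdivrMr.
exists a0, S; split => // i si.
pose t0 := \sum_(j <- s) b i j * a0 j.
pose dl j : R := if j == i then 1 else 0.
have sd (F : I -> R) : \sum_(j <- s) dl j * F j = F i.
  rewrite (bigD1_seq i)//= /dl eqxx mul1r big1 ?addr0// => j /negbTE ->.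
  by rewrite mul0r.
have Bt t : B (fun j => a0 j + t * dl j) = S + 2 * t * t0 + t ^+ 2 * b i i.
  have -> : S + 2 * t * t0 + t ^+ 2 * b i i = B a0 + t * t0 + t * t0 + t ^+ 2 * b i i.
    by rewrite Ba0; ring.
  rewrite /B.
  transitivity (\sum_(j <- s) (\sum_(k <- s) a0 j * a0 k * b j k +
     (t * (a0 j * b j i)) + (t * (dl j * t0)) + t ^+ 2 * (dl j * b j i))).
    apply: eq_bigr => j _.
    transitivity (\sum_(k <- s) (a0 j * a0 k * b j k + t * (dl k * (a0 j * b j k)) + t * dl j * (b j k * a0 k) + t ^+ 2 * dl j * (dl k * b j k))).
      by apply: eq_bigr => k _; ring.
    rewrite !big_split/= -!mulr_sumr !sd; congr (_ + _ + _ + _); last by ring.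
    by rewrite /t0 /dl; case: eqP => [->|_]; rewrite ?mulr0 ?mul0r//; ring.
  rewrite !big_split/= -!mulr_sumr !sd; congr (_ + _ * _ + _ + _).
  by rewrite /t0; apply: eq_bigr => j _; rewrite mulrC bC.
have Et t : E (fun j => a0 j + t * dl j) = 1 + 2 * t * (m i * a0 i) + t ^+ 2 * m i.
  transitivity (E a0 + 2 * t * (m i * a0 i) + t ^+ 2 * m i); last by rewrite Ea0.
  rewrite /E; transitivity (\sum_(j <- s) (m j * a0 j ^+ 2 + 2 * t * (dl j * (m j * a0 j)) + t ^+ 2 * (dl j * m j))).
    by apply: eq_bigr => j _; rewrite /dl; case: eqP => _; ring.
  by rewrite !big_split/= -!mulr_sumr !sd.
have H t : 0 <= 2 * t * (S * m i * a0 i - t0) + t ^+ 2 * (S * m i - b i i).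
  by have := BS (fun j => a0 j + t * dl j); rewrite Bt Et -subr_ge0; congr (_ <= _); ring.
suff : S * m i * a0 i - t0 = 0 by move/eqP; rewrite subr_eq0 => /eqP.
move: H; set x := _ - t0; set y := _ - b i i => H.
have yn : 0 < `|y| + 1 by rewrite ltr_wpDl.
(* A t opposite in sign to x and so small that the linear term 2 t x dominates t^2 y; the expression
   is then negative unless x = 0. *)
have := H (- x / (`|y| + 1)).
have -> : 2 * (- x / (`|y| + 1)) * x + (- x / (`|y| + 1)) ^+ 2 * y = (x / (`|y| + 1)) ^+ 2 * (y - 2 * (`|y| + 1)).
  by field; rewrite gt_eqF.
have yy : y - 2 * (`|y| + 1) < 0 by have := ler_norm y; have := normr_ge0 y; lra.
rewrite nmulr_lge0// => h.
have : (x / (`|y| + 1)) ^+ 2 = 0 by apply/eqP; rewrite eq_le h sqr_ge0.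
by move/eqP; rewrite sqrf_eq0 mulf_eq0 invr_eq0 (gt_eqF yn) orbF => /eqP.
Qed.

End quadratic_form.

(** * Division by w preserves the decay of Fourier coefficients *)

Section decay.
Context {R : realType}.
Variables (al be : R).
Local Notation s2 := (Num.sqrt (2 : R)).
Hypotheses (al0 : 0 <= al) (be0 : 0 <= be) (ab : al + be < s2).
Implicit Types (f g : R -> R -> R).
Definition wfun (u v : R) := s2 - al * cos u - be * cos v.
Local Notation w := wfun.

Lemma cont_cos : continuous (@cos R). Proof. exact: continuous_cos. Qed.

Lemma cont2_wfun : cont2 w.
Proof.
apply: cont2D; first apply: cont2D; first exact: cont2_cst.
  by apply: cont2N; apply: cont2_fst; cont1.
by apply: cont2N; apply: cont2_snd; cont1.
Qed.

Lemma wfun_ge u v : s2 - al - be <= w u v.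
Proof.
have h1 : al * cos u <= al by rewrite ler_piMr// cos_le1.
have h2 : be * cos v <= be by rewrite ler_piMr// cos_le1.
by rewrite /w; lra.
Qed.

Lemma wfun_gt0 u v : 0 < w u v.
Proof. by have := wfun_ge u v; move: ab; lra. Qed.

Lemma fc_wfun f j k : cont2 f ->
  fc (fun u v => w u v * f u v) j k.+1 = s2 * fc f j k.+1
   - al / 2 * (fc f j.+1 k.+1 + fc f (predr j) k.+1)
   - be / 2 * (fc f j k.+2 + fc f j k).
Proof.
move=> cf.
have c1 : cont2 (fun u v => cos u * f u v) by apply: cont2M => //; apply: cont2_fst; exact: cont_cos.
have c2 : cont2 (fun u v => cos v * f u v) by apply: cont2M => //; apply: cont2_snd; exact: cont_cos.
have cc a (h : R -> R -> R) : cont2 h -> cont2 (fun u v => a * h u v).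
  by move=> ch; apply: cont2M => //; exact: cont2_cst.
transitivity (fc (fun u v => s2 * f u v + (- al * (cos u * f u v) + - be * (cos v * f u v))) j k.+1).
  by apply: I2_ext => u v; rewrite /w; ring.
rewrite !fcD ?fcZ ?fc_cosu ?fc_cosv//; try exact: cc; last by apply: cont2D; exact: cc.
by field.
Qed.

Lemma nat_near (x y : nat) : (x <= y.+1)%N -> (y <= x.+1)%N ->
  x = y.+1 \/ x = y \/ x.+1 = y.
Proof. lia. Qed.

Lemma shift_near (j k : nat) :
  [/\ (j.+1 + k.+1 <= (j + k.+1).+1)%N, (j + k.+1 <= (j.+1 + k.+1).+1)%N,
      (predr j + k.+1 <= (j + k.+1).+1)%N & (j + k.+1 <= (predr j + k.+1).+1)%N] /\
  [/\ (j + k.+2 <= (j + k.+1).+1)%N, (j + k.+1 <= (j + k.+2).+1)%N,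
      (j + k <= (j + k.+1).+1)%N & (j + k.+1 <= (j + k).+1)%N].
Proof. by case: j => [|j] /=; split; split; lia. Qed.

(* Pointwise, 2^(1/2) |fc f| <= |fc g| + a convex-like average of neighbours with
   total mass (al + be) r < 2^(1/2); iterating kills the a priori bound. *)
Lemma fc_decay f g (p : nat -> R) (C r : R) :
  cont2 f -> (forall u v, w u v * f u v = g u v) ->
  (forall n, 0 <= p n) -> (forall n, p n.+1 <= p n) -> (forall n, p n <= r * p n.+1) ->
  1 <= r -> (al + be) * r < s2 -> 0 <= C ->
  (forall j k, `|fc g j k| <= C * p (j + k)%N) ->
  forall j k, `|fc f j k| <= C / (s2 - (al + be) * r) * p (j + k)%N.
Proof.
move=> cf fg p0 pd pr r1 rs C0 Cg.
have [M HM] := fc_bound cf.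
have M0 : 0 <= M by apply: le_trans (HM 0%N 0%N); exact: normr_ge0.
have s20 : 0 < s2 by rewrite sqrtr_gt0.
pose A := C / (s2 - (al + be) * r).
have D0 : 0 < s2 - (al + be) * r by rewrite subr_gt0.
have A0 : 0 <= A by rewrite divr_ge0// ltW.
pose q := (al + be) / s2.
have q0 : 0 <= q by rewrite divr_ge0 ?addr_ge0// ltW.
have q1 : q < 1 by rewrite ltr_pdivrMr// mul1r.
have key n : forall j k, `|fc f j k| <= A * p (j + k)%N + q ^+ n * M.
  elim: n => [|n IH] j k.
    rewrite expr0 mul1r; apply: le_trans (HM j k) _.
    by rewrite lerDr mulr_ge0.
  case: k => [|k].
    by rewrite fc0 normr0 addr_ge0// mulr_ge0// exprn_ge0.
  pose P := p (j + k.+1)%N; pose Q := q ^+ n * M.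
  have nb j' k' : (j' + k' <= (j + k.+1).+1)%N -> ((j + k.+1) <= (j' + k').+1)%N ->
      `|fc f j' k'| <= A * (r * P) + Q.
    move=> h1 h2; apply: le_trans (IH j' k') _; rewrite lerD2r ler_wpM2l//.
    have P0 : 0 <= P by exact: p0.
    have [->|[->|e]] := nat_near h1 h2.
    - by apply: le_trans (pd _) _; rewrite -/P ler_peMl.
    - by rewrite -/P ler_peMl.
    - by rewrite /P -e; exact: pr.
  have e : s2 * fc f j k.+1 = fc g j k.+1 + al / 2 * (fc f j.+1 k.+1 + fc f (predr j) k.+1)
     + be / 2 * (fc f j k.+2 + fc f j k).
    have -> : fc g j k.+1 = fc (fun u v => w u v * f u v) j k.+1.
      by apply: I2_ext => u v; rewrite fg.
    by rewrite fc_wfun//; ring.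
  have [[a1 a2 a3 a4] [a5 a6 a7 a8]] := shift_near j k.
  have n1 : `|fc f j.+1 k.+1| <= A * (r * P) + Q by exact: nb.
  have n2 : `|fc f (predr j) k.+1| <= A * (r * P) + Q by exact: nb.
  have n3 : `|fc f j k.+2| <= A * (r * P) + Q by exact: nb.
  have n4 : `|fc f j k| <= A * (r * P) + Q by exact: nb.
  have h : s2 * `|fc f j k.+1| <= C * P + (al + be) * (A * (r * P) + Q).
    rewrite -[X in X * _](ger0_norm (ltW s20)) -normrM e.
    apply: le_trans (ler_normD _ _) _.
    have -> : C * P + (al + be) * (A * (r * P) + Q) = C * P + al / 2 * ((A * (r * P) + Q) + (A * (r * P) + Q)) + be / 2 * ((A * (r * P) + Q) + (A * (r * P) + Q)) by field.
    apply: lerD.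
      apply: le_trans (ler_normD _ _) _; apply: lerD; first exact: Cg.
      rewrite normrM ger0_norm ?divr_ge0// ler_wpM2l ?divr_ge0//.
      by apply: le_trans (ler_normD _ _) _; exact: lerD.
    rewrite normrM ger0_norm ?divr_ge0// ler_wpM2l ?divr_ge0//.
    by apply: le_trans (ler_normD _ _) _; exact: lerD.
  rewrite -(ler_pM2l s20); apply: le_trans h _; apply: eq_ler.
  rewrite exprS /q -/P; have -> : C = A * (s2 - (al + be) * r) by rewrite /A divfK// gt_eqF.
  by rewrite /Q; field; rewrite gt_eqF.
move=> j k; rewrite -/A; apply/ler_addgt0Pr => e e0.
have cq : q ^+ n * M @[n --> \oo] --> (0 : R).
  by rewrite -[X in _ --> X](mul0r M); apply: cvgM; [apply: cvg_expr; rewrite ger0_norm|exact: cvg_cst].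
have [n _ /(_ n (leqnn n)) hn] := cvgr0_norm_lt _ cq _ e0.
apply: le_trans (key n j k) _; rewrite lerD2l.
by apply: ltW; apply: le_lt_trans hn; exact: ler_norm.
Qed.

End decay.

(** * Galerkin solutions *)

Section galerkin.
Context {R : realType}.
Variables (al be : R).
Local Notation s2 := (Num.sqrt (2 : R)).
Hypotheses (al0 : 0 <= al) (be0 : 0 <= be) (ab : al + be < s2).
Local Notation w := (wfun al be).
Implicit Types (a : nat * nat -> R) (i : nat * nat) (N : nat) (S : R).

Definition conf_weight (u v : R) := (w u v)^-1 ^+ 2.

Let wgt0 u v : 0 < w u v. Proof. exact: wfun_gt0. Qed.

Lemma cont2_winv : cont2 (fun u v => (w u v)^-1).
Proof. by apply: cont2V; [move=> u v; rewrite gt_eqF|exact: cont2_wfun]. Qed.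

Lemma cont2_conf_weight : cont2 conf_weight.
Proof. by apply: cont2X; exact: cont2_winv. Qed.

Lemma lam_ge1 i : (0 < i.2)%N -> 1 <= lam i :> R.
Proof.
move=> i2; rewrite /lam ler_wpDl ?sqr_ge0// -[leLHS](expr1n _ 2).
by rewrite ler_pXn2r ?nnegrE// ler1n.
Qed.

Definition energy N a := \sum_(i <- box N) lam i * nu i * a i ^+ 2.

(** The equation S (- Laplacian T) = w^(-2) T, tested against the frequencies of the box only. S is
    the reciprocal of an eigenvalue: the energy is normalised and the weighted square norm is what
    gets maximised. *)
Definition galerkin_solution N a S :=
  energy N a = 1 /\
  forall i, i \in box N ->
    S * lam i * (nu i * a i) = fc (fun u v => conf_weight u v * tpoly N a u v) i.1 i.2.

Let b i i' := I2 (fun u v => conf_weight u v * (ebas i u v * ebas i' u v)).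

Let cree i i' : cont2 (fun u v => conf_weight u v * (ebas i u v * ebas i' u v)).
Proof. by apply: cont2M; [exact: cont2_conf_weight|apply: cont2M; exact: cont2_ebas]. Qed.

Let fc_rho N a i : fc (fun u v => conf_weight u v * tpoly N a u v) i.1 i.2 =
  \sum_(j <- box N) b i j * a j.
Proof.
rewrite /fc.
transitivity (I2 (fun u v => \sum_(j <- box N) a j * (conf_weight u v * (ebas i u v * ebas j u v)))).
  apply: I2_ext => u v; rewrite /tpoly mulrAC mulr_sumr; apply: eq_bigr => j _.
  by rewrite /ebas; ring.
rewrite (I2_sum _ _).2; last by move=> j; apply: cont2M; [exact: cont2_cst|].
by apply: eq_bigr => j _; rewrite I2Z// mulrC.
Qed.

Let quad N a : I2 (fun u v => conf_weight u v * tpoly N a u v ^+ 2) =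
  \sum_(i <- box N) \sum_(j <- box N) a i * a j * b i j.
Proof.
transitivity (I2 (fun u v => \sum_(i <- box N) \sum_(j <- box N) a i * a j * (conf_weight u v * (ebas i u v * ebas j u v)))).
  apply: I2_ext => u v; rewrite /tpoly expr2 mulr_suml mulr_sumr; apply: eq_bigr => i _.
  by rewrite mulrC mulr_sumr mulr_suml; apply: eq_bigr => j _; ring.
have c1 i j : cont2 (fun u v => a i * a j * (conf_weight u v * (ebas i u v * ebas j u v))).
  by apply: cont2M; [exact: cont2_cst|].
rewrite (I2_sum _ _).2; last by move=> i; exact: (I2_sum _ _).1.
by apply: eq_bigr => i _; rewrite (I2_sum _ _).2//; apply: eq_bigr => j _; rewrite I2Z.
Qed.

Lemma galerkin_exists N : (0 < N)%N -> exists a S, [/\ galerkin_solution N a S,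
  S = I2 (fun u v => conf_weight u v * tpoly N a u v ^+ 2) &
  forall a', I2 (fun u v => conf_weight u v * tpoly N a' u v ^+ 2) <= S * energy N a'].
Proof.
move=> N0.
(* [quadratic_max] wants positive weights at all indices, but [lam] vanishes at (0, 0), which is
   outside the box; hence the value 1 there. *)
pose m i : R := if i \in box N then lam i * nu i else 1.
have m0 i : 0 < m i.
  rewrite /m; case: ifPn => //; rewrite mem_box => /andP[_ /andP[i2 _]].
  rewrite mulr_gt0//; first by apply: lt_le_trans (lam_ge1 i2).
  by apply: lt_le_trans (nu_ge1 i).
have s0 : box N != [::].
  apply/eqP => e; have : (0%N, 1%N) \in box N by rewrite mem_box/= N0.
  by rewrite e.
have bC i j : b i j = b j i.
  by apply: I2_ext => u v; rewrite (mulrC (ebas i u v)).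
have Em a : \sum_(i <- box N) m i * a i ^+ 2 = energy N a.
  by rewrite /energy big_seq [RHS]big_seq; apply: eq_bigr => i ib; rewrite /m ib.
have [a [S [Ea EL BS]]] := quadratic_max (box_uniq N) s0 bC m0.
exists a, S; split.
- split; first by rewrite -Em.
  by move=> i ib; rewrite fc_rho EL// /m ib; ring.
- rewrite quad -[LHS]mulr1 -Ea mulr_sumr big_seq [RHS]big_seq.
  apply: eq_bigr => i ib.
  transitivity (a i * (S * m i * a i)); first by ring.
  by rewrite -EL// mulr_sumr; apply: eq_bigr => j _; ring.
- by move=> a'; rewrite quad -Em; exact: BS.
Qed.

Lemma galerkin_fc N a S : galerkin_solution N a S ->
  forall j k, S * lam (j, k) * fc (tpoly N a) j k =
  if (j, k) \in box N then fc (fun u v => conf_weight u v * tpoly N a u v) j k else 0.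
Proof.
move=> [_ H] j k; rewrite fc_tpoly; case: ifPn => jk; last by rewrite mulr0.
exact: (H _ jk).
Qed.

Lemma galerkin_coef_le1 N a S i : galerkin_solution N a S -> i \in box N -> `|a i| <= 1.
Proof.
move=> [E _] ib.
have i2 : (0 < i.2)%N by move: ib; rewrite mem_box => /and3P[].
have h : lam i * nu i * a i ^+ 2 <= 1.
  rewrite -E /energy (bigD1_seq i)//= ?box_uniq// lerDl sumr_ge0// => j _.
  rewrite mulr_ge0 ?sqr_ge0// mulr_ge0//; first by rewrite addr_ge0 ?sqr_ge0.
  by apply: le_trans (nu_ge1 j).
rewrite -(@ler_pXn2r _ 2)// ?nnegrE// expr1n real_normK ?num_real//.
apply: le_trans h; rewrite ler_peMl ?sqr_ge0//.
by rewrite -[leLHS]mulr1 ler_pM// ?lam_ge1// nu_ge1.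
Qed.

Let s20 : 0 < s2. Proof. by rewrite sqrtr_gt0. Qed.
(** The decay weights are (1 + eps n)^(-s) with s <= 8. Their consecutive ratios are at most (1 +
    eps)^8 = r, and [fc_decay] needs (al + be) r < sqrt 2, however close al + be is to sqrt 2. For
    eps <= 1 one has r <= 1 + 255 eps, where 255 = 2^8 - 1, so the divisor 256 leaves strict
    room. *)
Let eps := (s2 - (al + be)) / (256 * s2).
Let eps0 : 0 < eps. Proof. by rewrite divr_gt0 ?subr_gt0// mulr_gt0. Qed.
Let eps1 : eps <= 1.
Proof. by rewrite ler_pdivrMr ?mulr_gt0//; move: s20 al0 be0; lra. Qed.
Let r := (1 + eps) ^+ 8.
Let r1 : 1 <= r. Proof. by rewrite exprn_ege1// lerDl ltW. Qed.

Let rs : (al + be) * r < s2.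
Proof.
have rle : r <= 1 + 255 * eps.
  rewrite /r (_ : 8 = 2 * 2 * 2)%N// !exprM.
  have h1 : (1 + eps) ^+ 2 <= 1 + 3 * eps by move: eps0 eps1; nra.
  have h2 : ((1 + eps) ^+ 2) ^+ 2 <= 1 + 15 * eps.
    apply: (@le_trans _ _ ((1 + 3 * eps) ^+ 2)); last by move: eps0 eps1; nra.
    by rewrite ler_pXn2r// nnegrE ?sqr_ge0//; move: eps0; lra.
  apply: (@le_trans _ _ ((1 + 15 * eps) ^+ 2)); last by move: eps0 eps1; nra.
  by rewrite ler_pXn2r// nnegrE ?sqr_ge0//; move: eps0; lra.
apply: (@le_lt_trans _ _ ((al + be) * (1 + 255 * eps))).
  by rewrite ler_wpM2l// addr_ge0.
have e : 256 * s2 * eps = s2 - (al + be) by rewrite /eps mulrC divfK// gt_eqF// mulr_gt0.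
have h : (al + be) * eps <= s2 * eps by rewrite ler_pM2r// ltW.
have := ab; move: e h; set y := (al + be) * eps; set z := s2 * eps.
have -> : (al + be) * (1 + 255 * eps) = (al + be) + 255 * y by rewrite /y; ring.
have -> : 256 * s2 * eps = 256 * z by rewrite /z; ring.
have : 0 < z by rewrite mulr_gt0.
lra.
Qed.

Let p (s n : nat) : R := ((1 + eps * n%:R) ^+ s)^-1.
Let d0 (n : nat) : 0 < 1 + eps * n%:R.
Proof. by rewrite ltr_pwDl// mulr_ge0// ltW. Qed.
Let p0 s n : 0 <= p s n. Proof. by rewrite invr_ge0 exprn_ge0// ltW. Qed.
Let pd s n : p s n.+1 <= p s n.
Proof.
rewrite lef_pV2 ?posrE ?exprn_gt0// lerXn2r ?nnegrE ?(ltW (d0 _))//.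
by rewrite lerD2l ler_pM2l// ler_nat.
Qed.
Let pr s n : (s <= 8)%N -> p s n <= r * p s n.+1.
Proof.
move=> s8; rewrite ler_pdivlMr ?exprn_gt0// mulrC ler_pdivrMr ?exprn_gt0//.
apply: (@le_trans _ _ (((1 + eps) * (1 + eps * n%:R)) ^+ s)).
  rewrite lerXn2r ?nnegrE ?(ltW (d0 _))//.
    by rewrite mulr_ge0 ?(ltW (d0 _))// addr_ge0// ltW.
  rewrite -natr1; have : 0 <= eps * (eps * n%:R).
    by apply: mulr_ge0; [exact: ltW|apply: mulr_ge0 => //; exact: ltW].
  lra.
rewrite exprMn ler_wpM2r ?exprn_ge0 ?(ltW (d0 _))// /r ler_weXn2l// lerDl.
exact: ltW.
Qed.

Variable Smin : R.
Hypothesis Smin0 : 0 < Smin.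

Let good (C : R) (s : nat) := 0 <= C /\ forall N a S, galerkin_solution N a S -> Smin <= S ->
  forall j k, `|fc (tpoly N a) j k| <= C * p s (j + k)%N.

(** w^(-2) T is T divided twice by w, and each division costs a factor 1 / D. The Galerkin equations
    then divide by S lam with S >= Smin. For n = j + k this gains two orders, since (1 + eps n)^2 <=
    4 n^2 <= 8 (j^2 + k^2); outside the box the coefficient is 0. *)
Let good_step C s : (s <= 6)%N -> good C s -> exists C', good C' s.+2.
Proof.
move=> s6 [C0 H].
have s8 : (s <= 8)%N by apply: leq_trans s6 _.
pose D := s2 - (al + be) * r.
have D0 : 0 < D by rewrite subr_gt0.
exists (8 * (C / D / D / Smin)); split; first by rewrite mulr_ge0// !divr_ge0// ltW.
move=> N a S Sol SS j k.
case: k => [|k]; first by rewrite fc0 normr0 mulr_ge0// mulr_ge0// !divr_ge0// ltW.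
have cT := @cont2_tpoly R N a.
have S0 : 0 < S by apply: lt_le_trans SS.
have w0 u v : w u v != 0 by rewrite gt_eqF.
pose g1 u v := (w u v)^-1 * tpoly N a u v.
have c1 : cont2 g1 by apply: cont2M => //; exact: cont2_winv.
pose g2 u v := conf_weight u v * tpoly N a u v.
have c2 : cont2 g2 by apply: cont2M => //; exact: cont2_conf_weight.
have e1 u v : w u v * g1 u v = tpoly N a u v by rewrite /g1 mulrA divff ?mul1r.
have e2 u v : w u v * g2 u v = g1 u v by rewrite /g2 /conf_weight /g1 expr2 !mulrA divff ?mul1r.
have h1 := fc_decay al0 be0 ab c1 e1 (p0 s) (pd s) (fun n => pr n s8) r1 rs C0 (H N a S Sol SS).
have C1 : 0 <= C / D by rewrite divr_ge0// ltW.
have h2 := fc_decay al0 be0 ab c2 e2 (p0 s) (pd s) (fun n => pr n s8) r1 rs C1 h1.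
have l0 : 1 <= lam (j, k.+1) :> R by exact: lam_ge1.
have l00 : 0 < lam (j, k.+1) :> R by apply: lt_le_trans l0.
have hf : S * lam (j, k.+1) * `|fc (tpoly N a) j k.+1| <= C / D / D * p s (j + k.+1)%N.
  rewrite -[X in X * `|_|](ger0_norm (ltW (mulr_gt0 S0 l00))) -normrM (galerkin_fc Sol).
  by case: ifP => _; [exact: h2|rewrite normr0 mulr_ge0// divr_ge0// ltW].
pose n := (j + k.+1)%N.
have n1 : 1 <= n%:R :> R by rewrite ler1n /n addnS.
have key : p s n <= 8 * lam (j, k.+1) * p s.+2 n.
  rewrite /p; set X := 1 + eps * n%:R.
  have X0 : 0 < X by exact: d0.
  have -> : X ^- s.+2 = X ^- s * X ^- 2 by rewrite -invfM -exprD addn2.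
  have -> : 8 * lam (j, k.+1) * (X ^- s * X ^- 2) = (8 * lam (j, k.+1) / X ^+ 2) * X ^- s by ring.
  rewrite ler_peMl ?invr_ge0 ?exprn_ge0 ?(ltW X0)// ler_pdivlMr ?exprn_gt0// mul1r.
  apply: (@le_trans _ _ ((2 * n%:R) ^+ 2)).
    rewrite lerXn2r ?nnegrE ?(ltW X0) ?mulr_ge0//.
    have : eps * n%:R <= n%:R by rewrite ler_piMl// (le_trans _ n1).
    by move: n1; rewrite /X; lra.
  rewrite /n natrD /lam/=; have := sqr_ge0 (j%:R - k.+1%:R : R).
  by set y := k.+1%:R; set x := j%:R; nra.
rewrite -(ler_pM2l (mulr_gt0 S0 l00)); apply: le_trans hf _.
apply: (@le_trans _ _ (C / D / D * (8 * lam (j, k.+1) * p s.+2 n))).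
  by rewrite ler_wpM2l// divr_ge0// ltW.
have -> : S * lam (j, k.+1) * (8 * (C / D / D / Smin) * p s.+2 (j + k.+1)%N) =
   (S / Smin) * (C / D / D * (8 * lam (j, k.+1) * p s.+2 n)).
  by rewrite /n; field; rewrite !gt_eqF.
rewrite ler_peMl ?ler_pdivlMr ?mul1r//.
apply: mulr_ge0; first by rewrite divr_ge0// ltW.
by rewrite mulr_ge0// mulr_ge0// ltW.
Qed.

Lemma sum_inv_sqr (n : nat) : \sum_(j <- iota 0 n) ((1 + j%:R) ^+ 2)^-1 <= 2 :> R.
Proof.
suff H m : \sum_(j <- iota 0 m.+1) ((1 + j%:R) ^+ 2)^-1 <= 2 - m.+1%:R^-1 :> R.
  case: n => [|n]; first by rewrite big_nil.
  by apply: le_trans (H n) _; rewrite gerBl invr_ge0.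
elim: m => [|m IH]; first by rewrite big_seq1 addr0 expr1n invr1; lra.
rewrite -(addn1 m.+1) iotaD big_cat big_seq1/= add0n addn1.
apply: le_trans (lerD IH (lexx _)) _.
rewrite -lerBrDl; have m0 : 0 < m.+1%:R :> R by [].
rewrite -(natr1 m.+1); move: m0; set y := m.+1%:R => m0.
have -> : 2 - (y + 1)^-1 - (2 - y^-1) = (y * (y + 1))^-1.
  by field; rewrite !gt_eqF// addr_gt0.
rewrite lef_pV2 ?posrE ?exprn_gt0 ?mulr_gt0 ?addr_gt0//; nra.
Qed.

(** (1 + j + k)^2 >= (1 + j) (1 + k), so the double sum is bounded by a product of two single
    ones. *)
Lemma sum_box_inv (N : nat) :
  \sum_(i <- box N) ((1 + i.1%:R + i.2%:R) ^+ 4)^-1 <= 4 :> R.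
Proof.
apply: (@le_trans _ _ (\sum_(i <- box N) ((1 + i.1%:R) ^+ 2)^-1 * ((1 + i.2%:R) ^+ 2)^-1)).
  apply: ler_sum => -[j k] _ /=.
  have j0 : 0 <= j%:R :> R by []. have k0 : 0 <= k%:R :> R by [].
  rewrite -invfM lef_pV2 ?posrE; last first.
  - by rewrite mulr_gt0// exprn_gt0// ltr_pwDl.
  - by rewrite exprn_gt0// !addr_gt0// ?ltr_pwDl// ltr_wpDr.
  rewrite -exprMn (_ : 4 = 2 * 2)%N// exprM lerXn2r ?nnegrE ?sqr_ge0//.
  by move: j0 k0; set x := j%:R; set y := k%:R; nra.
rewrite /box big_allpairs/=.
under eq_bigr do rewrite -mulr_sumr.
rewrite -mulr_suml.
have h : \sum_(k <- iota 1 N) ((1 + k%:R) ^+ 2)^-1 <= 2 :> R.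
  apply: le_trans (sum_inv_sqr N.+1); rewrite -[N.+1]/(1 + N)%N iotaD big_cat/= lerDr.
  by rewrite big_seq1 invr_ge0 sqr_ge0.
have h0 (s : seq nat) : 0 <= \sum_(k <- s) ((1 + k%:R) ^+ 2)^-1 :> R.
  by apply: sumr_ge0 => k _; rewrite invr_ge0 sqr_ge0.
have -> : 4 = 2 * 2 :> R by rewrite -natrM.
by apply: ler_pM => //; exact: sum_inv_sqr.
Qed.

(** Normalised energy gives [|a i| <= 1], which is decay of order 0, and four applications of
    [good_step] reach order 8. Of these, four orders pay for derivatives up to order 4 and four for
    summability over the plane of frequencies. K does not depend on N. *)
Theorem galerkin_regularity : exists K, 0 < K /\ forall N a S,
  galerkin_solution N a S -> Smin <= S ->
  (forall i, i \in box N -> `|a i| <= K / (1 + i.1%:R + i.2%:R) ^+ 8) /\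
  \sum_(i <- box N) (1 + i.1%:R + i.2%:R) ^+ 4 * `|a i| <= K.
Proof.
have g0 : good (2 * pi ^+ 2) 0.
  split; first by rewrite mulr_ge0// sqr_ge0.
  move=> N a S Sol _ j k; rewrite /p expr0 invr1 mulr1 fc_tpoly.
  case: ifPn => jk; last by rewrite normr0 mulr_ge0// sqr_ge0.
  have n0 : 0 <= nu (j, k) :> R by apply: le_trans (nu_ge1 _).
  rewrite normrM ger0_norm// -[leRHS]mulr1 ler_pM ?nu_le//.
  exact: (galerkin_coef_le1 Sol jk).
have [C2 g2] := good_step (isT : (0 <= 6)%N) g0.
have [C4 g4] := good_step (isT : (2 <= 6)%N) g2.
have [C6 g6] := good_step (isT : (4 <= 6)%N) g4.
have [C8 [C80 g8]] := good_step (isT : (6 <= 6)%N) g6.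
pose K := C8 / eps ^+ 8.
have K0 : 0 <= K by rewrite divr_ge0// exprn_ge0// ltW.
have bound N a S : galerkin_solution N a S -> Smin <= S ->
    forall i, i \in box N -> `|a i| <= K / (1 + i.1%:R + i.2%:R) ^+ 8.
  move=> Sol SS [j k] jk /=.
  have := g8 N a S Sol SS j k; rewrite fc_tpoly jk normrM => h.
  have n1 : 1 <= nu (j, k) :> R by exact: nu_ge1.
  apply: (@le_trans _ _ (C8 * p 8 (j + k)%N)).
    by apply: le_trans h; rewrite ler_peMl// (ger0_norm (le_trans ler01 n1)).
  rewrite /K -mulrA ler_wpM2l// -invfM -exprMn lef_pV2 ?posrE ?exprn_gt0//; last first.
    by rewrite mulr_gt0// -addrA -natrD ltr_pwDl.
  rewrite lerXn2r ?nnegrE ?(ltW (d0 _))//.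
    by rewrite mulr_ge0 ?(ltW eps0)// -addrA -natrD addr_ge0.
  by rewrite -addrA -natrD mulrDr mulr1 lerD2r.
exists (4 * K + 1); split; first by rewrite ltr_wpDl// mulr_ge0.
move=> N a S Sol SS; split.
  move=> i ib; apply: le_trans (bound N a S Sol SS i ib) _.
  have x0 : 0 <= 1 + i.1%:R + i.2%:R :> R by rewrite !addr_ge0.
  apply: ler_wpM2r; first by rewrite invr_ge0 exprn_ge0.
  by move: K0; lra.
apply: (@le_trans _ _ (4 * K)); last by rewrite lerDl.
apply: (@le_trans _ _ (K * \sum_(i <- box N) ((1 + i.1%:R + i.2%:R) ^+ 4)^-1)); last first.
  by rewrite mulrC ler_wpM2r// sum_box_inv.
rewrite mulr_sumr big_seq [leRHS]big_seq; apply: ler_sum => i ib.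
have x0 : 0 < 1 + i.1%:R + i.2%:R :> R by rewrite -addrA -natrD ltr_pwDl.
apply: le_trans (ler_wpM2l _ (bound N a S Sol SS i ib)) _; first by rewrite exprn_ge0// ltW.
by apply: eq_ler; field; rewrite gt_eqF.
Qed.

End galerkin.

(** * The test function in the Galerkin spaces *)

Section uniform_convergence.
Context {R : realType}.
Implicit Types (F G : nat -> R -> R -> R) (f g : R -> R -> R).

Definition ucv F f := exists e : nat -> R, e @ \oo --> (0 : R) /\
  forall n u v, circ u -> circ v -> `|F n u v - f u v| <= e n.

Lemma ucv_cst f : ucv (fun _ => f) f.
Proof.
by exists (fun _ => 0); split; [exact: cvg_cst|move=> n u v _ _; rewrite subrr normr0].
Qed.

Lemma ucvD F G f g : ucv F f -> ucv G g ->
  ucv (fun n u v => F n u v + G n u v) (fun u v => f u v + g u v).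
Proof.
move=> [e [e0 He]] [e' [e0' He']]; exists (fun n => e n + e' n); split.
  by rewrite -[X in _ --> X](addr0 0); exact: cvgD.
move=> n u v cu cv; rewrite opprD addrACA; apply: le_trans (ler_normD _ _) _.
by apply: lerD; [exact: He|exact: He'].
Qed.

Lemma ucvM F G f g : cont2 f -> cont2 g -> ucv F f -> ucv G g ->
  ucv (fun n u v => F n u v * G n u v) (fun u v => f u v * g u v).
Proof.
move=> cf cg [e [e0 He]] [e' [e0' He']].
have [M M0 HM] := cont2_bounded cf; have [M' M0' HM'] := cont2_bounded cg.
exists (fun n => e n * (M' + e' n) + M * e' n); split.
  rewrite -[X in _ --> X](_ : 0 * (M' + 0) + M * 0 = 0); last by rewrite mul0r mulr0 addr0.
  apply: cvgD; first by apply: cvgM => //; apply: cvgD => //; exact: cvg_cst.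
  by apply: cvgM => //; exact: cvg_cst.
move=> n u v cu cv.
have -> : F n u v * G n u v - f u v * g u v = (F n u v - f u v) * (g u v + (G n u v - g u v)) + f u v * (G n u v - g u v) by ring.
apply: le_trans (ler_normD _ _) _; rewrite !normrM; apply: lerD; apply: ler_pM => //.
- exact: He.
- apply: le_trans (ler_normD _ _) _; apply: lerD; [exact: (HM' (u, v))|exact: He'].
- exact: (HM (u, v)).
- exact: He'.
Qed.

Lemma ucv_I2 F f : (forall n, cont2 (F n)) -> cont2 f -> ucv F f ->
  I2 (F n) @[n --> \oo] --> I2 f.
Proof.
move=> cF cf [e [e0 He]].
have h n : `|I2 (F n) - I2 f| <= e n * (2 * pi) ^+ 2.
  have -> : I2 (F n) - I2 f = I2 (fun u v => F n u v + -1 * f u v).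
    rewrite I2D//; last by apply: cont2M => //; exact: cont2_cst.
    by rewrite I2Z// mulN1r.
  have cd : cont2 (fun u v => F n u v + -1 * f u v).
    by apply: cont2D => //; apply: cont2M => //; exact: cont2_cst.
  have hh u v : circ u -> circ v -> `|F n u v + -1 * f u v| <= e n.
    by move=> cu cv; rewrite mulN1r; exact: He.
  rewrite ler_norml -mulNr -!I2_cst; apply/andP; split.
    apply: le_I2 => //; first exact: cont2_cst.
    by move=> u v cu cv; have := hh _ _ cu cv; rewrite ler_norml => /andP[].
  apply: le_I2 => //; first exact: cont2_cst.
  by move=> u v cu cv; apply: le_trans (hh _ _ cu cv); exact: ler_norm.
have l0 : e n * (2 * pi) ^+ 2 @[n --> \oo] --> (0 : R).
  by rewrite -[X in _ --> X](mul0r ((2 * pi) ^+ 2)); apply: cvgM => //; exact: cvg_cst.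
apply/cvgrPdist_le => eps eps0.
near=> n.
rewrite distrC (le_trans (h n))// (le_trans (ler_norm _))//.
by near: n; exact: cvgr0_norm_le l0 _ eps0.
Unshelve. all: by end_near. Qed.

Lemma cvg_geo (q : R) : 0 <= q -> q < 1 -> q ^+ n @[n --> \oo] --> (0 : R).
Proof. by move=> q0 q1; apply: cvg_expr; rewrite ger0_norm. Qed.

(** The factor n + 1 comes from differentiating y^(n+1) in the truncated geometric series.
    Bernoulli's inequality for 1 / r, with r halfway between q and 1, absorbs it. *)
Lemma cvg_n_geo (q : R) : 0 <= q -> q < 1 -> n.+1%:R * q ^+ n @[n --> \oo] --> (0 : R).
Proof.
move=> q0 q1.
pose r := (q + 1) / 2.
have r0 : 0 < r by rewrite divr_gt0// ltr_wpDl.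
have r1 : r < 1 by rewrite /r; lra.
have qr : q < r by rewrite /r; lra.
have t1 : q / r < 1 by rewrite ltr_pdivrMr// mul1r.
have t0 : 0 <= q / r by rewrite divr_ge0// ltW.
pose h := r^-1 - 1.
have h0 : 0 < h by rewrite subr_gt0 invf_gt1.
have bern n : n%:R * h <= r^-1 ^+ n.
  have -> : r^-1 = 1 + h by rewrite /h; ring.
  elim: n => [|n IH]; first by rewrite mul0r.
  have : 1 <= (1 + h) ^+ n by rewrite exprn_ege1// lerDl ltW.
  rewrite exprS -natr1; move: IH; set y := (1 + h) ^+ n; set x := n%:R.
  by move: h0; nra.
have bound n : n.+1%:R * q ^+ n <= (h^-1 + 1) * (q / r) ^+ n.
  rewrite exprMn mulrCA mulrC ler_wpM2l ?exprn_ge0// -natr1 mulrDl mul1r lerD//.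
    by rewrite mulrC -ler_pdivrMr ?invr_gt0// invrK.
  by rewrite exprVn invf_ge1 ?exprn_gt0// exprn_ile1// ltW.
apply: (@squeeze_cvgr _ _ _ _ (fun _ => 0) (fun n => (h^-1 + 1) * (q / r) ^+ n)).
- by apply: nearW => n; rewrite bound mulr_ge0// exprn_ge0.
- exact: cvg_cst.
- rewrite -[X in _ --> X](mulr0 (h^-1 + 1)); apply: cvgM; first exact: cvg_cst.
  exact: cvg_geo.
Qed.

End uniform_convergence.

(** * Trigonometric polynomials even in u and odd in v *)

Section trig_span.
Context {R : realType}.
Implicit Types (f g : R -> R -> R) (a : nat * nat -> R) (i : nat * nat) (N : nat).

Definition tpoly_u N a (u v : R) : R :=
  \sum_(i <- box N) a i * (- (i.1%:R) * (sin (i.1%:R * u) * sin (i.2%:R * v))).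
Definition tpoly_v N a (u v : R) : R :=
  \sum_(i <- box N) a i * (i.2%:R * (cos (i.1%:R * u) * cos (i.2%:R * v))).

Lemma der_sum (I : Type) (s : seq I) (F : I -> R -> R) (dF : I -> R) x :
  (forall k, der (F k) x (dF k)) -> der (fun y => \sum_(k <- s) F k y) x (\sum_(k <- s) dF k).
Proof.
move=> h; elim: s => [|k s IH].
  by rewrite big_nil; apply: der_ext (der_cst 0 x) => y; rewrite big_nil.
by rewrite big_cons; apply: der_ext (derD (h k) IH) => y; rewrite big_cons.
Qed.

Lemma der_tpoly_u N a u v : der (fun x => tpoly N a x v) u (tpoly_u N a u v).
Proof.
apply: (@der_sum _ _ (fun i x => a i * ebas i x v)) => i; rewrite /ebas.
by derq; ring.
Qed.

Lemma der_tpoly_v N a u v : der (fun x => tpoly N a u x) v (tpoly_v N a u v).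
Proof.
apply: (@der_sum _ _ (fun i x => a i * ebas i u x)) => i; rewrite /ebas.
by derq; ring.
Qed.

(** Parseval for the two partial derivatives, whose systems sin sin and cos cos are again
    orthogonal: j^2 nu and k^2 nu add up to lam nu. It identifies the energy with the Dirichlet
    integral. *)
Lemma energy_grad N a : energy N a =
  I2 (fun u v => tpoly_u N a u v ^+ 2) + I2 (fun u v => tpoly_v N a u v ^+ 2).
Proof.
rewrite (@I2_sqr_orth _ _ _ _ (fun i => i.1%:R ^+ 2 * nu i) _ (box_uniq N)); last first.
- move=> [j k] [j' k']; rewrite !mem_box/= => H1 H2.
  transitivity (I2 (fun u v : R => (j%:R * j'%:R) * ((sin (j%:R * u) * sin (k%:R * v)) * (sin (j'%:R * u) * sin (k'%:R * v))))).
    by apply: I2_ext => u v; ring.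
  have cc m n : cont2 (fun u v : R => sin (m%:R * u) * sin (n%:R * v)).
    by apply: cont2M; [apply: cont2_fst; exact: cont_sinn|apply: cont2_snd; exact: cont_sinn].
  rewrite I2Z; last exact: cont2M.
  rewrite I2_4; [|exact: cont_sinn..].
  rewrite !I1_sinsin xpair_eqE /nu/=.
  case: (j =P j') => [<-|_] /=; last by rewrite mul0r mulr0.
  case: (k =P k') => [_|_]; last by rewrite !mulr0.
  have -> : (k == 0%N) = false by lia.
  by case: (j =P 0%N) => [->|_]; [rewrite !mul0r expr0n mul0r|rewrite expr2].
- move=> i; apply: cont2M; first exact: cont2_cst.
  by apply: cont2M; [apply: cont2_fst; exact: cont_sinn|apply: cont2_snd; exact: cont_sinn].
rewrite (@I2_sqr_orth _ _ _ _ (fun i => i.2%:R ^+ 2 * nu i) _ (box_uniq N)); last first.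
- move=> [j k] [j' k']; rewrite !mem_box/= => H1 H2.
  transitivity (I2 (fun u v : R => (k%:R * k'%:R) * ((cos (j%:R * u) * cos (k%:R * v)) * (cos (j'%:R * u) * cos (k'%:R * v))))).
    by apply: I2_ext => u v; ring.
  have cc m n : cont2 (fun u v : R => cos (m%:R * u) * cos (n%:R * v)).
    by apply: cont2M; [apply: cont2_fst; exact: cont_cosn|apply: cont2_snd; exact: cont_cosn].
  rewrite I2Z; last exact: cont2M.
  rewrite I2_4; [|exact: cont_cosn..].
  rewrite !I1_coscos xpair_eqE /nu/=.
  case: (j =P j') => [_|_] /=; last by rewrite mul0r mulr0.
  case: (k =P k') => [<-|_]; last by rewrite !mulr0.
  have -> : (k == 0%N) = false by lia.
  by rewrite expr2.
- move=> i; apply: cont2M; first exact: cont2_cst.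
  by apply: cont2M; [apply: cont2_fst; exact: cont_cosn|apply: cont2_snd; exact: cont_cosn].
by rewrite -big_split/=; apply: eq_bigr => i _; rewrite /lam; ring.
Qed.

(** Representability is asked in all large boxes, so that sums find a common box and the test
    function can be used in every later Galerkin space. *)
Definition span f := exists M, forall N, (M <= N)%N -> exists a, forall u v, f u v = tpoly N a u v.

Lemma span_ext f g : (forall u v, f u v = g u v) -> span f -> span g.
Proof. by move=> fg [M H]; exists M => N /H[a Ha]; exists a => u v; rewrite -fg. Qed.

Lemma span0 : span (fun _ _ => 0).
Proof. by exists 0%N => N _; exists (fun _ => 0) => u v; rewrite /tpoly big1// => i _; rewrite mul0r. Qed.

Lemma spanD f g : span f -> span g -> span (fun u v => f u v + g u v).
Proof.
move=> [M H] [M' H']; exists (maxn M M') => N; rewrite geq_max => /andP[/H[a Ha] /H'[a' Ha']].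
exists (fun i => a i + a' i) => u v; rewrite Ha Ha' /tpoly -big_split/=.
by apply: eq_bigr => i _; rewrite mulrDl.
Qed.

Lemma spanZ c f : span f -> span (fun u v => c * f u v).
Proof.
move=> [M H]; exists M => N /H[a Ha]; exists (fun i => c * a i) => u v.
by rewrite Ha /tpoly mulr_sumr; apply: eq_bigr => i _; rewrite mulrA.
Qed.

Lemma span_ebas i : span (ebas i).
Proof.
case: i => j [|k].
  by apply: span_ext span0 => u v; rewrite /ebas/= mul0r sin0 mulr0.
exists (j + k).+1 => N jkN; exists (fun i => if i == (j, k.+1) then 1 else 0) => u v.
rewrite /tpoly (bigD1_seq (j, k.+1))//= ?box_uniq// ?mem_box/= ?eqxx; last by lia.
by rewrite mul1r big1 ?addr0// => i /negbTE ->; rewrite mul0r.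
Qed.

Lemma span_sum (I : Type) (s : seq I) (F : I -> R -> R -> R) : (forall k, span (F k)) ->
  span (fun u v => \sum_(k <- s) F k u v).
Proof.
move=> h; elim: s => [|k s IH].
  by apply: span_ext span0 => u v; rewrite big_nil.
by apply: span_ext (spanD (h k) IH) => u v; rewrite big_cons.
Qed.

Lemma span_tpoly_mul (c : R -> R -> R) : (forall i, span (fun u v => c u v * ebas i u v)) ->
  forall f, span f -> span (fun u v => c u v * f u v).
Proof.
move=> H f [M /(_ M (leqnn M))[a Ha]].
apply: span_ext (span_sum (box M) (fun i => spanZ (a i) (H i))) => u v.
by rewrite Ha /tpoly mulr_sumr; apply: eq_bigr => i _; ring.
Qed.

Lemma span_cosu f : span f -> span (fun u v => cos u * f u v).
Proof.
apply: (@span_tpoly_mul (fun u _ => cos u)) => -[j k].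
apply: span_ext (spanZ 2^-1 (spanD (span_ebas (j.+1, k)) (span_ebas (predr j, k)))) => u v.
by rewrite cosu_ebas.
Qed.

Lemma span_cosv f : span f -> span (fun u v => cos v * f u v).
Proof.
apply: (@span_tpoly_mul (fun _ v => cos v)) => -[j [|k]].
  by apply: span_ext span0 => u v; rewrite /ebas/= mul0r sin0 !mulr0.
apply: span_ext (spanZ 2^-1 (spanD (span_ebas (j, k.+2)) (span_ebas (j, k)))) => u v.
by rewrite cosv_ebas.
Qed.

End trig_span.

(** * Truncations of the test function as competitors *)

Section trial.
Context {R : realType}.
Variables (al be : R).
Local Notation s2 := (Num.sqrt (2 : R)).
Hypotheses (al0 : 0 <= al) (be0 : 0 <= be) (ab : al + be < s2).
Local Notation w := (wfun al be).
Local Notation rho := (conf_weight al be).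

Let y (u v : R) := (al * cos u + be * cos v) / s2.
Let q := (al + be) / s2.
Let s20 : 0 < s2. Proof. by rewrite sqrtr_gt0. Qed.
Let q0 : 0 <= q. Proof. by rewrite divr_ge0 ?addr_ge0// ltW. Qed.
Let q1 : q < 1. Proof. by rewrite ltr_pdivrMr// mul1r. Qed.
Let yq u v : `|y u v| <= q.
Proof.
have si : 0 <= s2^-1 by rewrite invr_ge0 ltW.
rewrite /y /q normrM [`|s2^-1|]ger0_norm//; apply: ler_wpM2r => //.
apply: le_trans (ler_normD _ _) _; rewrite !normrM !(@ger0_norm _ al, @ger0_norm _ be)//.
have hc (x : R) : `|cos x| <= 1 by rewrite ler_norml cos_geN1 cos_le1.
by apply: lerD; rewrite ler_piMr.
Qed.
Let wy u v : w u v = s2 * (1 - y u v).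
Proof. by rewrite /wfun /y; field; rewrite gt_eqF. Qed.
Let wn u v : w u v != 0. Proof. by rewrite gt_eqF// wfun_gt0. Qed.

(* Truncation of the geometric series of sin v / w. *)
Let Z n (u v : R) := sin v * ((1 - y u v ^+ n.+1) / w u v).

Let span_Z n : span (Z n).
Proof.
have H m : span (fun u v => s2^-1 * (y u v ^+ m * sin v)).
  elim: m => [|m IH].
    apply: span_ext (spanZ s2^-1 (span_ebas (0%N, 1%N))) => u v.
    by rewrite /ebas/= mul0r cos0 !mul1r.
  apply: span_ext (spanZ s2^-1 (spanD (spanZ al (span_cosu IH)) (spanZ be (span_cosv IH)))) => u v.
  by rewrite /y exprS; ring.
apply: span_ext (span_sum (iota 0 n.+1) H) => u v.
rewrite -mulr_sumr -mulr_suml /Z.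
have -> : \sum_(i <- iota 0 n.+1) y u v ^+ i = (1 - y u v ^+ n.+1) / (1 - y u v).
  have yn : 1 - y u v != 0 by apply: contra_neq (wn u v) => e; rewrite wy e mulr0.
  rewrite -[1 in X in _ = X / _](expr1n _ n.+1) subrXX.
  rewrite mulrC mulKf//.
  rewrite -[iota 0 n.+1]/(index_iota 0 n.+1) big_mkord.
  by apply: eq_bigr => i _; rewrite expr1n mul1r; congr (_ ^+ _).
have yn : 1 - y u v != 0 by apply: contra_neq (wn u v) => e; rewrite wy e mulr0.
by rewrite wy invfM; ring.
Qed.

(** [yu] and [yv] are the partial derivatives of [y], [zu] and [zv] those of sin v / w, and [Zu n]
    and [Zv n] those of [Z n]. The last two differ from [zu] and [zv] only by terms in y^(n+1) and
    (n + 1) y^n, which tend to 0 uniformly as |y| <= q < 1. *)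
Let yu (u v : R) := - (al * sin u) / s2.
Let yv (u v : R) := - (be * sin v) / s2.
Let zu (u v : R) := - (al * sin u) * sin v * (w u v)^-1 ^+ 2.
Let zv (u v : R) := cos v * (w u v)^-1 - be * sin v ^+ 2 * (w u v)^-1 ^+ 2.
Let Zu n (u v : R) := zu u v * (1 + -1 * y u v ^+ n.+1) + -1 * (sin v * (w u v)^-1 * yu u v) * (n.+1%:R * y u v ^+ n).
Let Zv n (u v : R) := zv u v * (1 + -1 * y u v ^+ n.+1) + -1 * (sin v * (w u v)^-1 * yv u v) * (n.+1%:R * y u v ^+ n).

Let cy : cont2 y.
Proof.
apply: cont2M; last exact: cont2_cst.
by apply: cont2D; apply: cont2M; try exact: cont2_cst; [apply: cont2_fst|apply: cont2_snd]; exact: cont_cos.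
Qed.
Let cw : cont2 (fun u v => (w u v)^-1). Proof. exact: cont2_winv. Qed.
Let csu : cont2 (fun u _ : R => sin u). Proof. by apply: cont2_fst; exact: continuous_sin. Qed.
Let csv : cont2 (fun _ v : R => sin v). Proof. by apply: cont2_snd; exact: continuous_sin. Qed.
Let ccv : cont2 (fun _ v : R => cos v). Proof. by apply: cont2_snd; exact: continuous_cos. Qed.
Let cyu : cont2 yu. Proof. by rewrite /yu; c2. Qed.
Let cyv : cont2 yv. Proof. by rewrite /yv; c2. Qed.
Let czu : cont2 zu. Proof. by rewrite /zu; c2. Qed.
Let czv : cont2 zv. Proof. by rewrite /zv; c2. Qed.
Let cZu n : cont2 (Zu n). Proof. by rewrite /Zu; c2. Qed.
Let cZv n : cont2 (Zv n). Proof. by rewrite /Zv; c2. Qed.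
Let cZ n : cont2 (Z n). Proof. by rewrite /Z; c2. Qed.

Let dZu n u v : der (fun x => Z n x v) u (Zu n u v).
Proof.
rewrite /Z /Zu /zu /yu /y /wfun; have := wn u v; rewrite /wfun => h.
by derq => //; field; rewrite gt_eqF.
Qed.
Let dZv n u v : der (fun x => Z n u x) v (Zv n u v).
Proof.
rewrite /Z /Zv /zv /yv /y /wfun; have := wn u v; rewrite /wfun => h.
by derq => //; field; rewrite gt_eqF.
Qed.

Let uy : ucv (fun n u v => y u v ^+ n.+1) (fun _ _ => 0).
Proof.
exists (fun n => q ^+ n.+1); split; first last.
  by move=> n u v _ _; rewrite subr0 normrX lerXn2r ?nnegrE.
have h : q * q ^+ n @[n --> \oo] --> q * 0 by apply: cvgM; [exact: cvg_cst|exact: cvg_geo].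
by rewrite mulr0 in h; under eq_fun do rewrite exprS.
Qed.
Let uny : ucv (fun n u v => n.+1%:R * y u v ^+ n) (fun _ _ => 0).
Proof.
exists (fun n => n.+1%:R * q ^+ n); split; first exact: cvg_n_geo.
by move=> n u v _ _; rewrite subr0 normrM normrX ger0_norm// ler_wpM2l// lerXn2r ?nnegrE.
Qed.

Let ucv_lim (h k : R -> R -> R) : cont2 h -> cont2 k ->
  ucv (fun n u v => h u v * (1 + -1 * y u v ^+ n.+1) + k u v * (n.+1%:R * y u v ^+ n)) h.
Proof.
move=> ch ck.
have e : (fun u v => h u v * (1 + -1 * 0) + k u v * 0) = h.
  by apply/funext => u; apply/funext => v; rewrite !mulr0 !addr0 mulr1.
rewrite -[X in ucv _ X]e.
apply: ucvD; apply: ucvM => //.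
- exact: cont2_cst.
- exact: ucv_cst.
- apply: ucvD; first exact: ucv_cst.
  by apply: ucvM; [exact: cont2_cst|exact: cont2_cst|exact: ucv_cst|exact: uy].
- exact: cont2_cst.
- exact: ucv_cst.
Qed.

(** A strict inequality for sin v / w persists for a truncation [Z n] with n large. [Z n] lies in
    every Galerkin space from some M on, and there the maximum S is at least its quotient. So [Smin]
    is the quotient [Bn n / En n], independent of N. *)
Lemma trial_function :
  I2 (fun u v => zu u v ^+ 2 + zv u v ^+ 2) * I2 rho <
    (2 * pi) ^+ 2 * I2 (fun u v => sin v ^+ 2 * (w u v)^-1 ^+ 4) ->
  exists M Smin, [/\ I2 rho < (2 * pi) ^+ 2 * Smin, 0 < Smin &
    forall N a S, (M <= N)%N ->
      (forall a', I2 (fun u v => rho u v * tpoly N a' u v ^+ 2) <= S * energy N a') ->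
      galerkin_solution al be N a S -> Smin <= S].
Proof.
move=> EB.
set J := I2 rho; set QQ := (2 * pi) ^+ 2; set Bz := I2 (fun u v => sin v ^+ 2 * (w u v)^-1 ^+ 4).
pose En n := I2 (fun u v => Zu n u v ^+ 2) + I2 (fun u v => Zv n u v ^+ 2).
pose Bn n := I2 (fun u v => rho u v * Z n u v ^+ 2).
have csq (f : R -> R -> R) : cont2 f -> cont2 (fun u v => f u v * f u v) by move=> cf; exact: cont2M.
have sqE (f : R -> R -> R) : I2 (fun u v => f u v ^+ 2) = I2 (fun u v => f u v * f u v).
  by apply: I2_ext => u v; rewrite expr2.
have usq (F : nat -> R -> R -> R) (f : R -> R -> R) : (forall n, cont2 (F n)) -> cont2 f -> ucv F f ->
    I2 (fun u v => F n u v ^+ 2) @[n --> \oo] --> I2 (fun u v => f u v ^+ 2).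
  move=> cF cf Ff; rewrite sqE; under eq_fun do rewrite sqE.
  by apply: ucv_I2; [move=> n; exact: csq|exact: csq|exact: ucvM].
have cE : En n @[n --> \oo] --> I2 (fun u v => zu u v ^+ 2 + zv u v ^+ 2).
  rewrite I2D; [|exact: cont2X|exact: cont2X].
  apply: cvgD; apply: usq => //.
    by apply: ucv_lim => //; c2.
  by apply: ucv_lim => //; c2.
have crho : cont2 rho by exact: cont2_conf_weight.
have cB : Bn n @[n --> \oo] --> Bz.
  have -> : Bz = I2 (fun u v => rho u v * ((sin v * (w u v)^-1) * (sin v * (w u v)^-1))).
    by apply: I2_ext => u v; rewrite /conf_weight; ring.
  have uZ : ucv Z (fun u v => sin v * (w u v)^-1).
    have h := @ucv_lim (fun u v => sin v * (w u v)^-1) (fun _ _ => 0).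
    have [||e [e0 He]] := h; [by c2|exact: cont2_cst|].
    exists e; split => // n u v cu cv; apply: le_trans (He n u v cu cv).
    by apply: eq_ler; congr `|_ - _|; rewrite /Z; ring.
  have c1 : cont2 (fun u v => sin v * (w u v)^-1) by c2.
  have -> : Bn = (fun n => I2 (fun u v => rho u v * (Z n u v * Z n u v))).
    by apply/funext => n; apply: I2_ext => u v; rewrite expr2.
  apply: ucv_I2.
  - by move=> n; apply: cont2M => //; exact: csq.
  - by apply: cont2M => //; exact: csq.
  - by apply: ucvM => //; [exact: csq|exact: ucv_cst|exact: ucvM].
have cEB : En n * J - QQ * Bn n @[n --> \oo] --> I2 (fun u v => zu u v ^+ 2 + zv u v ^+ 2) * J - QQ * Bz.
  by apply: cvgB; apply: cvgM => //; exact: cvg_cst.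
have lim0 : I2 (fun u v => zu u v ^+ 2 + zv u v ^+ 2) * J - QQ * Bz < 0 by rewrite subr_lt0.
have [n _ /(_ n (leqnn n)) hn] := cvgr_lt _ cEB _ lim0.
rewrite /= subr_lt0 in hn.
have J0 : 0 <= J.
  have -> : 0 = I2 (fun _ _ : R => 0 : R) by rewrite I2_cst mul0r.
  by apply: le_I2 => //; [exact: cont2_cst|move=> u v _ _; rewrite sqr_ge0].
have Q0 : 0 < QQ by rewrite exprn_gt0// two_pi_gt0.
have Ege (f : R -> R -> R) : cont2 f -> 0 <= I2 (fun u v => f u v ^+ 2).
  move=> cf; have -> : 0 = I2 (fun _ _ : R => 0 : R) by rewrite I2_cst mul0r.
  by apply: le_I2 => //; [exact: cont2_cst|exact: cont2X|move=> u v _ _; rewrite sqr_ge0].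
have En0 : 0 <= En n by rewrite addr_ge0// Ege.
have Bn0 : 0 < Bn n.
  by rewrite -(pmulr_rgt0 _ Q0); apply: le_lt_trans hn; rewrite mulr_ge0.
have [M HM] := span_Z n.
have BE N S : (M <= N)%N ->
    (forall a', I2 (fun u v => rho u v * tpoly N a' u v ^+ 2) <= S * energy N a') ->
    Bn n <= S * En n.
  move=> MN HS; have [a Ha] := HM N MN; have := HS a.
  have -> : I2 (fun u v => rho u v * tpoly N a u v ^+ 2) = Bn n.
    by apply: I2_ext => u v; rewrite Ha.
  rewrite energy_grad.
  have -> : I2 (fun u v => tpoly_u N a u v ^+ 2) = I2 (fun u v => Zu n u v ^+ 2).
    apply: I2_ext => u v; congr (_ ^+ 2).
    apply: der_unique (der_tpoly_u N a u v) _.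
    by apply: der_ext (dZu n u v) => x; rewrite Ha.
  have -> // : I2 (fun u v => tpoly_v N a u v ^+ 2) = I2 (fun u v => Zv n u v ^+ 2).
  apply: I2_ext => u v; congr (_ ^+ 2).
  apply: der_unique (der_tpoly_v N a u v) _.
  by apply: der_ext (dZv n u v) => x; rewrite Ha.
(* A Galerkin solution serves here only to supply some S with [Bn n <= S * En n]; zero energy would
   then contradict [Bn0]. *)
have Enp : 0 < En n.
  rewrite lt_neqAle En0 andbT eq_sym; apply/negP => /eqP e0.
  have [a [S [_ _ HS]]] := galerkin_exists al0 be0 ab (ltn0Sn M).
  by have := BE _ _ (leqnSn M) HS; rewrite e0 mulr0 leNgt Bn0.
exists M, (Bn n / En n); split.
- by rewrite mulrA (ltr_pdivlMr _ _ Enp) mulrC; exact: hn.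
- by rewrite divr_gt0.
- by move=> N a S MN HS _; rewrite ler_pdivrMr//; exact: BE MN HS.
Qed.

End trial.

(** * Passage to the limit *)

Section trig_taylor.
Context {R : realType}.
Implicit Types (x y s t : R).

Lemma lip_cos x y : `|cos y - cos x| <= `|y - x|.
Proof.
wlog xy : x y / x <= y => [H|].
  by case: (leP x y) => [/H//|/ltW/H]; rewrite distrC (distrC x).
have [|c _ ->] := @MVT_segment R cos (fun z => - sin z) x y xy.
- by apply: continuous_subspaceT; exact: continuous_cos.
- by rewrite normrM normrN ler_piMl// ler_norml sin_geN1 sin_le1.
Qed.

Lemma lip_sin x y : `|sin y - sin x| <= `|y - x|.
Proof.
wlog xy : x y / x <= y => [H|].
  by case: (leP x y) => [/H//|/ltW/H]; rewrite distrC (distrC x).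
have [|c _ ->] := @MVT_segment R sin cos x y xy.
- by apply: continuous_subspaceT; exact: continuous_sin.
- by rewrite normrM ler_piMl// ler_norml cos_geN1 cos_le1.
Qed.

Lemma taylor_cos y s : `|cos (y + s) - cos y + s * sin y| <= s ^+ 2.
Proof.
have key (a b c : R) : a <= b -> c = a \/ c = b -> `|cos b - cos a + (b - a) * sin c| <= (b - a) ^+ 2.
  move=> leab cab.
  have [|z zab ->] := @MVT_segment R cos (fun z => - sin z) a b leab.
  - by apply: continuous_subspaceT; exact: continuous_cos.
  have -> : - sin z * (b - a) + (b - a) * sin c = (sin c - sin z) * (b - a) by ring.
  rewrite normrM expr2 (@ger0_norm _ (b - a)) ?subr_ge0// ler_wpM2r ?subr_ge0//.
  apply: le_trans (lip_sin z c) _; move: zab; rewrite in_itv/= => /andP[az zb].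
  by case: cab => ->; rewrite ler_norml; apply/andP; split; lra.
case: (leP 0 s) => s0.
  have e1 : y + s - y = s by ring.
  by have := key y (y + s) y; rewrite e1; apply; [rewrite lerDl|left].
have e2 : y - (y + s) = - s by ring.
have := key (y + s) y y; rewrite e2 sqrrN -normrN => H.
have -> : cos (y + s) - cos y + s * sin y = - (cos y - cos (y + s) + - s * sin y) by ring.
by apply: H; [lra|right].
Qed.

(* p-th derivative of cos (n x + ph) *)
Definition tder (n p : nat) (ph x : R) : R := n%:R ^+ p * cos (n%:R * x + p%:R * (pi / 2) + ph).

Lemma tder_bound n p ph x : `|tder n p ph x| <= n%:R ^+ p.
Proof.
rewrite /tder normrM ger0_norm ?exprn_ge0// ler_piMr ?exprn_ge0//.
by rewrite ler_norml cos_geN1 cos_le1.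
Qed.

Lemma tder_lip n p ph x y : `|tder n p ph y - tder n p ph x| <= n%:R ^+ p.+1 * `|y - x|.
Proof.
rewrite /tder -mulrBr normrM ger0_norm ?exprn_ge0// exprSr -mulrA ler_wpM2l ?exprn_ge0//.
apply: le_trans (lip_cos _ _) _; rewrite -[X in X * `|_|](@ger0_norm _ n%:R)// -normrM.
by apply: eq_ler; congr `|_|; ring.
Qed.

Lemma tder_taylor n p ph x t :
  `|tder n p ph (x + t) - tder n p ph x - t * tder n p.+1 ph x| <= n%:R ^+ p.+2 * t ^+ 2.
Proof.
rewrite /tder; set y := n%:R * x + p%:R * (pi / 2) + ph.
have -> : n%:R * (x + t) + p%:R * (pi / 2) + ph = y + n%:R * t by rewrite /y; ring.
have -> : n%:R * x + p.+1%:R * (pi / 2) + ph = y + pi / 2 by rewrite /y -natr1; ring.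
have -> : cos (y + pi / 2) = - sin y by rewrite cosD cos_pihalf sin_pihalf; ring.
have -> : n%:R ^+ p * cos (y + n%:R * t) - n%:R ^+ p * cos y - t * (n%:R ^+ p.+1 * - sin y) =
  n%:R ^+ p * (cos (y + n%:R * t) - cos y + (n%:R * t) * sin y) by rewrite exprSr; ring.
have -> : n%:R ^+ p.+2 = n%:R ^+ p * n%:R ^+ 2 :> R by rewrite -exprD addn2.
rewrite normrM (@ger0_norm _ (n%:R ^+ p)) ?exprn_ge0// -[leRHS]mulrA.
apply: ler_wpM2l; first exact: exprn_ge0.
by apply: le_trans (taylor_cos _ _) _; rewrite exprMn.
Qed.

Lemma tder0 n x : tder n 0 0 x = cos (n%:R * x).
Proof. by rewrite /tder expr0 mul1r mul0r !addr0. Qed.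

Lemma tder0s n x : tder n 0 (- (pi / 2)) x = sin (n%:R * x).
Proof. by rewrite /tder expr0 mul1r mul0r addr0 cosB cos_pihalf sin_pihalf; ring. Qed.

Lemma tder2 n ph x : tder n 2 ph x = - n%:R ^+ 2 * tder n 0 ph x.
Proof.
rewrite /tder expr0 mul1r mul0r addr0.
have -> : n%:R * x + 2 * (pi / 2) + ph = n%:R * x + ph + pi by field.
by rewrite cosDpi; ring.
Qed.

(** A pointwise limit does not commute with derivatives, but a Taylor estimate with a fixed constant
    K is an inequality and passes to ultrafilter limits. This criterion then recovers the derivative
    of the limit. *)
Lemma der_taylor (f : R -> R) x (l K : R) :
  (forall t, `|f (x + t) - f x - t * l| <= K * t ^+ 2) -> der f x l.
Proof.
move=> H.
have K0 : 0 <= K by have := H 1; rewrite expr1n mulr1; apply: le_trans.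
suff C : h^-1 *: ((f \o shift x) (h *: (1 : R)) - f x) @[h --> 0^'] --> l.
  by split; [apply/cvg_ex; exists l|apply/cvg_lim].
apply/cvgrPdist_le => e e0; near=> h.
have h0 : h != 0 by near: h; exact: nbhs_dnbhs_neq.
have -> : h^-1 *: ((f \o shift x) (h *: (1 : R)) - f x) = (f (x + h) - f x) / h.
  by rewrite /GRing.scale/= /GRing.scale/= mulr1 (addrC h) mulrC.
rewrite -(@ler_pM2r _ `|h|) ?normr_gt0// -normrM mulrBl divfK// distrC.
have -> : f (x + h) - f x - l * h = f (x + h) - f x - h * l by ring.
apply: le_trans (H h) _; rewrite -(real_normK (num_real h)) expr2 mulrA.
rewrite ler_wpM2r//.
have : `|h| <= e / (K + 1).
  by near: h; apply: dnbhs0_le; rewrite divr_gt0// ltr_wpDl.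
rewrite ler_pdivlMr ?ltr_wpDl//; have := normr_ge0 h; nra.
Unshelve. all: by end_near. Qed.

(** Explicit bounds and Lipschitz constants, valid on the whole plane, are kept instead of
    continuity because they are preserved by pointwise limits. *)
Definition blip (f : R -> R -> R) (B L : R) :=
  (forall u v, `|f u v| <= B) /\
  forall u v u' v', `|f u' v' - f u v| <= L * (`|u' - u| + `|v' - v|).

Lemma blip_ge0 f B L : blip f B L -> 0 <= B /\ 0 <= L.
Proof.
move=> [h1 h2]; split; first by apply: le_trans (h1 0 0).
by have := h2 0 0 1 0; rewrite !subr0 normr1 normr0 addr0 mulr1; apply: le_trans.
Qed.

Lemma blipD f g B L B' L' : blip f B L -> blip g B' L' ->
  blip (fun u v => f u v + g u v) (B + B') (L + L').
Proof.
move=> [h1 h2] [k1 k2]; split => [u v|u v u' v'].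
  by apply: le_trans (ler_normD _ _) _; exact: lerD.
by rewrite opprD addrACA mulrDl; apply: le_trans (ler_normD _ _) _; exact: lerD.
Qed.

Lemma blipM f g B L B' L' : blip f B L -> blip g B' L' ->
  blip (fun u v => f u v * g u v) (B * B') (L * B' + B * L').
Proof.
move=> bf bg; have [B0 L0] := blip_ge0 bf; have [B0' L0'] := blip_ge0 bg.
case: bf => [h1 h2]; case: bg => [k1 k2]; split => [u v|u v u' v'].
  by rewrite normrM ler_pM.
have -> : f u' v' * g u' v' - f u v * g u v =
  (f u' v' - f u v) * g u' v' + f u v * (g u' v' - g u v) by ring.
rewrite [leRHS]mulrDl; apply: le_trans (ler_normD _ _) _; rewrite !normrM; apply: lerD.
  by rewrite mulrAC ler_pM.
by rewrite -mulrA ler_pM.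
Qed.

Lemma blip_cst c : blip (fun _ _ => c) `|c| 0.
Proof. by split => // *; rewrite subrr normr0 mul0r. Qed.

Lemma blipW f B L B' L' : B <= B' -> L <= L' -> blip f B L -> blip f B' L'.
Proof.
move=> BB LL [h1 h2]; split => [u v|u v u' v']; first exact: le_trans (h1 _ _) BB.
by apply: le_trans (h2 _ _ _ _) _; rewrite ler_wpM2r// addr_ge0.
Qed.

Lemma blip_cont2 f B L : blip f B L -> cont2 f.
Proof.
move=> bf; have [_ L0] := blip_ge0 bf; case: bf => _ h2 [u v].
apply/cvgrPdist_le => e e0 /=.
have d0 : 0 < e / (2 * (L + 1)) by rewrite divr_gt0// mulr_gt0// ltr_wpDl.
near=> z.
rewrite distrC; apply: le_trans (h2 u v z.1 z.2) _.
have /andP[z1 z2] : (`|z.1 - u| <= e / (2 * (L + 1))) && (`|z.2 - v| <= e / (2 * (L + 1))).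
  near: z; exists (ball u (e / (2 * (L + 1))), ball v (e / (2 * (L + 1)))).
    by split; exact: nbhsx_ballx.
  move=> [u' v'] [/=]; rewrite /ball/= distrC => /ltW ->.
  by rewrite distrC => /ltW ->.
apply: (@le_trans _ _ (L * (e / (2 * (L + 1)) + e / (2 * (L + 1))))).
  by rewrite ler_wpM2l// lerD.
have -> : L * (e / (2 * (L + 1)) + e / (2 * (L + 1))) = e * (L / (L + 1)).
  by field; rewrite gt_eqF// ltr_wpDl.
by rewrite ler_piMr ?(ltW e0)// ler_pdivrMr ?ltr_wpDl// mul1r lerDl.
Unshelve. all: by end_near. Qed.

(** By the Chebyshev recurrence, cos (n x) is a polynomial in cos x. Galerkin solutions thus depend
    only on cos u, cos v and sin v, which is how their limit descends to the torus. *)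
Lemma cos_eq_mul (x y : R) n : cos x = cos y -> cos (n%:R * x) = cos (n%:R * y).
Proof.
move=> e; suff : cos (n%:R * x) = cos (n%:R * y) /\ cos (n.+1%:R * x) = cos (n.+1%:R * y) by case.
have rec m (z : R) : cos (m.+2%:R * z) = 2 * cos z * cos (m.+1%:R * z) - cos (m%:R * z).
  have -> : m.+2%:R * z = m.+1%:R * z + z by rewrite -(natr1 m.+1); ring.
  have -> : m%:R * z = m.+1%:R * z - z by rewrite -(natr1 m); ring.
  by rewrite cosD cosB; ring.
elim: n => [|n [h1 h2]]; first by rewrite !mul0r !mul1r.
by split => //; rewrite !rec h1 h2 e.
Qed.

Lemma cos_sin_eq_mul (x y : R) n : cos x = cos y -> sin x = sin y ->
  sin (n%:R * x) = sin (n%:R * y).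
Proof.
move=> ec es; elim: n => [|n IH]; first by rewrite !mul0r.
by rewrite -natr1 !mulrDl !mul1r !sinD IH ec es (cos_eq_mul n ec).
Qed.

Lemma circle_rep (x : R) : exists x', [/\ circ x', cos x' = cos x & sin x' = sin x].
Proof.
have cx : -1 <= cos x <= 1 by rewrite cos_geN1 cos_le1.
have [a0 api] : 0 <= acos (cos x) /\ acos (cos x) <= pi by split; [exact: acos_ge0|exact: acos_lepi].
have ca : cos (acos (cos x)) = cos x by rewrite acosK.
have sa : sin (acos (cos x)) = `|sin x| by rewrite sin_acos// -sin2cos2 sqrtr_sqr.
case: (leP 0 (sin x)) => sx.
  exists (acos (cos x)); split => //; last by rewrite sa ger0_norm.
  by rewrite /circ/= in_itv/= a0/=; lra.
exists (2 * pi - acos (cos x)); split.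
- by rewrite /circ/= in_itv/=; apply/andP; split; lra.
- by rewrite cosB (mulrC 2) mulr_natr cos2pi sin2pi ca; ring.
- by rewrite sinB (mulrC 2) mulr_natr cos2pi sin2pi sa ltr0_norm//; ring.
Qed.

End trig_taylor.

(** * Estimates for partial derivatives, uniform in the dimension *)

Section partial_derivatives.
Context {R : realType}.
Implicit Types (a : nat * nat -> R) (i : nat * nat) (N p q : nat) (u v t K : R).

Definition tpd p q N a (u v : R) : R :=
  \sum_(i <- box N) a i * (tder i.1 p 0 u * tder i.2 q (- (pi / 2)) v).

(** Each derivative costs one power of the frequency. With weight 4, derivatives of order at most 4
    are bounded by K, those of order at most 3 are K-Lipschitz, and those of order at most 2 have
    first-order Taylor remainder at most K t^2. *)
Definition coef_bound N a K := \sum_(i <- box N) (1 + i.1%:R + i.2%:R) ^+ 4 * `|a i| <= K.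

Let wt i : R := (1 + i.1%:R + i.2%:R) ^+ 4.

Let wt_le i p q : (p + q <= 4)%N -> i.1%:R ^+ p * i.2%:R ^+ q <= wt i.
Proof.
move=> pq.
have x0 : 0 <= i.1%:R :> R by []. have y0 : 0 <= i.2%:R :> R by [].
have s1 : 1 <= 1 + i.1%:R + i.2%:R :> R by rewrite -addrA lerDl addr_ge0.
apply: (@le_trans _ _ ((1 + i.1%:R + i.2%:R) ^+ (p + q))); last exact: ler_weXn2l.
rewrite exprD ler_pM ?exprn_ge0// lerXn2r ?nnegrE//; move: x0 y0; lra.
Qed.

Let sum_wt N a K (X : nat * nat -> R) c : coef_bound N a K -> 0 <= c ->
  (forall i, `|X i| <= wt i * c) -> `|\sum_(i <- box N) a i * X i| <= K * c.
Proof.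
move=> HK c0 HX; apply: le_trans (ler_norm_sum _ _ _) _.
apply: le_trans (ler_wpM2r c0 HK); rewrite mulr_suml; apply: ler_sum => i _.
by rewrite normrM mulrC -/(wt i) mulrAC ler_wpM2r.
Qed.

Lemma coef_bound_ge0 N a K : coef_bound N a K -> 0 <= K.
Proof. by apply: le_trans; apply: sumr_ge0 => i _; rewrite mulr_ge0// exprn_ge0// !addr_ge0. Qed.

Lemma tpd_bound p q N a K u v : coef_bound N a K -> (p + q <= 4)%N -> `|tpd p q N a u v| <= K.
Proof.
move=> HK pq; rewrite -[K]mulr1; apply: sum_wt => // i.
rewrite mulr1 normrM; apply: le_trans (wt_le i pq).
by apply: ler_pM => //; exact: tder_bound.
Qed.

Lemma tpd_lip p q N a K : coef_bound N a K -> (p + q <= 3)%N ->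
  blip (tpd p q N a) K K.
Proof.
move=> HK pq; split => [u v|u v u' v'].
  by apply: tpd_bound => //; apply: leq_trans pq _.
rewrite /tpd -sumrB; under eq_bigr do rewrite -mulrBr.
apply: sum_wt => // i.
have -> : tder i.1 p 0 u' * tder i.2 q (- (pi / 2)) v' - tder i.1 p 0 u * tder i.2 q (- (pi / 2)) v =
  (tder i.1 p 0 u' - tder i.1 p 0 u) * tder i.2 q (- (pi / 2)) v' +
  tder i.1 p 0 u * (tder i.2 q (- (pi / 2)) v' - tder i.2 q (- (pi / 2)) v) by ring.
apply: le_trans (ler_normD _ _) _; rewrite [X in X + _]normrM [X in _ + X]normrM [leRHS]mulrDr; apply: lerD.
  apply: (@le_trans _ _ ((i.1%:R ^+ p.+1 * `|u' - u|) * i.2%:R ^+ q)).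
    by apply: ler_pM => //; [exact: tder_lip|exact: tder_bound].
  by rewrite mulrAC ler_wpM2r// wt_le//; lia.
apply: (@le_trans _ _ (i.1%:R ^+ p * (i.2%:R ^+ q.+1 * `|v' - v|))).
  by apply: ler_pM => //; [exact: tder_bound|exact: tder_lip].
by rewrite mulrA ler_wpM2r// wt_le//; lia.
Qed.

Lemma tpd_taylor_u p q N a K u v t : coef_bound N a K -> (p + q <= 2)%N ->
  `|tpd p q N a (u + t) v - tpd p q N a u v - t * tpd p.+1 q N a u v| <= K * t ^+ 2.
Proof.
move=> HK pq; rewrite /tpd -sumrB mulr_sumr -sumrB.
rewrite (eq_bigr (fun i => a i * (tder i.1 p 0 (u + t) * tder i.2 q (- (pi / 2)) v -
  tder i.1 p 0 u * tder i.2 q (- (pi / 2)) v -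
  t * (tder i.1 p.+1 0 u * tder i.2 q (- (pi / 2)) v)))); last by move=> i _; ring.
apply: sum_wt => // [|i]; first exact: sqr_ge0.
have -> : tder i.1 p 0 (u + t) * tder i.2 q (- (pi / 2)) v - tder i.1 p 0 u * tder i.2 q (- (pi / 2)) v -
   t * (tder i.1 p.+1 0 u * tder i.2 q (- (pi / 2)) v) =
   (tder i.1 p 0 (u + t) - tder i.1 p 0 u - t * tder i.1 p.+1 0 u) * tder i.2 q (- (pi / 2)) v by ring.
rewrite normrM; apply: (@le_trans _ _ ((i.1%:R ^+ p.+2 * t ^+ 2) * i.2%:R ^+ q)).
  by apply: ler_pM => //; [exact: tder_taylor|exact: tder_bound].
by rewrite mulrAC ler_wpM2r ?sqr_ge0// wt_le//; lia.
Qed.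

Lemma tpd_taylor_v p q N a K u v t : coef_bound N a K -> (p + q <= 2)%N ->
  `|tpd p q N a u (v + t) - tpd p q N a u v - t * tpd p q.+1 N a u v| <= K * t ^+ 2.
Proof.
move=> HK pq; rewrite /tpd -sumrB mulr_sumr -sumrB.
rewrite (eq_bigr (fun i => a i * (tder i.1 p 0 u * tder i.2 q (- (pi / 2)) (v + t) -
  tder i.1 p 0 u * tder i.2 q (- (pi / 2)) v -
  t * (tder i.1 p 0 u * tder i.2 q.+1 (- (pi / 2)) v)))); last by move=> i _; ring.
apply: sum_wt => // [|i]; first exact: sqr_ge0.
have -> : tder i.1 p 0 u * tder i.2 q (- (pi / 2)) (v + t) - tder i.1 p 0 u * tder i.2 q (- (pi / 2)) v -
   t * (tder i.1 p 0 u * tder i.2 q.+1 (- (pi / 2)) v) =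
   tder i.1 p 0 u * (tder i.2 q (- (pi / 2)) (v + t) - tder i.2 q (- (pi / 2)) v - t * tder i.2 q.+1 (- (pi / 2)) v) by ring.
rewrite normrM; apply: (@le_trans _ _ (i.1%:R ^+ p * (i.2%:R ^+ q.+2 * t ^+ 2))).
  by apply: ler_pM => //; [exact: tder_bound|exact: tder_taylor].
by rewrite mulrA ler_wpM2r ?sqr_ge0// wt_le//; lia.
Qed.

Lemma tpd00 N a u v : tpd 0 0 N a u v = tpoly N a u v.
Proof. by apply: eq_bigr => i _; rewrite tder0 tder0s. Qed.

Lemma tpd_lap N a u v :
  tpd 2 0 N a u v + tpd 0 2 N a u v = - tpoly N (fun i => lam i * a i) u v.
Proof.
rewrite /tpd /tpoly -big_split/= -sumrN; apply: eq_bigr => i _.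
by rewrite !tder2 tder0 tder0s /lam /ebas; ring.
Qed.

End partial_derivatives.

(** A frequency within two layers of the upper edges of the box, or beyond them, is larger than n;
    it makes the contribution of the edge to the residual small. *)
Lemma box_edge (N n j k : nat) : (n.+2 <= N)%N -> ~~ ((j.+2 < N) && (k.+3 < N))%N ->
  (n < 1 + j + k.+1)%N.
Proof. by rewrite negb_and -!leqNgt; lia. Qed.

(** * The limit of the Galerkin solutions and its equation *)

Section limit.
Context {R : realType}.
Variables (al be : R).
Local Notation s2 := (Num.sqrt (2 : R)).
Hypotheses (al0 : 0 <= al) (be0 : 0 <= be) (ab : al + be < s2).
Local Notation w := (wfun al be).
Local Notation rho := (conf_weight al be).
Variables (N_ : nat -> nat) (a_ : nat -> nat * nat -> R) (S_ : nat -> R) (Smin K : R).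
Hypotheses (N_ge : forall n, (n.+2 <= N_ n)%N)
  (sol : forall n, galerkin_solution al be (N_ n) (a_ n) (S_ n))
  (S_E : forall n, S_ n = I2 (fun u v => rho u v * tpoly (N_ n) (a_ n) u v ^+ 2))
  (Smin0 : 0 < Smin) (S_ge : forall n, Smin <= S_ n)
  (HK : forall n, coef_bound (N_ n) (a_ n) K).

Let K0 : 0 <= K. Proof. exact: coef_bound_ge0 (HK 0). Qed.
Local Notation T n := (tpoly (N_ n) (a_ n)).
Local Notation L n := (tpoly (N_ n) (fun i => lam i * a_ n i)).
Let crho : cont2 rho. Proof. exact: cont2_conf_weight. Qed.
Let cw : cont2 w. Proof. exact: cont2_wfun. Qed.
Let wgt0 u v : 0 < w u v. Proof. exact: wfun_gt0. Qed.
Let wn u v : w u v != 0. Proof. by rewrite gt_eqF. Qed.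

Let T_bound n u v : `|T n u v| <= K.
Proof. by rewrite -tpd00; exact: tpd_bound. Qed.

Let blip_w : blip w (s2 + al + be) (al + be).
Proof.
have s20 : 0 <= s2 by rewrite sqrtr_ge0.
have hc (x : R) : `|cos x| <= 1 by rewrite ler_norml cos_geN1 cos_le1.
split => [u v|u v u' v'].
  rewrite /wfun; apply: le_trans (ler_normB _ _) _; apply: lerD.
    apply: le_trans (ler_normB _ _) _; rewrite ger0_norm// lerD2l normrM ger0_norm//.
    by rewrite ler_piMr.
  by rewrite normrM ger0_norm// ler_piMr.
have -> : w u' v' - w u v = - (al * (cos u' - cos u) + be * (cos v' - cos v)) by rewrite /wfun; ring.
rewrite normrN [leRHS]mulrDr; apply: le_trans (ler_normD _ _) _.
rewrite (normrM al) (normrM be) (ger0_norm al0) (ger0_norm be0); apply: lerD.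
  by apply: ler_pM => //; [rewrite lerDl|exact: lip_cos].
by apply: ler_pM => //; [rewrite lerDr|exact: lip_cos].
Qed.

Let Wm := s2 + al + be.
Let Wm0 : 0 < Wm.
Proof. by rewrite /Wm -addrA ltr_pwDl ?sqrtr_gt0// addr_ge0. Qed.

Let S_bound : exists SB, forall n, `|S_ n| <= SB.
Proof.
exists (K ^+ 2 * I2 rho) => n.
rewrite ger0_norm; last by apply: le_trans (S_ge n); exact: ltW.
rewrite S_E -I2Z//; apply: le_I2.
- by apply: cont2M => //; apply: cont2X; exact: cont2_tpoly.
- by apply: cont2M => //; exact: cont2_cst.
- move=> u v _ _; rewrite mulrC ler_wpM2r ?sqr_ge0//.
  by rewrite -(real_normK (num_real _)) lerXn2r ?nnegrE.
Qed.

(* g n = w^2 (S (-Laplacian) - rho) applied to the n-th Galerkin solution *)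
Let g n u v := w u v ^+ 2 * (S_ n * L n u v) + -1 * T n u v.
Let d n u v := S_ n * L n u v + -1 * (rho u v * T n u v).

Let gd n u v : g n u v = w u v ^+ 2 * d n u v.
Proof. by rewrite /g /d /conf_weight; field. Qed.

Let cT n : cont2 (T n). Proof. exact: cont2_tpoly. Qed.
Let cL n : cont2 (L n). Proof. exact: cont2_tpoly. Qed.
Let cd n : cont2 (d n). Proof. by have h1 := @cT n; have h2 := @cL n; rewrite /d; c2. Qed.
Let cg n : cont2 (g n). Proof. by have h1 := @cT n; have h2 := @cL n; rewrite /g; c2. Qed.

Let fc_d n j k : (j, k) \in box (N_ n) -> fc (d n) j k = 0.
Proof.
move=> jk; rewrite /d fcD ?fcZ//; try by [apply: cont2M => //; exact: cont2_cst|exact: cont2M|c2].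
- rewrite fc_tpoly jk -((sol n).2 _ jk)/=; ring.
Qed.

(** g = w^2 d, and multiplication by w couples only neighbouring frequencies. So the Galerkin
    equations, which kill the coefficients of d in the box, kill those of g two layers away from the
    upper edges. At the lower edges the reflection [predr] and [fc0] close the stencil. *)
Let fc_g n j k : (j.+2 < N_ n)%N -> (k.+3 < N_ n)%N -> fc (g n) j k.+1 = 0.
Proof.
move=> jN kN.
have dz j' k' : (j' < N_ n)%N -> (k' < N_ n)%N -> fc (d n) j' k' = 0.
  by case: k' => [|k'] h1 h2; [exact: fc0|apply: fc_d; rewrite mem_box/=; lia].
have wd j' k' : (j'.+1 < N_ n)%N -> (k'.+1 < N_ n)%N -> fc (fun u v => w u v * d n u v) j' k' = 0.
  case: k' => [|k'] h1 h2; first exact: fc0.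
  rewrite fc_wfun// !dz ?mulr0 ?addr0 ?mulr0 ?subr0//; try lia.
  by case: (j') h1 => [|?] /=; lia.
have -> : fc (g n) j k.+1 = fc (fun u v => w u v * (w u v * d n u v)) j k.+1.
  by apply: I2_ext => u v; rewrite gd; ring.
rewrite fc_wfun; last exact: cont2M.
rewrite !wd ?mulr0 ?addr0 ?mulr0 ?subr0//; try lia.
by case: (j) jN => [|?] /=; lia.
Qed.

Let blip_g : exists B Lg, forall n, blip (g n) B Lg.
Proof.
have [SB HSB] := S_bound.
have SB0 : 0 <= SB by apply: le_trans (HSB 0).
have bT n : blip (T n) K K.
  have h := @tpd_lip R 0 0 _ _ K (HK n) isT.
  split => [u v|u v u' v']; first exact: T_bound.
  by rewrite -!tpd00; exact: h.2.
have bL n : blip (L n) (K + K) (K + K).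
  have h := blipM (blip_cst (-1)) (blipD (@tpd_lip R 2 0 _ _ K (HK n) isT) (@tpd_lip R 0 2 _ _ K (HK n) isT)).
  rewrite normrN1 !mul1r mul0r add0r in h.
  split => [u v|u v u' v'].
    by have := h.1 u v; rewrite tpd_lap mulN1r opprK.
  by have := h.2 u v u' v'; rewrite !tpd_lap !mulN1r !opprK.
have bS n : blip (fun _ _ : R => S_ n) SB 0 by apply: blipW (blip_cst (S_ n)).
have bw2 : blip (fun u v => w u v ^+ 2) (Wm * Wm) ((al + be) * Wm + Wm * (al + be)).
  have := blipM blip_w blip_w; rewrite -/Wm => -[h1 h2].
  by split => [u v|u v u' v']; rewrite !expr2.
eexists; eexists => n.
exact: blipD (blipM bw2 (blipM (bS n) (bL n))) (blipM (blip_cst (-1)) (bT n)).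
Qed.

Let I2_tpoly_mul n (a : nat * nat -> R) (f : R -> R -> R) : cont2 f ->
  I2 (fun u v => f u v * tpoly (N_ n) a u v) = \sum_(i <- box (N_ n)) a i * fc f i.1 i.2.
Proof.
move=> cf.
transitivity (I2 (fun u v => \sum_(i <- box (N_ n)) a i * (f u v * ebas i u v))).
  by apply: I2_ext => u v; rewrite /tpoly mulr_sumr; apply: eq_bigr => i _; ring.
have ce i : cont2 (fun u v => f u v * ebas i u v) by apply: cont2M => //; exact: cont2_ebas.
rewrite (I2_sum _ _).2; last by move=> i; apply: cont2M => //; exact: cont2_cst.
by apply: eq_bigr => i _; rewrite I2Z.
Qed.

(** As g = w^2 d, \int g^2 <= Wm^2 \int g d, and \int g d = S \int g L - \int d T, where the last
    integral is 0 by the Galerkin equations. In \int g L only edge frequencies survive. There 1 + j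
    + k > n, so lam (n + 1) <= (1 + j + k)^4 and [HK] bounds the sum by a constant over n + 1. *)
Let residual : exists C, 0 <= C /\ forall n, I2 (fun u v => g n u v ^+ 2) <= C / n.+1%:R.
Proof.
have [SB HSB] := S_bound.
have SB0 : 0 <= SB by apply: le_trans (HSB 0).
have [B [Lg bg]] := blip_g.
have [B0 _] := blip_ge0 (bg 0).
have fcB n j k : `|fc (g n) j k| <= B * (2 * pi) ^+ 2.
  rewrite -I2_cst.
  have ce : cont2 (fun u v => g n u v * (cos (j%:R * u) * sin (k%:R * v))).
    by apply: cont2M => //; exact: (@cont2_ebas _ (j, k)).
  have H u v : `|g n u v * (cos (j%:R * u) * sin (k%:R * v))| <= B.
    rewrite normrM -[B]mulr1; apply: ler_pM => //; first exact: (bg n).1.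
    rewrite normrM -[1]mulr1; apply: ler_pM => //; rewrite ler_norml.
      by rewrite cos_geN1 cos_le1.
    by rewrite sin_geN1 sin_le1.
  rewrite ler_norml; apply/andP; split; last first.
    by apply: le_I2 => //; [exact: cont2_cst|move=> u v _ _; apply: le_trans (H _ _); exact: ler_norm].
  rewrite I2_cst -mulNr -I2_cst; apply: le_I2 => //; first exact: cont2_cst.
  by move=> u v _ _; have := H u v; rewrite ler_norml => /andP[].
pose FB := B * (2 * pi) ^+ 2.
have FB0 : 0 <= FB by rewrite mulr_ge0// sqr_ge0.
exists (Wm ^+ 2 * (SB * (FB * K))); split.
  by apply: mulr_ge0; [exact: sqr_ge0|apply: mulr_ge0 => //; apply: mulr_ge0].
move=> n.
apply: (@le_trans _ _ (Wm ^+ 2 * I2 (fun u v => g n u v * d n u v))).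
  rewrite -I2Z; last exact: cont2M.
  apply: le_I2; [exact: cont2X|by apply: cont2M; [exact: cont2_cst|exact: cont2M]|].
  move=> u v _ _; rewrite expr2 [X in _ * X]gd mulrCA mulrA [leRHS]mulrA.
  rewrite -mulrA -[leRHS]mulrA; apply: ler_wpM2r.
    by rewrite gd -mulrA mulr_ge0 ?sqr_ge0// -expr2 sqr_ge0.
  by rewrite lerXn2r ?nnegrE ?(ltW (wgt0 u v))// ?(ltW Wm0)//; apply: le_trans (blip_w.1 u v); exact: ler_norm.
rewrite -[leRHS]mulrA; apply: ler_wpM2l; first exact: sqr_ge0.
have -> : I2 (fun u v => g n u v * d n u v) = S_ n * I2 (fun u v => g n u v * L n u v) + -1 * I2 (fun u v => d n u v * T n u v).
  rewrite -I2Z; last exact: cont2M.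
  rewrite -[in X in _ + X]I2Z; last exact: cont2M.
  rewrite -I2D; [|by apply: cont2M; [exact: cont2_cst|exact: cont2M]..].
  by apply: I2_ext => u v; rewrite gd {1}/d /conf_weight; field.
have -> : I2 (fun u v => d n u v * T n u v) = 0.
  rewrite I2_tpoly_mul// big_seq big1// => -[j k] jk.
  by rewrite fc_d ?mulr0.
rewrite mulr0 addr0; apply: le_trans (ler_norm _) _; rewrite normrM -mulrA.
apply: ler_pM => //; rewrite I2_tpoly_mul//.
apply: le_trans (ler_norm_sum _ _ _) _.
apply: (@le_trans _ _ (\sum_(i <- box (N_ n)) FB / n.+1%:R * ((1 + i.1%:R + i.2%:R) ^+ 4 * `|a_ n i|))); last first.
  rewrite -mulr_sumr [leRHS]mulrAC; apply: ler_wpM2l; last exact: HK.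
  exact: divr_ge0.
rewrite big_seq [leRHS]big_seq; apply: ler_sum => -[j [|k]] jk; first by move: jk; rewrite mem_box/= andbF.
have n0 : 0 < n.+1%:R :> R by [].
have x0 : 0 <= j%:R :> R by []. have y0 : 0 <= k.+1%:R :> R by [].
have rhs0 : 0 <= FB / n.+1%:R * ((1 + (j, k.+1).1%:R + (j, k.+1).2%:R) ^+ 4 * `|a_ n (j, k.+1)|).
  by rewrite mulr_ge0 ?divr_ge0// mulr_ge0// exprn_ge0// !addr_ge0.
have [/andP[jN kN]|edge] := boolP ((j.+2 < N_ n)%N && (k.+3 < N_ n)%N).
  by rewrite /= fc_g// mulr0 normr0.
rewrite /= normrM mulrC; rewrite normrM.
have sz : n.+1%:R <= 1 + j%:R + k.+1%:R :> R.
  rewrite -[X in X + _ + _]/(1%:R) -!natrD ler_nat.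
  exact: box_edge (N_ge n) edge.
have lamle : `|lam (j, k.+1)| * n.+1%:R <= (1 + j%:R + k.+1%:R) ^+ 4 :> R.
  have l0 : 0 <= lam (j, k.+1) :> R by rewrite addr_ge0 ?sqr_ge0.
  have l1 : lam (j, k.+1) <= (1 + j%:R + k.+1%:R) ^+ 2 :> R.
    rewrite /lam/=; move: x0 y0; set x := j%:R; set y := k.+1%:R; nra.
  rewrite ger0_norm//.
  apply: (@le_trans _ _ ((1 + j%:R + k.+1%:R) ^+ 2 * (1 + j%:R + k.+1%:R))).
    by apply: ler_pM.
  rewrite -exprSr ler_weXn2l// -addrA lerDl addr_ge0//.
apply: (@le_trans _ _ (FB * (`|lam (j, k.+1)| * `|a_ n (j, k.+1)|))).
  by apply: ler_wpM2r => //; rewrite mulr_ge0.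
rewrite -[leRHS]mulrA; apply: ler_wpM2l => //.
rewrite [leRHS]mulrA; apply: ler_wpM2r => //.
by rewrite mulrC ler_pdivlMr.
Qed.

Context (U : set_system nat) {UU : UltraFilter U}.
Hypothesis Uoo : \oo `<=` U.

Let F_ex p q u v : exists l : R, (p + q <= 4)%N -> tpd p q (N_ n) (a_ n) u v @[n --> U] --> l.
Proof.
case: (leqP (p + q) 4) => pq; last by exists 0.
have [|l hl] := @ultra_cvg R U UU (fun n => tpd p q (N_ n) (a_ n) u v) K; last by exists l.
by apply: filterE => n; exact: tpd_bound.
Qed.

Let F p q u v := projT1 (cid (F_ex p q u v)).
Let FE p q u v : (p + q <= 4)%N -> tpd p q (N_ n) (a_ n) u v @[n --> U] --> F p q u v.
Proof. by rewrite /F; case: cid. Qed.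

(** All that passes to the limit is a pointwise identity or an inequality whose constant is the same
    for all n. The equation follows from the residual in mean square, which the common Lipschitz
    constant makes pointwise; nonvanishing follows from the lower bound on [S_ n]. *)
Theorem galerkin_limit : exists (F : nat -> nat -> R -> R -> R) S, [/\
  Smin <= S,
  (forall p q u v, (p + q <= 2)%N ->
    der (fun x => F p q x v) u (F p.+1 q u v) /\ der (fun x => F p q u x) v (F p q.+1 u v)),
  (forall p q, (p + q <= 3)%N -> cont2 (F p q)),
  (forall u v, S * - (F 2 0 u v + F 0 2 u v) = rho u v * F 0 0 u v) &
  (exists u v, F 0 0 u v != 0) /\
  (forall u v u' v', cos u = cos u' -> cos v = cos v' -> sin v = sin v' ->
    F 0 0 u v = F 0 0 u' v')].
Proof.
have [SB HSB] := S_bound.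
have [|S hS] := @ultra_cvg R U UU S_ SB; first by apply: filterE; exact: HSB.
have SS : Smin <= S by apply: (ultra_ge (U := U) hS); exact: filterE.
have F00 u v : T n u v @[n --> U] --> F 0 0 u v.
  by under eq_fun do rewrite -tpd00; exact: FE.
have Flap u v : L n u v @[n --> U] --> - (F 2 0 u v + F 0 2 u v).
  have h : - (tpd 2 0 (N_ n) (a_ n) u v + tpd 0 2 (N_ n) (a_ n) u v) @[n --> U] --> - (F 2 0 u v + F 0 2 u v).
    by apply: cvgN; apply: cvgD; exact: FE.
  by under eq_fun do rewrite -[L _ u v]opprK -tpd_lap.
have perT a n u v u' v' : cos u = cos u' -> cos v = cos v' -> sin v = sin v' ->
    tpoly n a u v = tpoly n a u' v' :> R.
  move=> e1 e2 e3; apply: eq_bigr => i _; rewrite /ebas.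
  by rewrite (cos_eq_mul _ e1) (cos_sin_eq_mul _ e2 e3).
exists F, S; split => //.
- move=> p q u v pq; split; apply: (@der_taylor _ _ _ _ K) => t.
    apply: (ultra_norm_le (U := U) (a := fun n => tpd p q (N_ n) (a_ n) (u + t) v - tpd p q (N_ n) (a_ n) u v - t * tpd p.+1 q (N_ n) (a_ n) u v)).
      apply: cvgB; first by apply: cvgB; apply: FE; lia.
      by apply: cvgM; [exact: cvg_cst|apply: FE; lia].
    by apply: filterE => n; exact: tpd_taylor_u.
  apply: (ultra_norm_le (U := U) (a := fun n => tpd p q (N_ n) (a_ n) u (v + t) - tpd p q (N_ n) (a_ n) u v - t * tpd p q.+1 (N_ n) (a_ n) u v)).
    apply: cvgB; first by apply: cvgB; apply: FE; lia.
    by apply: cvgM; [exact: cvg_cst|apply: FE; lia].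
  by apply: filterE => n; exact: tpd_taylor_v.
- move=> p q pq; apply: (@blip_cont2 _ _ K K); split => [u v|u v u' v'].
    have pq4 : (p + q <= 4)%N by lia.
    apply: (ultra_norm_le (U := U) (a := fun n => tpd p q (N_ n) (a_ n) u v)); first exact: FE.
    by apply: filterE => n; apply: tpd_bound.
  apply: (ultra_norm_le (U := U) (a := fun n => tpd p q (N_ n) (a_ n) u' v' - tpd p q (N_ n) (a_ n) u v)).
    by apply: cvgB; apply: FE; lia.
  by apply: filterE => n; exact: (tpd_lip (HK n) pq).2.
- pose G u v := w u v ^+ 2 * (S * - (F 2 0 u v + F 0 2 u v)) + -1 * F 0 0 u v.
  have gG u v : g n u v @[n --> U] --> G u v.
    apply: cvgD; last by apply: cvgM; [exact: cvg_cst|exact: F00].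
    apply: cvgM; first exact: cvg_cst.
    by apply: cvgM; [exact: hS|exact: Flap].
  suff G0 u v : G u v = 0.
    move=> u v; have := G0 u v; rewrite /G mulN1r => /eqP; rewrite subr_eq0 => /eqP <-.
    by rewrite /conf_weight; field.
  (* The residual is controlled on one period square only, so the point is moved there; [g n]
     depends only on cosines and sines of the angles. *)
  have [u' [cu' eu eu2]] := circle_rep u; have [v' [cv' ev ev2]] := circle_rep v.
  have -> : G u v = G u' v'.
    apply: (ultra_unique (U := U) (gG u v)).
    suff -> : (fun n => g n u v) = (fun n => g n u' v') by exact: gG.
    by apply/funext => n; rewrite /g /wfun -eu -ev !(perT _ _ u v u' v').
  apply/eqP; apply: contraT => Gn0.
  (* If G is not 0 at (u', v'), then |g n| >= e there for some arbitrarily large n. The common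
     Lipschitz constant keeps |g n| >= e / 2 within distance [l] in each coordinate, against the
     decay of the residual. The [pi] in [l] serves [I2_lower]. *)
  pose e := `|G u' v'| / 2.
  have e0 : 0 < e by rewrite divr_gt0// normr_gt0.
  have [B [Lg bg]] := blip_g; have [B0 Lg0] := blip_ge0 (bg 0).
  have [C [C0 HC]] := residual.
  pose l := Num.min pi (e / (4 * (Lg + 1))).
  have p4 : 0 < 4 * (Lg + 1) by rewrite mulr_gt0// ltr_wpDl.
  have l0 : 0 < l by rewrite lt_min pi_gt0 divr_gt0.
  have [n [hn1 hn2]] : exists n, e <= `|g n u' v'| /\ C / n.+1%:R < (e / 2) ^+ 2 * l ^+ 2.
    have h1 : U [set n | e <= `|g n u' v'|].
      have h0 : `|g n u' v'| @[n --> U] --> `|G u' v'| by apply: cvg_norm; exact: gG.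
      have el : e < `|G u' v'| by rewrite /e ltr_pdivrMr// ltr_pMr ?normr_gt0//; lra.
      have FU : Filter U by typeclasses eauto.
      have h2 : U [set n | e < `|g n u' v'|] := @cvgr_gt _ _ _ FU _ _ h0 _ el.
      by apply: filterS h2 => n; exact: ltW.
    have eta0 : 0 < (e / 2) ^+ 2 * l ^+ 2 by rewrite mulr_gt0 ?exprn_gt0// divr_gt0.
    have e1 : 0 < (e / 2) ^+ 2 * l ^+ 2 / (C + 1) by rewrite divr_gt0// ltr_wpDl.
    have [n0 _ hn0] := near_infty_natSinv_lt (PosNum e1).
    have h2 := U_ge Uoo n0.
    have FU : ProperFilter U by typeclasses eauto.
    have h12 := @filterI _ _ FU _ _ h1 h2.
    have [n [/= k1 k2]] := @filter_ex _ _ FU _ h12.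
    exists n; split => //; have /= := hn0 n k2.
    rewrite ltr_pdivlMr ?ltr_wpDl// => h; apply: le_lt_trans h.
    by rewrite mulrC ler_wpM2l// lerDl.
  have := le_lt_trans (HC n) hn2; rewrite ltNge => /negP[].
  apply: (@I2_lower _ _ 0 l ((e / 2) ^+ 2) u' v') => //.
  + exact: cont2X.
  + by rewrite exprn_gt0// divr_gt0.
  + by move=> *; exact: sqr_ge0.
  + move=> u1 v1 hu hv.
    rewrite -(real_normK (num_real (g n u1 v1))) lerXn2r ?nnegrE ?divr_ge0 ?(ltW e0)//.
    have := (bg n).2 u' v' u1 v1.
    have ll : l <= e / (4 * (Lg + 1)) by rewrite ge_min lexx orbT.
    have h3 : Lg * (`|u1 - u'| + `|v1 - v'|) <= e / 2.
      apply: (@le_trans _ _ (Lg * (e / (4 * (Lg + 1)) + e / (4 * (Lg + 1))))).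
        by rewrite ler_wpM2l// lerD// (le_trans _ ll).
      have -> : Lg * (e / (4 * (Lg + 1)) + e / (4 * (Lg + 1))) = e / 2 * (Lg / (Lg + 1)).
        by field; rewrite gt_eqF// ltr_wpDl.
      by rewrite ler_piMr ?divr_ge0 ?(ltW e0)// ler_pdivrMr ?ltr_wpDl// mul1r lerDl.
    move=> h4; have := le_trans h4 h3.
    have := ler_distD (g n u1 v1) (g n u' v') 0; rewrite !subr0 distrC.
    lra.
  + by rewrite ge_min lexx.
- split; last first.
    move=> u v u' v' e1 e2 e3; apply: (ultra_unique (U := U) (F00 u v)).
    by under eq_fun do rewrite (perT _ _ u v u' v')//; exact: F00.
  have IR0 : 0 <= I2 rho.
    have -> : 0 = I2 (fun _ _ : R => 0 : R) by rewrite I2_cst mul0r.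
    by apply: le_I2 => //; [exact: cont2_cst|move=> u v _ _; rewrite sqr_ge0].
  (* If [T n] had square below c0 on the whole period square, then [S_ n] would be at most c0 times
     \int rho, which is below Smin by the summand 1. So each [T n] has a point [z n] where its
     square is at least c0. These points have a limit along U, and the common Lipschitz constant K
     carries the lower bound to that limit. *)
  pose c0 := Smin / (I2 rho + 1).
  have c00 : 0 < c0 by rewrite divr_gt0// ltr_wpDl.
  have /boolp.choice[z Hz] : forall n, exists z : R * R, square z /\ c0 <= T n z.1 z.2 ^+ 2.
    move=> n; apply: contrapT => /forallNP H.
    have : S_ n <= c0 * I2 rho.
      rewrite S_E -I2Z//; apply: le_I2.
      - by apply: cont2M => //; exact: cont2X.
      - by apply: cont2M => //; exact: cont2_cst.
      move=> u v cu cv; rewrite mulrC ler_wpM2r ?sqr_ge0// leNgt; apply/negP => h.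
      by apply: (H (u, v)); split => //; exact: ltW.
    move=> /(le_trans (S_ge n)); rewrite leNgt => /negP[].
    by rewrite /c0 mulrAC ltr_pdivrMr ?ltr_wpDl// mulrDr mulr1 ltrDl.
  have zb (x : R) : circ x -> `|x| <= 2 * pi.
    by rewrite /circ/= in_itv/= => /andP[x0 x1]; rewrite ger0_norm.
  have [|us hus] := @ultra_cvg R U UU (fun n => (z n).1) (2 * pi).
    by apply: filterE => n; apply: zb; exact: (Hz n).1.1.
  have [|vs hvs] := @ultra_cvg R U UU (fun n => (z n).2) (2 * pi).
    by apply: filterE => n; apply: zb; exact: (Hz n).1.2.
  exists us, vs; apply/eqP => F0.
  have bT n : blip (T n) K K.
    have h := @tpd_lip R 0 0 _ _ K (HK n) isT.
    split => [u v|u v u' v']; first exact: T_bound.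
    by rewrite -!tpd00; exact: h.2.
  have c1 : K * (`|(z n).1 - us| + `|(z n).2 - vs|) + `|T n us vs| @[n --> U] --> K * (`|us - us| + `|vs - vs|) + `|F 0 0 us vs|.
    apply: cvgD; last by apply: cvg_norm; exact: F00.
    apply: cvgM; first exact: cvg_cst.
    by apply: cvgD; apply: cvg_norm; apply: cvgB => //; exact: cvg_cst.
  rewrite F0 !subrr normr0 !addr0 mulr0 in c1.
  have : Num.sqrt c0 <= 0.
    apply: (ultra_ge (U := U) c1); apply: filterE => n /=.
    have h1 : Num.sqrt c0 <= `|T n (z n).1 (z n).2| by rewrite -sqrtr_sqr ler_wsqrtr//; exact: (Hz n).2.
    apply: le_trans h1 _; have := (bT n).2 us vs (z n).1 (z n).2.
    have := ler_distD (T n us vs) (T n (z n).1 (z n).2) 0; rewrite !subr0.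
    lra.
  by rewrite leNgt sqrtr_gt0 c00.
Qed.

End limit.

(** * Eigenfunctions for the conformal metric on the square torus *)

Section flat_eigenfunction.
Context {R : realType}.
Implicit Types (al be S : R) (r : R -> R -> R) (F : nat -> nat -> R -> R -> R).

(* F p q stands for the derivative of F 0 0 of order p in u and q in v *)
Definition flat_eigenfunction r S F :=
  [/\ forall p q u v, (p + q <= 2)%N ->
        der (fun x => F p q x v) u (F p.+1 q u v) /\ der (fun x => F p q u x) v (F p q.+1 u v),
      forall p q, (p + q <= 3)%N -> cont2 (F p q),
      forall u v, S * - (F 2 0 u v + F 0 2 u v) = r u v * F 0 0 u v,
      exists u v, F 0 0 u v != 0 &
      forall u v u' v', cos u = cos u' -> sin u = sin u' -> cos v = cos v' -> sin v = sin v' ->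
        F 0 0 u v = F 0 0 u' v'].

(** It reduces al < be to be < al. The periodicity clause of [flat_eigenfunction] compares sin u as
    well as sin v, which makes it symmetric in the two angles. *)
Lemma flat_eigenfunction_swap r S F : flat_eigenfunction r S F ->
  flat_eigenfunction (fun u v => r v u) S (fun p q u v => F q p v u).
Proof.
move=> [h1 h2 h3 [u [v h4]] h5]; split.
- by move=> p q u' v' pq; have [] := h1 q p v' u'; rewrite 1?addnC.
- by move=> p q pq; apply: cont2_swap; apply: h2; rewrite addnC.
- by move=> u' v'; rewrite addrC.
- by exists v, u.
- by move=> *; exact: h5.
Qed.

Lemma flat_eigenfunction_lt al be : 0 <= be -> be < al -> al ^+ 2 + be ^+ 2 = 1 ->
  exists S F, [/\ I2 (conf_weight al be) < (2 * pi) ^+ 2 * S, 0 < S & flat_eigenfunction (conf_weight al be) S F].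
Proof.
move=> be0 beal abE.
have al0 : 0 <= al by apply: le_trans (ltW beal).
have ab := ab_lt_sqrt2 be0 beal abE.
have wn u v : wfun al be u v != 0 by rewrite gt_eqF// wfun_gt0.
have [|M [Smin [Smin1 Smin0 HM]]] := trial_function al0 be0 ab.
  apply: le_lt_trans (test_function_quotient be0 beal abE); apply: eq_ler; congr (_ * _).
  apply: I2_ext => u v /=; rewrite -/(wfun al be u v).
  have -> : be * sin v ^+ 2 = be - be * cos v ^+ 2 by rewrite sin2cos2; ring.
  have := wn u v; rewrite /wfun => hw; field; exact: hw.
(* In the dimension M + n + 2, the summand M brings the truncated test function into the space, and
   n + 2 is what the edge estimate asks. *)
have /boolp.choice[a /boolp.choice[S_ HS]] : forall n, exists a S, [/\ galerkin_solution al be (M + n.+2)%N a S,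
    S = I2 (fun u v : R => conf_weight al be u v * tpoly (M + n.+2)%N a u v ^+ 2) & Smin <= S].
  move=> n; have [|a [S [h1 h2 h3]]] := @galerkin_exists R al be al0 be0 ab (M + n.+2)%N.
    by rewrite addnS.
  by exists a, S; split => //; apply: HM h3 h1; rewrite leq_addr.
have [K [K0 HK]] := galerkin_regularity al0 be0 ab Smin0.
have [U [UU Uoo]] := ultrafilter_nat.
have [|n|n|n|n|F [S [h1 h2 h3 h4 [h5 h6]]]] := @galerkin_limit R al be al0 be0 ab (fun n => M + n.+2)%N a S_ Smin K
  _ _ _ Smin0 _ _ U UU Uoo.
- by move=> n; rewrite leq_addl.
- by have [] := HS n.
- by have [] := HS n.
- by have [] := HS n.
- by have [g1 g2 g3] := HS n; exact: (HK _ _ _ g1 g3).2.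
exists S, F; split.
- by apply: lt_le_trans Smin1 _; rewrite ler_wpM2l// sqr_ge0.
- exact: lt_le_trans h1.
- by split => // u v u' v' e1 _ e2 e3; exact: h6.
Qed.

Theorem flat_eigenfunction_exists al be : 0 <= al -> 0 <= be -> al != be -> al ^+ 2 + be ^+ 2 = 1 ->
  exists S F, [/\ I2 (conf_weight al be) < (2 * pi) ^+ 2 * S, 0 < S & flat_eigenfunction (conf_weight al be) S F].
Proof.
move=> al0 be0; rewrite neq_lt => /orP[] lt abE; last exact: flat_eigenfunction_lt.
rewrite addrC in abE.
have [S [F [h1 h2 h3]]] := flat_eigenfunction_lt al0 lt abE.
have rE u v : conf_weight be al v u = conf_weight al be u v by rewrite /conf_weight /wfun; congr (_ ^-1 ^+ 2); ring.
exists S, (fun p q u v => F q p v u); split => //.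
  rewrite -I2_swap; last by apply: cont2_conf_weight => //; rewrite addrC; exact: ab_lt_sqrt2.
  by rewrite (I2_ext (g := conf_weight be al))// => u v; rewrite -rE.
have -> : conf_weight al be = fun u v => conf_weight be al v u by apply/funext => u; apply/funext => v; rewrite rE.
exact: flat_eigenfunction_swap.
Qed.

End flat_eigenfunction.

(** * Geometry of inverted rings *)

Section euclidean_space.
Context {R : realType}.
Implicit Types (x y z : R) (p t : 'rV[R]_3) (Q : 'M[R]_3).

Lemma circle_angle x y : x ^+ 2 + y ^+ 2 = 1 -> exists th, cos th = x /\ sin th = y.
Proof.
move=> e.
have x1 : -1 <= x <= 1 by rewrite -ler_norml -(expr_le1 (n := 2))// real_normK ?num_real// -e lerDl sqr_ge0.
have s : sin (acos x) = `|y|.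
  rewrite sin_acos//; have -> : 1 - x ^+ 2 = y ^+ 2 by rewrite -e; ring.
  by rewrite sqrtr_sqr.
case: (leP 0 y) => y0; first by exists (acos x); rewrite acosK// s ger0_norm.
by exists (- acos x); rewrite cosN sinN acosK// s ltr0_norm// opprK.
Qed.

Lemma polar_coordinates x y : exists r th, [/\ 0 <= r, r ^+ 2 = x ^+ 2 + y ^+ 2,
  x = r * cos th & y = r * sin th].
Proof.
pose r := Num.sqrt (x ^+ 2 + y ^+ 2).
have r2 : r ^+ 2 = x ^+ 2 + y ^+ 2 by rewrite sqr_sqrtr// addr_ge0 ?sqr_ge0.
have [r0|r0] := eqVneq r 0.
  exists 0, 0; move: r2; rewrite r0 expr0n/= => /esym/eqP.
  by rewrite paddr_eq0 ?sqr_ge0// !expf_eq0/= => /andP[/eqP -> /eqP ->]; rewrite !expr0n/= addr0 !mul0r.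
have [|th [c s]] := @circle_angle (x / r) (y / r).
  by rewrite !expr_div_n -mulrDl -r2 divff// expf_neq0.
exists r, th; split; rewrite ?sqrtr_ge0// ?c ?s mulrC divfK//.
Qed.

Lemma vec3E x y z : [/\ vec3 x y z 0 0 = x, vec3 x y z 0 1 = y & vec3 x y z 0 2%:R = z].
Proof. by rewrite /vec3 !mxE. Qed.

Lemma sum3 (F : 'I_3 -> R) : \sum_(i < 3) F i = F 0 + F 1 + F 2%:R.
Proof.
rewrite !big_ord_recl big_ord0 addr0 addrA; by congr (F _ + F _ + F _); apply: val_inj.
Qed.

Lemma dot_vec3 x y z x' y' z' :
  dot (vec3 x y z) (vec3 x' y' z') = x * x' + y * y' + z * z'.
Proof. by rewrite /dot sum3; case: (vec3E x y z) => -> -> ->; case: (vec3E x' y' z') => -> -> ->. Qed.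

Lemma vec3B x y z x' y' z' : vec3 x y z - vec3 x' y' z' = vec3 (x - x') (y - y') (z - z').
Proof. by apply/rowP => i; rewrite /vec3 !mxE; case: i => [[|[|[|i]]] hi]. Qed.

Lemma vec3Z k x y z : k *: vec3 x y z = vec3 (k * x) (k * y) (k * z).
Proof. by apply/rowP => i; rewrite /vec3 !mxE; case: i => [[|[|[|i]]] hi]. Qed.

Lemma dotE p t : dot p t = (p *m t^T) 0 0.
Proof. by rewrite mxE; apply: eq_bigr => i _; rewrite mxE. Qed.

Lemma dot_mulmx Q p t : Q *m Q^T = 1%:M -> dot (p *m Q) (t *m Q) = dot p t.
Proof. by move=> QQ; rewrite !dotE trmx_mul mulmxA -(mulmxA p) QQ mulmx1. Qed.

Lemma row3P p : p = vec3 (p 0 0) (p 0 1) (p 0 2%:R).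
Proof.
apply/rowP => i; rewrite /vec3 mxE; case: i => [[|[|[|i]]] hi] //=; congr (p 0 _); exact: val_inj.
Qed.

Lemma derive1_row3 p Q (y1 y2 y3 : R -> R) s d1 d2 d3 :
  der y1 s d1 -> der y2 s d2 -> der y3 s d3 ->
  derive1 (fun r => p + vec3 (y1 r) (y2 r) (y3 r) *m Q) s = vec3 d1 d2 d3 *m Q.
Proof.
move=> h1 h2 h3.
have vE x y z j : (vec3 x y z *m Q) 0 j = x * Q 0 j + y * Q 1 j + z * Q 2%:R j.
  by rewrite mxE sum3; case: (vec3E x y z) => -> -> ->.
have hd j : der (fun r => (p + vec3 (y1 r) (y2 r) (y3 r) *m Q) 0 j) s ((vec3 d1 d2 d3 *m Q) 0 j).
  apply: (@der_ext _ (fun r => p 0 j + (y1 r * Q 0 j + y2 r * Q 1 j + y3 r * Q 2%:R j))).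
    by move=> r /=; rewrite [RHS]mxE vE.
  by derq; rewrite vE; ring.
rewrite derive1E derive_mx; last first.
  by apply/derivable_mxP => i j; rewrite ord1; case: (hd j).
by apply/rowP => j; case: (hd j) => _ <-; rewrite mxE.
Qed.

Lemma classC0 (f : R -> R -> R) : cont2 f -> classC 0 f.
Proof. by []. Qed.

Lemma classC_succ k (f fu fv : R -> R -> R) : cont2 f ->
  (forall u v, der (fun s => f s v) u (fu u v)) ->
  (forall u v, der (fun s => f u s) v (fv u v)) ->
  classC k fu -> classC k fv -> classC k.+1 f.
Proof.
move=> cf hu hv ku kv; split => //; split.
- by move=> u v; case: (hu u v).
- by move=> u v; case: (hv u v).
- rewrite (_ : partial_u f = fu)//; apply/funext => u; apply/funext => v; exact: derive1_der.
- rewrite (_ : partial_v f = fv)//; apply/funext => u; apply/funext => v; exact: derive1_der.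
Qed.

Lemma der_inversion c (z1 z2 z3 : R -> R) s d1 d2 d3 (i : R -> R) d :
  der z1 s d1 -> der z2 s d2 -> der z3 s d3 -> der i s d ->
  z1 s ^+ 2 + z2 s ^+ 2 + z3 s ^+ 2 != 0 ->
  let n := z1 s ^+ 2 + z2 s ^+ 2 + z3 s ^+ 2 in
  der (fun r => c ^+ 2 * (i r / (z1 r ^+ 2 + z2 r ^+ 2 + z3 r ^+ 2))) s
    (c ^+ 2 * (d / n - i s * (2 * (z1 s * d1 + z2 s * d2 + z3 s * d3)) / n ^+ 2)).
Proof.
move=> h1 h2 h3 h n0 n.
apply: der_eq.
  apply: derM; first exact: der_cst.
  apply: derM; first exact: h.
  apply: derV; first exact: n0.
  exact: (derD (derD (derX 2 h1) (derX 2 h2)) (derX 2 h3)).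
by rewrite /n /= !expr1; field; exact: n0.
Qed.

(* an inversion is conformal *)
Lemma dot_inversion c z1 z2 z3 x1 x2 x3 y1 y2 y3 :
  let n := z1 ^+ 2 + z2 ^+ 2 + z3 ^+ 2 in n != 0 ->
  let f x y := c ^+ 2 * (x / n - y * (2 * (z1 * x1 + z2 * x2 + z3 * x3)) / n ^+ 2) in
  let g x y := c ^+ 2 * (x / n - y * (2 * (z1 * y1 + z2 * y2 + z3 * y3)) / n ^+ 2) in
  f x1 z1 * g y1 z1 + f x2 z2 * g y2 z2 + f x3 z3 * g y3 z3 =
  (x1 * y1 + x2 * y2 + x3 * y3) * c ^+ 4 / n ^+ 2.
Proof. by move=> n n0 f g; rewrite /f /g /n; field; exact: n0. Qed.

End euclidean_space.

(** * The induced metric of the cyclide in isothermal coordinates *)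

Section cyclide.
Context {R : realType}.
Variables (b c : R) (Q : 'M[R]_3) (t p : 'rV[R]_3).
Local Notation s2 := (Num.sqrt (2 : R)).
Hypotheses (b0 : 0 < b) (c0 : c != 0) (QQ : Q *m Q^T = 1%:M).
Local Notation T := (anchor_ring (s2 * b) b Q t).
Hypothesis pT : ~ surface T p.
Local Notation M := (inverted p c T).

(* the centre of inversion in the coordinates in which the ring is standard *)
Let q := (p - t) *m Q^T.
Let q1 := q 0 0.
Let q2 := q 0 1.
Let q3 := q 0 2%:R.

Let k (u : R) := s2 + cos u.
Let z1 u v := b * k u * cos v - q1.
Let z2 u v := b * k u * sin v - q2.
Let z3 u (v : R) := b * sin u - q3.
(** The squared distance from the centre of inversion to the point of the ring. The inversion
    multiplies the ring metric b^2 (du^2 + k^2 dv^2) by c^4 / n^2. *)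
Let n u v := z1 u v ^+ 2 + z2 u v ^+ 2 + z3 u v ^+ 2.

Let k0 u : 0 < k u.
Proof.
have := @cos_geN1 R u; have : 1 < s2 by rewrite -{1}sqrtr1 ltr_sqrt//; lra.
rewrite /k; lra.
Qed.

Let k1 u : k u != 0. Proof. by rewrite gt_eqF. Qed.

Let TE u v : T u v - p = vec3 (z1 u v) (z2 u v) (z3 u v) *m Q.
Proof.
have -> : p = q *m Q + t by rewrite -mulmxA (mulmx1C QQ) mulmx1 subrK.
rewrite /anchor_ring opprD addrACA subrr addr0 -mulmxBl; congr (_ *m _).
by rewrite [q]row3P vec3B /z1 /z2 /z3 /k -/q1 -/q2 -/q3; congr vec3; ring.
Qed.

Let n0 u v : n u v != 0.
Proof.
apply/eqP => e; apply: pT; exists u, v; apply/esym/eqP; rewrite -subr_eq0 TE.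
move: e => /eqP; rewrite /n !paddr_eq0 ?addr_ge0 ?sqr_ge0// !expf_eq0/= => /andP[/andP[/eqP -> /eqP ->] /eqP ->].
by rewrite (_ : vec3 0 0 0 = 0) ?mul0mx//; apply/rowP => i; rewrite !mxE; case: i => [[|[|[|i]]] hi].
Qed.

Let ME : M = fun u v => p + vec3 (c ^+ 2 * (z1 u v / n u v)) (c ^+ 2 * (z2 u v / n u v)) (c ^+ 2 * (z3 u v / n u v)) *m Q.
Proof.
apply/funext => u; apply/funext => v; rewrite /inverted /inversion TE dot_mulmx// dot_vec3; congr (_ + _).
by rewrite scalemxAl vec3Z -!expr2 -/(n u v); congr (vec3 _ _ _ *m _); ring.
Qed.

Let z1u u v : der (fun s => z1 s v) u (- (b * sin u * cos v)).
Proof. by rewrite /z1 /k; derq; ring. Qed.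
Let z2u u v : der (fun s => z2 s v) u (- (b * sin u * sin v)).
Proof. by rewrite /z2 /k; derq; ring. Qed.
Let z3u u v : der (fun s => z3 s v) u (b * cos u).
Proof. by rewrite /z3; derq; ring. Qed.
Let z1v u v : der (fun s => z1 u s) v (- (b * k u * sin v)).
Proof. by rewrite /z1; derq; ring. Qed.
Let z2v u v : der (fun s => z2 u s) v (b * k u * cos v).
Proof. by rewrite /z2; derq; ring. Qed.
Let z3v u v : der (fun s => z3 u s) v 0.
Proof. by rewrite /z3; derq; ring. Qed.

Lemma partial_u_cyclide u v : partial_u M u v = vec3 (c ^+ 2 * (- (b * sin u * cos v) / n u v - z1 u v * (2 * (z1 u v * - (b * sin u * cos v) + z2 u v * - (b * sin u * sin v) + z3 u v * (b * cos u))) / n u v ^+ 2))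
 (c ^+ 2 * (- (b * sin u * sin v) / n u v - z2 u v * (2 * (z1 u v * - (b * sin u * cos v) + z2 u v * - (b * sin u * sin v) + z3 u v * (b * cos u))) / n u v ^+ 2))
 (c ^+ 2 * ((b * cos u) / n u v - z3 u v * (2 * (z1 u v * - (b * sin u * cos v) + z2 u v * - (b * sin u * sin v) + z3 u v * (b * cos u))) / n u v ^+ 2)) *m Q.
Proof.
rewrite ME /partial_u; apply: derive1_row3.
- exact: (der_inversion c (z1u u v) (z2u u v) (z3u u v) (z1u u v) (n0 u v)).
- exact: (der_inversion c (z1u u v) (z2u u v) (z3u u v) (z2u u v) (n0 u v)).
- exact: (der_inversion c (z1u u v) (z2u u v) (z3u u v) (z3u u v) (n0 u v)).
Qed.

Lemma partial_v_cyclide u v : partial_v M u v = vec3 (c ^+ 2 * (- (b * k u * sin v) / n u v - z1 u v * (2 * (z1 u v * - (b * k u * sin v) + z2 u v * (b * k u * cos v) + z3 u v * 0)) / n u v ^+ 2))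
 (c ^+ 2 * ((b * k u * cos v) / n u v - z2 u v * (2 * (z1 u v * - (b * k u * sin v) + z2 u v * (b * k u * cos v) + z3 u v * 0)) / n u v ^+ 2))
 (c ^+ 2 * (0 / n u v - z3 u v * (2 * (z1 u v * - (b * k u * sin v) + z2 u v * (b * k u * cos v) + z3 u v * 0)) / n u v ^+ 2)) *m Q.
Proof.
rewrite ME /partial_v; apply: derive1_row3.
- exact: (der_inversion c (z1v u v) (z2v u v) (z3v u v) (z1v u v) (n0 u v)).
- exact: (der_inversion c (z1v u v) (z2v u v) (z3v u v) (z2v u v) (n0 u v)).
- exact: (der_inversion c (z1v u v) (z2v u v) (z3v u v) (z3v u v) (n0 u v)).
Qed.

Lemma fundE_cyclide u v : fundE M u v = c ^+ 4 * b ^+ 2 / n u v ^+ 2.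
Proof.
rewrite /fundE partial_u_cyclide dot_mulmx// dot_vec3 (dot_inversion _ _ _ _ _ _ _ (n0 u v)) -/(n u v).
have -> : - (b * sin u * cos v) * - (b * sin u * cos v) + - (b * sin u * sin v) * - (b * sin u * sin v) + b * cos u * (b * cos u) =
  b ^+ 2 * (cos u ^+ 2 + sin u ^+ 2 * (cos v ^+ 2 + sin v ^+ 2)) by ring.
by rewrite !cos2Dsin2 mulr1 cos2Dsin2 mulr1 (mulrC (b ^+ 2)).
Qed.

Lemma fundF_cyclide u v : fundF M u v = 0.
Proof.
rewrite /fundF partial_u_cyclide partial_v_cyclide dot_mulmx// dot_vec3 (dot_inversion _ _ _ _ _ _ _ (n0 u v)) -/(n u v).
by ring.
Qed.

Lemma fundG_cyclide u v : fundG M u v = c ^+ 4 * b ^+ 2 * k u ^+ 2 / n u v ^+ 2.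
Proof.
rewrite /fundG partial_v_cyclide dot_mulmx// dot_vec3 (dot_inversion _ _ _ _ _ _ _ (n0 u v)) -/(n u v).
have -> : - (b * k u * sin v) * - (b * k u * sin v) + b * k u * cos v * (b * k u * cos v) + 0 * 0 =
  b ^+ 2 * k u ^+ 2 * (cos v ^+ 2 + sin v ^+ 2) by ring.
by rewrite cos2Dsin2; ring.
Qed.

Lemma area_density_cyclide u v : area_density M u v = c ^+ 4 * b ^+ 2 * k u / n u v ^+ 2.
Proof.
rewrite /area_density fundE_cyclide fundF_cyclide fundG_cyclide expr0n/= subr0.
have -> : c ^+ 4 * b ^+ 2 / n u v ^+ 2 * (c ^+ 4 * b ^+ 2 * k u ^+ 2 / n u v ^+ 2) =
  (c ^+ 4 * b ^+ 2 * k u / n u v ^+ 2) ^+ 2 by field; exact: n0.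
rewrite sqrtr_sqr ger0_norm// divr_ge0 ?sqr_ge0// mulr_ge0 ?(ltW (k0 u))// mulr_ge0 ?sqr_ge0//.
by rewrite (_ : 4%N = (2 * 2)%N)// exprM sqr_ge0.
Qed.

(** A function of the angles thus descends to the points of the surface. The squares of the
    coordinates z_i / n sum to 1 / n, so n and then the z_i are determined; the first two, after
    translation, give k by cos^2 + sin^2 = 1, and then the angles. *)
Lemma inverted_inj u v u' v' : M u v = M u' v' ->
  [/\ cos u = cos u', sin u = sin u', cos v = cos v' & sin v = sin v'].
Proof.
rewrite ME => /addrI /(congr1 (fun y => y *m Q^T)); rewrite -!mulmxA QQ !mulmx1 => e.
have e1 : c ^+ 2 * (z1 u v / n u v) = c ^+ 2 * (z1 u' v' / n u' v').
  by have := congr1 (fun y : 'rV[R]_3 => y 0 0) e; rewrite !mxE.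
have e2 : c ^+ 2 * (z2 u v / n u v) = c ^+ 2 * (z2 u' v' / n u' v').
  by have := congr1 (fun y : 'rV[R]_3 => y 0 1) e; rewrite !mxE.
have e3 : c ^+ 2 * (z3 u v / n u v) = c ^+ 2 * (z3 u' v' / n u' v').
  by have := congr1 (fun y : 'rV[R]_3 => y 0 2%:R) e; rewrite !mxE.
have c2 : c ^+ 2 != 0 by rewrite expf_neq0.
move/(mulfI c2): e1 => e1; move/(mulfI c2): e2 => e2; move/(mulfI c2): e3 => e3.
have en : n u v = n u' v'.
  apply: invr_inj.
  have sq x y : (n x y)^-1 = (z1 x y / n x y) ^+ 2 + (z2 x y / n x y) ^+ 2 + (z3 x y / n x y) ^+ 2.
    by have := n0 x y; rewrite /n => h; field; exact: h.
  by rewrite (sq u v) (sq u' v') e1 e2 e3.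
have ni : (n u' v')^-1 != 0 by rewrite invr_eq0.
rewrite en in e1 e2 e3; move/(mulIf ni): e1 => e1; move/(mulIf ni): e2 => e2; move/(mulIf ni): e3 => e3.
have bn : b != 0 by rewrite gt_eqF.
move: e1 e2 e3; rewrite /z1 /z2 /z3 => /addIr e1 /addIr e2 /addIr /(mulfI bn) es.
have ek : k u = k u'.
  apply/eqP; rewrite -(eqrXn2 (n := 2)) ?(ltW (k0 _))//; apply/eqP; apply: (mulfI (expf_neq0 2 bn)).
  have sq x y : b ^+ 2 * k x ^+ 2 = (b * k x * cos y) ^+ 2 + (b * k x * sin y) ^+ 2.
    by rewrite -[LHS]mulr1 -(cos2Dsin2 y); ring.
  by rewrite (sq u v) (sq u' v') e1 e2.
have bk : b * k u' != 0 by rewrite mulf_neq0.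
rewrite ek in e1 e2; move/(mulfI bk): e1 => e1; move/(mulfI bk): e2 => e2.
by split => //; move: ek => /addrI.
Qed.

(** The isothermal coordinate of the ring. This is where a / b = sqrt 2 enters: the Kepler parameter
    is d = 1 because 2 - 1 = 1, so G' is exactly 1 / k while G advances by 2 pi, and the flat torus
    is a square. *)
Local Notation G := (kepler_angle s2 (-1) 1).

Let s20 : 0 < s2. Proof. exact: sqrt2_gt0. Qed.
Let s2E : 1 ^+ 2 = s2 ^+ 2 - (-1) ^+ 2. Proof. by rewrite sqrt2_sqr; ring. Qed.
Let kE u : s2 - -1 * cos u = k u. Proof. by rewrite /k; ring. Qed.

Let derG u : der G u (k u)^-1.
Proof. by have := der_kepler s20 ltr01 s2E u; rewrite kE div1r. Qed.

Let cosG u : k u * cos (G u) = s2 * cos u + 1.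
Proof. by rewrite (cos_sin_kepler s20 ltr01 s2E u).1 kE; field; exact: k1. Qed.

Let sinG u : k u * sin (G u) = sin u.
Proof. by rewrite (cos_sin_kepler s20 ltr01 s2E u).2 kE; field; exact: k1. Qed.

Let G_congr u u' : cos u = cos u' -> sin u = sin u' ->
  cos (G u) = cos (G u') /\ sin (G u) = sin (G u').
Proof.
move=> ec es; have ek : k u = k u' by rewrite /k ec.
by split; apply: (mulfI (k1 u)); rewrite {2}ek ?cosG ?sinG ?ec ?es.
Qed.

(** The inverse of the Kepler substitution is given by the same formulas with the opposite
    eccentricity. Surjectivity provides a point of the surface where the transplanted eigenfunction
    is not 0. *)
Let G_onto th : exists u, cos (G u) = cos th /\ sin (G u) = sin th.
Proof.
have d0 : 0 < s2 - cos th.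
  have := @cos_le1 R th; have : 1 < s2 by rewrite -{1}sqrtr1 ltr_sqrt//; lra.
  lra.
have dn : s2 - cos th != 0 by rewrite gt_eqF.
have [|u [cu su]] := @circle_angle R ((s2 * cos th - 1) / (s2 - cos th)) (sin th / (s2 - cos th)).
  rewrite !expr_div_n sin2cos2 -mulrDl; apply: (mulIf (expf_neq0 2 dn)); rewrite divfK ?expf_neq0// mul1r.
  rewrite !sqrrB exprMn sqrt2_sqr; ring.
have e : k u * (s2 - cos th) = 1.
  rewrite /k cu; transitivity (s2 ^+ 2 - 1); first by field; exact: dn.
  by rewrite sqrt2_sqr; ring.
exists u; split; apply: (mulfI (k1 u)).
  rewrite cosG cu; apply: (mulIf dn); rewrite mulrAC e mul1r.
  transitivity (s2 ^+ 2 * cos th - cos th); first by field; exact: dn.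
  by rewrite sqrt2_sqr; ring.
by rewrite sinG su; apply: (mulIf dn); rewrite divfK// [RHS]mulrAC e mul1r.
Qed.

(** The denominator of inverse stereographic projection: (2 b q, |q|^2 - b^2) / K0 lies on S^3, by
    (|q|^2 - b^2)^2 + 4 b^2 |q|^2 = K0^2. This is the source of al^2 + be^2 = 1. *)
Let K0 := q1 ^+ 2 + q2 ^+ 2 + q3 ^+ 2 + b ^+ 2.
Let K00 : 0 < K0.
Proof. by rewrite ltr_wpDl ?exprn_gt0// !addr_ge0 ?sqr_ge0. Qed.
Let K0n : K0 != 0. Proof. by rewrite gt_eqF. Qed.

(* al = be would mean (r - a)^2 + q3^2 = b^2, with r the distance from the axis to
   the centre of inversion, which would then lie on the ring *)
Lemma cyclide_isothermal : exists al be U0 v0, [/\ 0 <= al, 0 <= be, al != be,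
  al ^+ 2 + be ^+ 2 = 1 &
  forall u v, n u v = K0 * k u * wfun al be (G u - U0) (v - v0)].
Proof.
(* The image of q on S^3 splits into one pair for each angle of the torus. Their polar radii,
   divided by K0 after the factor 2 b is restored in the second, are al and be; the polar angles are
   absorbed by the shifts U0 and v0. *)
have [r1 [U0 [r10 r1E x1 y1]]] := polar_coordinates (q1 ^+ 2 + q2 ^+ 2 + q3 ^+ 2 - b ^+ 2) (2 * b * q3).
have [r2 [v0 [r20 r2E x2 y2]]] := polar_coordinates q1 q2.
have s2s : s2 ^+ 2 = 2 :> R := sqrt2_sqr.
have abE : (r1 / K0) ^+ 2 + (2 * b * r2 / K0) ^+ 2 = 1.
  apply: (mulfI (expf_neq0 2 K0n)); rewrite mulr1.
  transitivity (r1 ^+ 2 + 4 * b ^+ 2 * r2 ^+ 2); first by field; exact: K0n.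
  by rewrite r1E r2E /K0; ring.
exists (r1 / K0), (2 * b * r2 / K0), U0, v0; split => //.
- by rewrite divr_ge0// ltW.
- by rewrite divr_ge0 ?(ltW K00)// !mulr_ge0// ltW.
- apply/eqP => e.
  have h : K0 ^+ 2 = 8 * b ^+ 2 * r2 ^+ 2.
    rewrite e in abE; have := congr1 (fun x => K0 ^+ 2 * x) abE => /=; rewrite mulr1 => <-.
    by field; exact: K0n.
  have h2 : K0 = 2 * s2 * b * r2.
    apply/eqP; rewrite -(eqrXn2 (n := 2)) ?(ltW K00)//; last by rewrite !mulr_ge0// ltW.
    by rewrite h !exprMn s2s; apply/eqP; ring.
  have [|u [cu su]] := @circle_angle R ((r2 - s2 * b) / b) (q3 / b).
    have bn : b != 0 by rewrite gt_eqF.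
    apply: (mulfI (expf_neq0 2 bn)).
    transitivity (r2 ^+ 2 + q3 ^+ 2 - 2 * s2 * b * r2 + s2 ^+ 2 * b ^+ 2); first by field; exact: bn.
    by rewrite -h2 r2E s2s /K0; ring.
  have : n u v0 = 0.
    have bn : b != 0 by rewrite gt_eqF.
    rewrite /n /z1 /z2 /z3 /k cu su x2 y2; field; exact: bn.
  by move/eqP; apply/negP; exact: n0.
- move=> u v; rewrite /wfun !cosB.
  transitivity (K0 * k u * s2 - ((k u * cos (G u)) * (r1 * cos U0) + (k u * sin (G u)) * (r1 * sin U0))
    - 2 * b * k u * (cos v * (r2 * cos v0) + sin v * (r2 * sin v0))); last by field; exact: K0n.
  rewrite -x1 -y1 -x2 -y2 cosG sinG.
  have -> : n u v = b ^+ 2 * k u ^+ 2 * (cos v ^+ 2 + sin v ^+ 2) + b ^+ 2 * sin u ^+ 2 + (q1 ^+ 2 + q2 ^+ 2 + q3 ^+ 2)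
    - 2 * b * q3 * sin u - 2 * b * k u * (cos v * q1 + sin v * q2) by rewrite /n /z1 /z2 /z3; ring.
  rewrite cos2Dsin2 sin2cos2 /K0 /k.
  have -> : b ^+ 2 * (s2 + cos u) ^+ 2 * 1 = b ^+ 2 * (s2 ^+ 2 + 2 * s2 * cos u + cos u ^+ 2) by ring.
  have -> : (q1 ^+ 2 + q2 ^+ 2 + q3 ^+ 2 + b ^+ 2) * (s2 + cos u) * s2 =
    (q1 ^+ 2 + q2 ^+ 2 + q3 ^+ 2 + b ^+ 2) * (s2 ^+ 2 + s2 * cos u) by ring.
  by rewrite s2s; ring.
Qed.

(** In the isothermal coordinates the metric is c^4 b^2 / K0^2 times the model metric w^(-2) (dU^2 +
    dv^2). The factor cancels in the product of eigenvalue and area, which is \int w^(-2) / S. *)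
Theorem cyclide_small_eigenvalue : 0 < area M /\
  exists lam, [/\ is_eigenvalue M lam, lam != 0 & lam * area M < 4 * pi ^+ 2].
Proof.
have [al [be [U0 [v0 [al0 be0 albe abE nE]]]]] := cyclide_isothermal.
have [S [F [S1 S0 [dF cF eF [u1 [v1 F1]] pF]]]] := flat_eigenfunction_exists al0 be0 albe abE.
have ab : al + be < s2.
  move: albe; rewrite neq_lt => /orP[lt|lt]; last exact: ab_lt_sqrt2.
  by rewrite addrC; apply: ab_lt_sqrt2 => //; rewrite addrC.
have w0 u v : wfun al be u v != 0 by rewrite gt_eqF// wfun_gt0.
have cr : cont2 (conf_weight al be) by exact: cont2_conf_weight.
have bn : b != 0 by rewrite gt_eqF.
pose phi u := G u - U0.
pose psi v := v - v0.
pose ka u := (k u)^-1.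
have dk u : der k u (- sin u) by rewrite /k; derq; ring.
have dka u : der ka u (sin u * ka u ^+ 2).
  by apply: der_eq (derV (k1 u) (dk u)) _; rewrite /ka mulNr opprK exprVn.
have dphi u : der phi u (ka u) by rewrite /phi; derq; rewrite addr0.
have dpsi v : der psi v 1 by rewrite /psi; derq; rewrite addr0.
have cka : continuous ka by apply: der_cont => u; eexists; exact: dka.
have cphi : continuous phi by apply: der_cont => u; eexists; exact: dphi.
have cpsi : continuous psi by apply: der_cont => u; eexists; exact: dpsi.
(* [is_eigenvalue] differentiates in the angles of the ring, not in the isothermal ones, so the flat
   eigenfunction is pulled back by [phi] and [psi], and each derivative in u brings a factor [ka] =
   1 / k. *)
pose H i j u v := F i j (phi u) (psi v).
have cH i j : (i + j <= 3)%N -> cont2 (H i j) by move=> ij; apply: cont2_comp => //; exact: cF.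
have Hu i j u v : (i + j <= 2)%N -> der (fun s => H i j s v) u (H i.+1 j u v * ka u).
  by move=> ij; exact: (@der_comp _ (fun x => F i j x (psi v)) _ _ _ _ (dphi u) (dF i j _ _ ij).1).
have Hv i j u v : (i + j <= 2)%N -> der (fun s => H i j u s) v (H i j.+1 u v).
  move=> ij; rewrite -[H i j.+1 u v]mulr1; exact: (@der_comp _ (fun x => F i j (phi u) x) _ _ _ _ (dpsi v) (dF i j _ _ ij).2).
have c2ka : cont2 (fun u _ : R => ka u) by exact: cont2_fst.
have c2ka' : cont2 (fun u _ : R => sin u * ka u ^+ 2).
  by apply: cont2M; [apply: cont2_fst; exact: continuous_sin|exact: cont2X].
have classH : classC 2 (H 0 0).
  apply: (@classC_succ _ _ _ (fun u v => H 1 0 u v * ka u) (H 0 1)).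
  - exact: cH.
  - by move=> u v; exact: Hu.
  - by move=> u v; exact: Hv.
  - apply: (@classC_succ _ _ _ (fun u v => (H 2 0 u v * ka u) * ka u + H 1 0 u v * (sin u * ka u ^+ 2)) (fun u v => H 1 1 u v * ka u)).
    + by apply: cont2M => //; exact: cH.
    + by move=> u v; apply: derM; [exact: Hu|exact: dka].
    + by move=> u v; derq; [exact: Hv|rewrite mulr0 addr0].
    + apply: classC0; apply: cont2D; apply: cont2M => //; last exact: cH.
      by apply: cont2M => //; exact: cH.
    + by apply: classC0; apply: cont2M => //; exact: cH.
  - apply: (@classC_succ _ _ _ (fun u v => H 1 1 u v * ka u) (H 0 2)).
    + exact: cH.
    + by move=> u v; exact: Hu.
    + by move=> u v; exact: Hv.
    + by apply: classC0; apply: cont2M => //; exact: cH.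
    + by apply: classC0; exact: cH.
have dU : partial_u (H 0 0) = fun u v => H 1 0 u v * ka u.
  by apply/funext => u; apply/funext => v; apply: derive1_der; exact: Hu.
have dV : partial_v (H 0 0) = H 0 1.
  by apply/funext => u; apply/funext => v; apply: derive1_der; exact: Hv.
have LB u v : laplace_beltrami M (H 0 0) u v = K0 ^+ 2 / (c ^+ 4 * b ^+ 2 * S) * H 0 0 u v.
  rewrite /laplace_beltrami dU dV.
  have -> : (fun s r => (fundG M s r * (H 1 0 s r * ka s) - fundF M s r * H 0 1 s r) / area_density M s r) = H 1 0.
    apply/funext => s; apply/funext => r; rewrite fundG_cyclide fundF_cyclide area_density_cyclide /ka.
    by field; rewrite c0 bn k1 n0.
  have -> : (fun s r => (fundE M s r * H 0 1 s r - fundF M s r * (H 1 0 s r * ka s)) / area_density M s r) = fun s r => H 0 1 s r * ka s.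
    apply/funext => s; apply/funext => r; rewrite fundE_cyclide fundF_cyclide area_density_cyclide /ka.
    by field; rewrite c0 bn k1 n0.
  have -> : partial_u (H 1 0) u v = H 2 0 u v * ka u by apply: derive1_der; exact: Hu.
  have -> : partial_v (fun s r => H 0 1 s r * ka s) u v = H 0 2 u v * ka u.
    by apply: derive1_der; derq; [exact: Hv|rewrite mulr0 addr0].
  rewrite area_density_cyclide nE -/(phi u) -/(psi v).
  have := eF (phi u) (psi v); rewrite -/(H 2 0 u v) -/(H 0 2 u v) -/(H 0 0 u v) /conf_weight => e.
  have -> : H 0 0 u v = S * - (H 2 0 u v + H 0 2 u v) * wfun al be (phi u) (psi v) ^+ 2.
    by rewrite e; field; exact: w0.
  rewrite /ka; field.
  by rewrite c0 bn k1 K0n w0 gt_eqF.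
have areaE : area M = c ^+ 4 * b ^+ 2 / K0 ^+ 2 * I2 (conf_weight al be).
  transitivity (I2 (fun u v => c ^+ 4 * b ^+ 2 / K0 ^+ 2 * (conf_weight al be (phi u) (psi v) * (ka u * 1)))).
    apply: I2_ext => u v; rewrite area_density_cyclide nE -/(phi u) -/(psi v) /conf_weight /ka.
    by field; rewrite k1 K0n w0.
  rewrite I2Z; last by apply: cont2M; [exact: cont2_comp|apply: cont2M => //; exact: cont2_cst].
  congr (_ * _); apply: (I2_subst (dpsi := fun _ => 1)) => //.
  - by move=> u v; rewrite /conf_weight /wfun (mulrC 2) mulr_natr cosD2pi.
  - by move=> u v; rewrite /conf_weight /wfun (mulrC 2) mulr_natr cosD2pi.
  - exact: cont_cst.
  - by rewrite /phi kepler_2pi addrAC.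
  - by rewrite /psi sub0r addrC.
have I0 : 0 < I2 (conf_weight al be).
  have W0 : 0 < s2 + al + be by rewrite -addrA ltr_pwDl// addr_ge0.
  have H0 : 0 < (s2 + al + be)^-1 ^+ 2 * (2 * pi) ^+ 2.
    by rewrite mulr_gt0// exprn_gt0 ?invr_gt0// two_pi_gt0.
  apply: lt_le_trans H0 _; rewrite -I2_cst; apply: le_I2 => //; first exact: cont2_cst.
  move=> u v _ _; rewrite /conf_weight lerXn2r ?nnegrE ?invr_ge0 ?(ltW (wfun_gt0 _ _ _ _ _))// ?(ltW W0)//.
  rewrite lef_pV2 ?posrE ?wfun_gt0//.
  have cu := @cos_geN1 R u; have cv := @cos_geN1 R v; rewrite /wfun; nra.
have C0 : 0 < c ^+ 4 * b ^+ 2 / K0 ^+ 2.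
  have c4 : 0 < c ^+ 4 by rewrite exprn_even_gt0.
  by apply: divr_gt0; [apply: mulr_gt0 => //|]; exact: exprn_gt0.
split; first by rewrite areaE mulr_gt0.
exists (K0 ^+ 2 / (c ^+ 4 * b ^+ 2 * S)); split.
(* An eigenfunction must be defined on points of E^3. On the surface the set has exactly one element
   by [inverted_inj] and the periodicity of F; elsewhere [f] takes the default 0. *)
- pose f y := xget 0 [set z | exists u v, y = M u v /\ z = H 0 0 u v].
  have fM : (fun u v => f (M u v)) = H 0 0.
    apply/funext => u; apply/funext => v; rewrite /f; apply: xget_unique; first by exists u, v.
    move=> z [u' [v' [e ->]]]; have [e1 e2 e3 e4] := inverted_inj e; rewrite /H.
    have [g1 g2] := G_congr e1 e2.
    by apply: pF; rewrite /phi /psi ?cosB ?sinB ?e3 ?e4 ?g1 ?g2.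
  exists f => h; have -> : h = H 0 0 by exact: fM.
  split; [exact: classH| |exact: LB].
    (* The preimage, modulo 2 pi, of the point (u1, v1) where the flat eigenfunction is not 0. *)
    have [u [g1 g2]] := G_onto (u1 + U0).
    exists (M u (v1 + v0)); first by exists u, (v1 + v0).
    have := congr1 (fun h => h u (v1 + v0)) fM => ->.
    rewrite (_ : H 0 0 u (v1 + v0) = F 0 0 u1 v1)// /H; apply: pF.
    - by rewrite /phi cosB g1 g2 -cosB addrK.
    - by rewrite /phi sinB g1 g2 -sinB addrK.
    - by rewrite /psi addrK.
    - by rewrite /psi addrK.
- by rewrite mulf_neq0 ?invr_eq0 ?expf_neq0// ?mulf_neq0 ?expf_neq0// gt_eqF.
- rewrite areaE.
  have -> : K0 ^+ 2 / (c ^+ 4 * b ^+ 2 * S) * (c ^+ 4 * b ^+ 2 / K0 ^+ 2 * I2 (conf_weight al be)) = I2 (conf_weight al be) / S.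
    by field; rewrite c0 bn K0n gt_eqF.
  by rewrite ltr_pdivrMr//; move: S1; rewrite exprMn -natrX.
Qed.

End cyclide.

Theorem mainTheorem2 (R : realType) (a b : R) (Q : 'M[R]_3) (t : 'rV[R]_3)
    (p : 'rV[R]_3) (c : R) (lambda1 : R) :
  0 < b -> b < a -> a / b = Num.sqrt 2 ->
  Q *m Q^T = 1%:M ->
  c != 0 ->
  let T := anchor_ring a b Q t in
  ~ surface T p ->
  let M := inverted p c T in
  is_first_nonzero_eigenvalue M lambda1 ->
  lambda1 < 4 * pi ^+ 2 / area M.
Proof.
move=> b0 _ abE QQ c0.
have -> : a = Num.sqrt 2 * b by rewrite -abE divfK// gt_eqF.
move=> T pT M [_ _ least].
have [A0 [lam [eig lam0 small]]] := cyclide_small_eigenvalue b0 c0 QQ pT.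
by apply: le_lt_trans (least _ eig lam0) _; rewrite ltr_pdivlMr.
Qed.
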